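(* Consider the $N$ Euler-Lagrange agents $$\mathcal{M}_i(q_i)\ddot q_i+\mathcal{C}_i(q_i,\dot q_i)\dot q_i+G_i(q_i)=\tau_i+d_i,\qquad i=1,\dots,N,$$ with the structural properties and disturbances described in the context, and suppose that the directed communication graph $\mathcal{G}$ contains a spanning tree. Let each agent use the distributed dynamic control law \begin{align*} \dot S_i&=\mu_1\sum_{j\in\mathcal{N}_i}a_{ij}(S_j-S_i),\\ \dot\eta_i&=S_i\eta_i+\mu_2\sum_{j\in\mathcal{N}_i}a_{ij}(\eta_j-\eta_i),\\ \dot\xi_i&=M_i\xi_i+N_i\tau_i,\\ \dot\zeta_i&=M_i\zeta_i+P_i,\\ \dot{\hat\omega}_i&=\Lambda_i^{-1}\rho_i^{T}s_i,\\ \tau_i&=-K_is_i-\rho_i\hat\omega_i+A_i\xi_i, \end{align*} where $s_i,P_i,\rho_i,A_i,M_i,N_i,K_i,\Lambda_i$ are as defined in the context, $\mu_1,\mu_2>0$ are sufficiently large (depending on the graph and on $S_1(0),\dots,S_N(0)$), and the observer initial conditions $S_i(0),\eta_i(0)$ are such that the function $t\mapsto S^*e^{S^*t}\chi^*$ defined in the context is bounded on $[0,\infty)$. Then this control law solves the leaderless consensus problem. That is, for any external disturbances with arbitrary $\psi_{is,0},\phi_{is,k}\in\mathbb{R}$ and $\psi_{is,k},\sigma_{is,k}>0$, and for arbitrary initial conditions $q_i(0),\dot q_i(0)\in\mathbb{R}^n$, the trajectories $q_i(t)$ and $\dot q_i(t)$ exist and are bounded for all $t\ge 0$, and $$\lim_{t\to\infty}(q_i(t)-q_j(t))=0,\qquad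 \lim_{t\to\infty}(\dot q_i(t)-\dot q_j(t))=0\qquad\text{for all } i,j.$$
   Context: **Notation.** $\mathrm{col}(X_1,\dots,X_m)$ and $\mathrm{row}(X_1,\dots,X_m)$ denote vertical and horizontal stacking; $\otimes$ is the Kronecker product. **Agents.** $q_i\in\mathbb{R}^n$ are generalized coordinates, $\mathcal{M}_i(q_i)\in\mathbb{R}^{n\times n}$ is the inertia matrix, $\mathcal{C}_i(q_i,\dot q_i)\dot q_i\in\mathbb{R}^n$ the Coriolis and centripetal forces, $G_i(q_i)\in\mathbb{R}^n$ the gravitational force, $\tau_i\in\mathbb{R}^n$ the control torque, and $d_i\in\mathbb{R}^n$ the disturbance. Standing properties: (1) $\mathcal{M}_i(q_i)$ is symmetric with $k_{\underline m}I\le\mathcal{M}_i(q_i)\le k_{\overline m}I$, $\|\mathcal{C}_i(q_i,\dot q_i)\|\le k_c\|\dot q_i\|$, and $\|G_i(q_i)\|\le k_g$, for some positive scalars $k_{\underline m},k_{\overline m},k_c,k_g$. (2) For all $x,y\in\mathbb{R}^n$, $\mathcal{M}_i(q_i)x+\mathcal{C}_i(q_i,\dot q_i)y+G_i(q_i)=Y_i(q_i,\dot q_i,x,y)\Theta_i$, where $Y_i\in\mathbb{R}^{n\times p}$ is a known regression matrix and $\Theta_i\in\mathbb{R}^p$ is a constant vector of uncertain parameters. (3) $\dot{\mathcal{M}}_i(q_i)-2\mathcal{C}_i(q_i,\dot q_i)$ is skew symmetric for all $q_i,\dot q_i$. **Disturbances.** $d_i=\mathrm{col}(d_{i1},\dots,d_{in})$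 with $d_{is}(t)=\psi_{is,0}+\sum_{k=1}^{n_{is}}\psi_{is,k}\sin(\sigma_{is,k}t+\phi_{is,k})$, where all constants $\psi_{is,0},\psi_{is,k},\sigma_{is,k},\phi_{is,k}$ are unknown to the controller. Let $\sigma_i$ collect all frequencies of agent $i$ and $\sigma_{is}$ those of $d_{is}$. **Graph.** $\mathcal{G}$ is a static directed graph on $\{1,\dots,N\}$ with adjacency matrix $[a_{ij}]$, $a_{ij}>0$ if $(j,i)$ is an edge and $a_{ij}=0$ otherwise; $\mathcal{N}_i=\{j:(j,i)\text{ is an edge}\}$; $\mathcal{L}$ is the Laplacian matrix (diagonal entries $\sum_{j\neq i}a_{ij}$, off-diagonal entries $-a_{ij}$). A spanning tree means a directed spanning tree: some node has a directed path to every other node. **Observer and standing assumption.** $S_i(t)\in\mathbb{R}^{n\times n}$ and $\eta_i(t)\in\mathbb{R}^n$. Let $u^T=(u_1,\dots,u_N)$ be the left eigenvector of $\mathcal{L}$ for the eigenvalue $0$ normalized by $\sum_iu_i=1$, and $S^*=\sum_{i=1}^Nu_iS_i(0)$. Let $\chi^*\in\mathbb{R}^n$ be the common limit $\chi^*=\lim_{t\to\infty}e^{-S^*t}\eta_i(t)$ (independent of $i$; it exists for sufficiently large $\mu_1,\mu_2$). The common trajectory is $e^{S^*t}\chi^*$, and it is assumed that its derivative $S^*e^{S^*t}\chi^*$ is bounded for $t\ge0$. **Internal model.** For each $i,s$ there are a positive integer $r_{is}$ and real numbers $c_{is,1},\dots,c_{is,r_{is}}$ (possibly depending on $\sigma_{is}$)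 with $d_{is}^{(r_{is})}=c_{is,1}d_{is}+c_{is,2}\dot d_{is}+\dots+c_{is,r_{is}}d_{is}^{(r_{is}-1)}$. Let $\Phi_{is}^{\sigma_{is}}\in\mathbb{R}^{r_{is}\times r_{is}}$ be the companion matrix with ones on the superdiagonal, last row $(c_{is,1},\dots,c_{is,r_{is}})$ and zeros elsewhere, and $\Psi_{is}=(1,0,\dots,0)\in\mathbb{R}^{1\times r_{is}}$. Choose $M_{is}\in\mathbb{R}^{r_{is}\times r_{is}}$ Hurwitz and $N_{is}\in\mathbb{R}^{r_{is}}$ with $(M_{is},N_{is})$ controllable, and let $T_{is}^{\sigma_{is}}$ be the nonsingular solution of $T_{is}^{\sigma_{is}}\Phi_{is}^{\sigma_{is}}-M_{is}T_{is}^{\sigma_{is}}=N_{is}\Psi_{is}$. Let $\Psi_i,M_i,N_i,T_i^{\sigma_i}$ be the block-diagonal matrices with diagonal blocks $\Psi_{is},M_{is},N_{is},T_{is}^{\sigma_{is}}$, $s=1,\dots,n$, and $n_i=\sum_{s=1}^nr_{is}$. Let $A_i=\Psi_i(T_i^0)^{-1}$, where $T_i^0$ is a fixed (nominal) nonsingular $n_i\times n_i$ matrix, $B_i=\Psi_i(T_i^{\sigma_i})^{-1}$ and $E_i^{\sigma_i}=A_i-B_i\in\mathbb{R}^{n\times n_i}$. Write $E_i^{\sigma_i}=\sum_{j=1}^{l}E_{ij}\varrho_{ij}$ for some integer $l\ge1$, with known constant matrices $E_{ij}\in\mathbb{R}^{n\times n_i}$ and unknown scalars $\varrho_{ij}$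 that are smooth functions of $\sigma_i$. For a matrix or vector $Z$ with $n_i$ rows put $E_i\circ Z=\mathrm{row}(E_{i1}Z,\dots,E_{il}Z)$. **Controller signals.** $\xi_i\in\mathbb{R}^{n_i}$, $\zeta_i\in\mathbb{R}^{n_i\times p}$, $\hat\omega_i\in\mathbb{R}^{p+lp+l}$. With a constant $\alpha>0$, $$\dot q_{ri}=S_i\eta_i-\alpha(q_i-\eta_i),\quad \ddot q_{ri}=\dot S_i\eta_i+S_i\dot\eta_i-\alpha(\dot q_i-\dot\eta_i),\quad s_i=\dot q_i-\dot q_{ri}.$$ The known regression matrices (not depending on $\Theta_i$) $L_i=L_i(q_i,s_i)\in\mathbb{R}^{n\times p}$, $P_i=P_i(q_i,\dot q_i,s_i)\in\mathbb{R}^{n_i\times p}$, $Q_i=Q_i(q_i,\dot q_i,s_i)\in\mathbb{R}^{n\times p}$ (the last two also depending on $\dot q_{ri},\ddot q_{ri}$) are those satisfying \begin{align*} L_i\Theta_i&=\mathcal{M}_i(q_i)s_i,\\ P_i\Theta_i&=M_iN_i\mathcal{M}_i(q_i)s_i+N_i\mathcal{C}_i(q_i,\dot q_i)s_i-N_i\dot{\mathcal{M}}_i(q_i)s_i+N_iY_i(q_i,\dot q_i,\dot q_{ri},\ddot q_{ri})\Theta_i,\\ Q_i\Theta_i&=A_iN_i\mathcal{M}_i(q_i)s_i-Y_i(q_i,\dot q_i,\dot q_{ri},\ddot q_{ri})\Theta_i, \end{align*} where, by property (2) with $(x,y)=(\ddot q_{ri},\dot q_{ri})$, $Y_i(q_i,\dot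 q_i,\dot q_{ri},\ddot q_{ri})\Theta_i$ denotes $\mathcal{M}_i(q_i)\ddot q_{ri}+\mathcal{C}_i(q_i,\dot q_i)\dot q_{ri}+G_i(q_i)$. Finally $$\rho_i=\mathrm{row}\big(A_i\zeta_i+Q_i,\;E_i\circ[\zeta_i+N_iL_i],\;E_i\circ\xi_i\big)\in\mathbb{R}^{n\times(p+lp+l)},$$ $K_i\in\mathbb{R}^{n\times n}$ is a positive definite matrix and $\Lambda_i$ is a positive definite diagonal matrix. The initial values $\xi_i(0),\zeta_i(0),\hat\omega_i(0)$ are arbitrary.
   Formalization: Besides its derivative, the common trajectory e^{S*t}χ* itself is assumed bounded (for a ramp S*e^{S*t}χ* is bounded but q_i is not); also M_i is assumed differentiable and C_i, G_i, L_i, P_i, Q_i continuous, as existence of trajectories requires. *)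

(* Defs.v *)
From HB Require Import structures.
From mathcomp Require Import all_boot all_order all_algebra.
From mathcomp Require Import all_classical all_reals all_analysis.
From mathcomp Require Import complex.
Import Order.TTheory GRing.Theory Num.Theory numFieldNormedType.Exports.

Set Implicit Arguments.
Unset Strict Implicit.
Unset Printing Implicit Defensive.

Local Open Scope classical_set_scope.
Local Open Scope ring_scope.

(* The norm `|x| of a vector or a matrix is the max-entry norm; every use below
   is a bound by an unspecified constant, so the choice of norm on a
   finite-dimensional space is immaterial. *)

Section Matrices.
Variable R : realType.

Definition qform n (A : 'M[R]_n) (x : 'cV[R]_n) : R := (x^T *m A *m x) 0 0.

(* Symmetry is not required. *)
Definition posdef n (A : 'M[R]_n) : Prop := forall x, x != 0 -> 0 < qform A x.

Definition skew_symmetric n (A : 'M[R]_n) : Prop := A^T = - A.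

Definition hurwitz n (A : 'M[R]_n) : Prop :=
  forall z : R[i], eigenvalue (map_mx (real_complex R) A) z -> complex.Re z < 0.

(* Kalman rank condition on [B, A B, ..., A^(n-1) B]. *)
Definition controllable n m (A : 'M[R]_n) (B : 'M[R]_(n, m)) : Prop :=
  \rank (\mxrow_(k < n) (A ^+ k *m B)) = n.

Definition expmx n (A : 'M[R]_n) : 'M[R]_n :=
  limn (series (fun k => (k`!%:R : R)^-1 *: A ^+ k)).

(* Ones on the superdiagonal and last row c (the library's companionmx is
   indexed by a polynomial). *)
Definition companion r (c : 'rV[R]_r) : 'M[R]_r :=
  \matrix_(i, j) if i.+1 == r then c 0 j else (i.+1 == j :> nat)%:R.

Definition first_row r : 'rV[R]_r := \row_j (j == 0 :> nat)%:R.

Definition bounded_on_halfline m n (x : R -> 'M[R]_(m, n)) : Prop :=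
  exists B : R, forall t, 0 <= t -> `|x t| <= B.

(* x' = xdot on [0, +oo[ and x(0) = x0.  The values of x at t < 0 are
   irrelevant: x is only required to be right-continuous at 0. *)
Definition ivp m n (x xdot : R -> 'M[R]_(m, n)) (x0 : 'M[R]_(m, n)) : Prop :=
  [/\ {within `[0, +oo[, continuous x},
      forall t : R, 0 < t -> is_derive t (1 : R) x (xdot t) &
      x 0 = x0].

Definition positive_orthant k : set 'rV[R]_k := [set x | forall j, 0 < x 0 j].

Definition iterated_partial k (f : 'rV[R]_k -> R) (js : seq 'I_k)
    : 'rV[R]_k -> R :=
  foldr (fun j (g : 'rV[R]_k -> R) =>
           (fun x => 'D_(delta_mx 0 j : 'rV[R]_k) g x)) f js.

(* Class C^oo, for D open: differentiability of every iterated partial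
   derivative also gives their continuity. *)
Definition smooth_on k (D : set 'rV[R]_k) (f : 'rV[R]_k -> R) : Prop :=
  forall js x, D x -> differentiable (iterated_partial f js) x.

End Matrices.

Section Graph.
Variables (R : realType) (N : nat).

(* e j i means that (j, i) is an edge, i.e. that i receives from j. *)
Definition adjacency (e : rel 'I_N) (a : 'M[R]_N) : Prop :=
  forall i j, (e j i -> 0 < a i j) /\ (~~ e j i -> a i j = 0).

Definition laplacian (a : 'M[R]_N) : 'M[R]_N :=
  \matrix_(i, j) if i == j then \sum_(k | k != i) a i k else - a i j.

Definition has_spanning_tree (e : rel 'I_N) : Prop :=
  exists k, forall i, connect e k i.

End Graph.

Section Observer.
Variables (R : realType) (N n : nat) (e : rel 'I_N) (a : 'M[R]_N).
Variables (mu1 mu2 : R).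

Definition S_rhs (S : 'I_N -> 'M[R]_n) (i : 'I_N) : 'M[R]_n :=
  mu1 *: \sum_(j | e j i) a i j *: (S j - S i).

Definition eta_rhs (S : 'I_N -> 'M[R]_n) (eta : 'I_N -> 'cV[R]_n) (i : 'I_N)
    : 'cV[R]_n :=
  S i *m eta i + mu2 *: \sum_(j | e j i) a i j *: (eta j - eta i).

Definition observer (S0 : 'I_N -> 'M[R]_n) (eta0 : 'I_N -> 'cV[R]_n)
    (S : 'I_N -> R -> 'M[R]_n) (eta : 'I_N -> R -> 'cV[R]_n) : Prop :=
  forall i, ivp (S i) (fun t => S_rhs (S^~ t) i) (S0 i) /\
    ivp (eta i) (fun t => eta_rhs (S^~ t) (eta^~ t) i) (eta0 i).

(* chi is the common limit of exp(- Sstar t) eta_i(t). *)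
Definition common_limit (Sstar : 'M[R]_n) (S0 : 'I_N -> 'M[R]_n)
    (eta0 : 'I_N -> 'cV[R]_n) (chi : 'cV[R]_n) : Prop :=
  exists S eta, observer S0 eta0 S eta /\
    forall i, expmx (- (t *: Sstar)) *m eta i t @[t --> +oo] --> chi.

(* Its derivative is Sstar *m common_trajectory Sstar chi t.  That the derivative
   is bounded does not make the trajectory bounded (a nilpotent Sstar gives a
   ramp), whereas bounded q_i force a bounded common trajectory because q_i is
   asymptotic to it; both bounds are therefore separate hypotheses. *)
Definition common_trajectory (Sstar : 'M[R]_n) (chi : 'cV[R]_n) (t : R)
    : 'cV[R]_n :=
  expmx (t *: Sstar) *m chi.

End Observer.

Section Agents.
Variables (R : realType) (n p : nat).

Record agent := Agent {
  inertia : 'cV[R]_n -> 'M[R]_n;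
  coriolis : 'cV[R]_n -> 'cV[R]_n -> 'M[R]_n;
  gravity : 'cV[R]_n -> 'cV[R]_n;
  regressor : 'cV[R]_n -> 'cV[R]_n -> 'cV[R]_n -> 'cV[R]_n -> 'M[R]_(n, p);
  theta : 'cV[R]_p }.

Variable g : agent.

(* Time derivative of inertia (q t) along a motion with velocity v. *)
Definition inertia_dot (q v : 'cV[R]_n) : 'M[R]_n := 'D_v (inertia g) q.

Definition el_bounds : Prop :=
  exists km kM kc kg : R, [/\ 0 < km, 0 < kM, 0 < kc & 0 < kg] /\
  forall q v : 'cV[R]_n,
    [/\ (inertia g q)^T = inertia g q,
        forall x : 'cV[R]_n,
          km * (x^T *m x) 0 0 <= qform (inertia g q) x <= kM * (x^T *m x) 0 0,
        `|coriolis g q v| <= kc * `|v| &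
        `|gravity g q| <= kg].

(* Linearity in the parameters: x plays the role of an acceleration and y that
   of a velocity. *)
Definition el_linear : Prop :=
  forall q v x y : 'cV[R]_n,
    inertia g q *m x + coriolis g q v *m y + gravity g q
      = regressor g q v x y *m theta g.

Definition el_skew : Prop :=
  forall q v : 'cV[R]_n,
    skew_symmetric (inertia_dot q v - 2%:R *: coriolis g q v).

(* Least regularity for which the equations of motion make sense and have
   solutions: the derivative of the inertia matrix exists and the data are
   continuous (that derivative is then continuous by el_skew). *)
Definition el_regular : Prop :=
  [/\ forall q, differentiable (inertia g) q,
      continuous (fun z : 'cV[R]_n * 'cV[R]_n => coriolis g z.1 z.2) &
      continuous (gravity g)].

Definition euler_lagrange : Prop :=
  [/\ el_regular, el_bounds, el_linear & el_skew].

End Agents.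

Definition sinusoids (R : realType) k (psi0 : R) (psi sigma phi : 'rV[R]_k)
    (t : R) : R :=
  psi0 + \sum_(j < k) psi 0 j * sin (sigma 0 j * t + phi 0 j).

Section InternalModel.
Variables (R : realType) (n l : nat).

(* The controller design of one agent for all disturbances with im_freqs s
   sinusoids in channel s.  im_rec (the recurrence coefficients), im_T and
   im_varrho are functions of the frequencies; the rest is constant. *)
Record internal_model := InternalModel {
  im_freqs : 'I_n -> nat;
  im_order : 'I_n -> nat;
  im_rec : forall s, 'rV[R]_(im_freqs s) -> 'rV[R]_(im_order s);
  im_M : forall s, 'M[R]_(im_order s);
  im_N : forall s, 'cV[R]_(im_order s);
  im_T : forall s, 'rV[R]_(im_freqs s) -> 'M[R]_(im_order s);
  im_T0 : 'M[R]_(\sum_s im_order s);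
  im_E : 'I_l -> 'M[R]_(n, \sum_s im_order s);
  im_varrho : 'I_l -> 'rV[R]_(\sum_s im_freqs s) -> R }.

End InternalModel.

Arguments im_rec {R n l} _ {s} _.
Arguments im_M {R n l} _ s.
Arguments im_N {R n l} _ s.
Arguments im_T {R n l} _ {s} _.
Arguments im_E {R n l} _ _.
Arguments im_varrho {R n l} _ _ _.

Section InternalModelTheory.
Variables (R : realType) (n l : nat) (m : internal_model R n l).

Definition im_dim : nat := (\sum_s im_order m s)%N.

(* Block-diagonal with 1 x r_s blocks. *)
Definition Psi_blk : 'M[R]_(n, im_dim) :=
  \mxrow_s (delta_mx s (0 : 'I_1) *m first_row R (im_order m s)).

(* Block-diagonal with r_s x 1 blocks. *)
Definition N_blk : 'M[R]_(im_dim, n) :=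
  \mxcol_s (im_N m s *m delta_mx (0 : 'I_1) s).

Definition M_blk : 'M[R]_im_dim := \mxdiag_s im_M m s.

Definition T_blk (sigma : 'rV[R]_(\sum_s im_freqs m s)) : 'M[R]_im_dim :=
  \mxdiag_s im_T m (submxrow sigma s).

Definition A_blk : 'M[R]_(n, im_dim) := Psi_blk *m invmx (im_T0 m).

Definition B_blk (sigma : 'rV[R]_(\sum_s im_freqs m s)) : 'M[R]_(n, im_dim) :=
  Psi_blk *m invmx (T_blk sigma).

Definition im_recurrence s : Prop :=
  forall (psi0 : R) (psi sigma phi : 'rV[R]_(im_freqs m s)),
    positive_orthant psi -> positive_orthant sigma ->
    let d := sinusoids psi0 psi sigma phi in
    forall t : R, derive1n (im_order m s) d t
      = \sum_(j < im_order m s) im_rec m sigma 0 j * derive1n j d t.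

Definition im_sylvester s : Prop :=
  forall sigma : 'rV[R]_(im_freqs m s), positive_orthant sigma ->
    im_T m sigma \in unitmx /\
    im_T m sigma *m companion (im_rec m sigma) - im_M m s *m im_T m sigma
      = im_N m s *m first_row R (im_order m s).

Definition im_decomposition : Prop :=
  (forall j, smooth_on (@positive_orthant R _) (im_varrho m j)) /\
  forall sigma, positive_orthant sigma ->
    A_blk - B_blk sigma = \sum_(j < l) im_varrho m j sigma *: im_E m j.

Definition internal_model_design : Prop :=
  [/\ forall s, (0 < im_order m s)%N /\ im_recurrence s,
      forall s, hurwitz (im_M m s) /\ controllable (im_M m s) (im_N m s),
      forall s, im_sylvester s,
      im_T0 m \in unitmx &
      im_decomposition].

(* row(E_1 Z, ..., E_l Z); its number of columns \sum_(j < l) q is l * q. *)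
Definition E_row q (Z : 'M[R]_(im_dim, q)) : 'M[R]_(n, \sum_(j < l) q) :=
  \mxrow_(j < l) (im_E m j *m Z).

Record disturbance := Disturbance {
  d_bias : 'I_n -> R;
  d_amp : forall s, 'rV[R]_(im_freqs m s);
  d_freq : 'rV[R]_(\sum_s im_freqs m s);
  d_phase : forall s, 'rV[R]_(im_freqs m s) }.

Definition disturbance_signal (d : disturbance) (t : R) : 'cV[R]_n :=
  \col_s sinusoids (d_bias d s) (d_amp d s) (submxrow (d_freq d) s)
                   (d_phase d s) t.

Definition disturbance_positive (d : disturbance) : Prop :=
  (forall s, positive_orthant (d_amp d s)) /\ positive_orthant (d_freq d).

End InternalModelTheory.

Section Controller.
Variables (R : realType) (n p l : nat) (g : agent R n p).
Variable m : internal_model R n l.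

Definition omega_dim : nat := (p + \sum_(j < l) p + \sum_(j < l) 1)%N.

(* The last two arguments of ct_P and ct_Q are the reference velocity and the
   reference acceleration. *)
Record controller := Controller {
  ct_K : 'M[R]_n;
  ct_Lambda : 'M[R]_omega_dim;
  ct_L : 'cV[R]_n -> 'cV[R]_n -> 'M[R]_(n, p);
  ct_P : 'cV[R]_n -> 'cV[R]_n -> 'cV[R]_n -> 'cV[R]_n -> 'cV[R]_n ->
         'M[R]_(im_dim m, p);
  ct_Q : 'cV[R]_n -> 'cV[R]_n -> 'cV[R]_n -> 'cV[R]_n -> 'cV[R]_n ->
         'M[R]_(n, p) }.

Variable c : controller.

Definition regression_identities : Prop :=
  forall q v s qrd qrdd : 'cV[R]_n,
    [/\ ct_L c q s *m theta g = inertia g q *m s,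
        ct_P c q v s qrd qrdd *m theta g
          = M_blk m *m N_blk m *m inertia g q *m s
            + N_blk m *m coriolis g q v *m s
            - N_blk m *m inertia_dot g q v *m s
            + N_blk m *m (regressor g q v qrdd qrd *m theta g) &
        ct_Q c q v s qrd qrdd *m theta g
          = A_blk m *m N_blk m *m inertia g q *m s
            - regressor g q v qrdd qrd *m theta g].

Definition regression_continuous : Prop :=
  let V := ('cV[R]_n)%type in
  [/\ continuous (fun z : V * V => ct_L c z.1 z.2),
      continuous (fun z : V * V * V * V * V =>
        ct_P c z.1.1.1.1 z.1.1.1.2 z.1.1.2 z.1.2 z.2) &
      continuous (fun z : V * V * V * V * V =>
        ct_Q c z.1.1.1.1 z.1.1.1.2 z.1.1.2 z.1.2 z.2)].

Definition controller_design : Prop :=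
  [/\ posdef (ct_K c), is_diag_mx (ct_Lambda c), posdef (ct_Lambda c),
      regression_identities & regression_continuous].

End Controller.

Section ClosedLoop.
Variables (R : realType) (N n p l : nat) (e : rel 'I_N) (a : 'M[R]_N).
Variables (mu1 mu2 alpha : R).
Variable g : 'I_N -> agent R n p.
Variable m : 'I_N -> internal_model R n l.
Variable c : forall i, controller p (m i).
Variable d : forall i, disturbance (m i).

(* tr_v is the generalized velocity. *)
Record trajectory := Trajectory {
  tr_S : 'I_N -> R -> 'M[R]_n;
  tr_eta : 'I_N -> R -> 'cV[R]_n;
  tr_q : 'I_N -> R -> 'cV[R]_n;
  tr_v : 'I_N -> R -> 'cV[R]_n;
  tr_xi : forall i, R -> 'cV[R]_(im_dim (m i));
  tr_zeta : forall i, R -> 'M[R]_(im_dim (m i), p);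
  tr_omega : 'I_N -> R -> 'cV[R]_(omega_dim p l) }.

Record initial_data := InitialData {
  S_init : 'I_N -> 'M[R]_n;
  eta_init : 'I_N -> 'cV[R]_n;
  q_init : 'I_N -> 'cV[R]_n;
  v_init : 'I_N -> 'cV[R]_n;
  xi_init : forall i, 'cV[R]_(im_dim (m i));
  zeta_init : forall i, 'M[R]_(im_dim (m i), p);
  omega_init : 'I_N -> 'cV[R]_(omega_dim p l) }.

Variable x : trajectory.

Section Signals.
Variables (i : 'I_N) (t : R).
Let S := tr_S x i t.
Let eta := tr_eta x i t.
Let q := tr_q x i t.
Let v := tr_v x i t.
Let xi := tr_xi x i t.
Let zeta := tr_zeta x i t.
Let S_dot := S_rhs e a mu1 ((tr_S x)^~ t) i.
Let eta_dot := eta_rhs e a mu2 ((tr_S x)^~ t) ((tr_eta x)^~ t) i.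

Definition qr_dot : 'cV[R]_n := S *m eta - alpha *: (q - eta).

Definition qr_ddot : 'cV[R]_n :=
  S_dot *m eta + S *m eta_dot - alpha *: (v - eta_dot).

Definition sliding : 'cV[R]_n := v - qr_dot.

Definition L_sig : 'M[R]_(n, p) := ct_L (c i) q sliding.

Definition P_sig : 'M[R]_(im_dim (m i), p) :=
  ct_P (c i) q v sliding qr_dot qr_ddot.

Definition Q_sig : 'M[R]_(n, p) := ct_Q (c i) q v sliding qr_dot qr_ddot.

Definition rho : 'M[R]_(n, omega_dim p l) :=
  row_mx (row_mx (A_blk (m i) *m zeta + Q_sig)
                 (E_row (zeta + N_blk (m i) *m L_sig)))
         (E_row xi).

Definition torque : 'cV[R]_n :=
  - (ct_K (c i) *m sliding) - rho *m tr_omega x i t + A_blk (m i) *m xi.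

Definition equation_of_motion : Prop :=
  derivable (tr_v x i) t (1 : R) /\
  inertia (g i) q *m derive1 (tr_v x i) t + coriolis (g i) q v *m v
    + gravity (g i) q = torque + disturbance_signal (d i) t.

End Signals.

Definition closed_loop (x0 : initial_data) : Prop :=
  observer e a mu1 mu2 (S_init x0) (eta_init x0) (tr_S x) (tr_eta x) /\
  forall i,
  [/\ ivp (tr_q x i) (tr_v x i) (q_init x0 i),
      [/\ {within `[0, +oo[, continuous (tr_v x i)},
          forall t, 0 < t -> equation_of_motion i t &
          tr_v x i 0 = v_init x0 i],
      ivp (tr_xi x i)
        (fun t => M_blk (m i) *m tr_xi x i t + N_blk (m i) *m torque i t)
        (xi_init x0 i),
      ivp (tr_zeta x i)
        (fun t => M_blk (m i) *m tr_zeta x i t + P_sig i t)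
        (zeta_init x0 i) &
      ivp (tr_omega x i)
        (fun t => invmx (ct_Lambda (c i)) *m (rho i t)^T *m sliding i t)
        (omega_init x0 i)].

Definition leaderless_consensus : Prop :=
  (forall i, bounded_on_halfline (tr_q x i) /\ bounded_on_halfline (tr_v x i))
  /\ forall i j,
       ((tr_q x i t - tr_q x j t) @[t --> +oo] --> (0 : 'cV[R]_n)) /\
       ((tr_v x i t - tr_v x j t) @[t --> +oo] --> (0 : 'cV[R]_n)).

End ClosedLoop.

(* Main.v *)
Require Import Defs.
From HB Require Import structures.
From mathcomp Require Import all_boot all_order all_algebra.
From mathcomp Require Import all_classical all_reals all_analysis.
From mathcomp Require Import complex lra ring.
Import Order.TTheory GRing.Theory Num.Theory numFieldNormedType.Exports.

Set Implicit Arguments.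
Unset Strict Implicit.
Unset Printing Implicit Defensive.

Local Open Scope classical_set_scope.
Local Open Scope ring_scope.

(** The control law works because it splits into a distributed observer, which
   reaches consensus by itself, and N adaptive controllers, each of which makes
   its agent track the output of its own copy of the observer.

   Observer.  Subtracting from minus the Laplacian the rank-one matrix 1 u gives
   a Hurwitz matrix when the graph has a spanning tree (hurwitz_grounded), hence
   a quadratic Lyapunov form for the deviation from the u-weighted mean
   (hurwitz_lyapunov).  For S the mean is conserved, so each S_i tends to Sstar
   at a rate proportional to mu1.  For eta the deviation decays at a rate
   proportional to mu2, while the total energy grows at a rate that depends on
   neither gain.  In the frame moving with exp(t Sstar) the mean has therefore
   an exponentially decaying derivative when mu1 is large, and tends to a limit
   chi; the deviation decays even in that frame when mu2 is large.  Hence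
   eta_i - exp(t Sstar) chi tends to 0 exponentially (observer_consensus).

   One agent.  The disturbance is the output of a stable copy of the internal
   model driven by the disturbance itself: d = B theta with
   theta' = M theta + N d and theta bounded (steady_state).  With H the inertia
   matrix, C the Coriolis matrix and Theta the unknown parameters, the error
   eps = xi + theta - N H s - zeta Theta satisfies eps' = M eps
   (model_error_dynamics), and the control law turns the equation of motion into
   H s' + C s = - K s + B eps - rho (omega - omega0), where omega0 collects
   Theta, the coefficients of A - B and, up to sign, the products of both
   (sliding_dynamics).  Skew symmetry and the adaptation law then give
   V' <= - k |s|^2, with k > 0, for
   V = s^T H s + (omega - omega0)^T Lambda (omega - omega0) + ce eps^T P eps,
   where P is a Lyapunov form of M and ce is large (lyapunov_rate).

   Consequences.  V bounds s, omega and eps; q - eta and zeta are outputs of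
   stable linear filters of bounded signals, and xi is recovered from eps
   (state_bounds).  These bounds do not depend on the length of the time
   interval.  They first give the existence of global trajectories, by Peano's
   theorem with an a priori bound (peano_apriori, proved with Euler polygons
   and an ultrafilter, since the data are only assumed continuous), and then
   a bound on s', so that s tends to 0 by a Barbalat argument (barbalat).
   Since (q - eta)' = - alpha (q - eta) + s + S eta - eta', and S eta - eta'
   tends to 0 by consensus of the observers, q_i - eta_i and q_i' - S_i eta_i
   tend to 0.  Consensus of the observers concludes. *)

(** * Norms and limits of matrices *)

Section MatrixNorm.
Variable R : realType.

Lemma mx_entry_le m n (A : 'M[R]_(m, n)) i j : `|A i j| <= `|A|.
Proof.
rewrite [leRHS]/Num.Def.normr/= mx_normrE.
exact: (le_bigmax _ (fun ij : 'I_m * 'I_n => `|A ij.1 ij.2|) (i, j)).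
Qed.

Lemma mx_norm_le m n (A : 'M[R]_(m, n)) B :
  0 <= B -> (forall i j, `|A i j| <= B) -> `|A| <= B.
Proof.
move=> B0 h; rewrite [leLHS]/Num.Def.normr/= mx_normrE.
by apply: bigmax_le => // -[i j] _; exact: h.
Qed.

Lemma norm_mulmx m n p (A : 'M[R]_(m, n)) (B : 'M[R]_(n, p)) :
  `|A *m B| <= n%:R * `|A| * `|B|.
Proof.
apply: mx_norm_le; first by rewrite !mulr_ge0.
move=> i j; rewrite mxE; apply: le_trans (ler_norm_sum _ _ _) _.
apply: le_trans (_ : \sum_(k < n) `|A| * `|B| <= _).
  by apply: ler_sum => k _; rewrite normrM ler_pM // mx_entry_le.
by rewrite sumr_const card_ord -mulrA mulr_natl.
Qed.

Lemma norm_mulmx_le a1 a2 a3 (X : 'M[R]_(a1, a2)) (Y : 'M[R]_(a2, a3)) (x1 y1 : R) :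
  `|X| <= x1 -> `|Y| <= y1 -> `|X *m Y| <= a2%:R * x1 * y1.
Proof.
move=> hX hY; apply: le_trans (norm_mulmx _ _) _.
by apply: ler_pM; [exact: mulr_ge0|exact: normr_ge0|exact: ler_wpM2l|exact: hY].
Qed.

Lemma norm_trmx m n (A : 'M[R]_(m, n)) : `|A^T| = `|A|.
Proof.
have le k l (B : 'M[R]_(k, l)) : `|B^T| <= `|B|.
  by apply: mx_norm_le => // i j; rewrite mxE mx_entry_le.
by apply/eqP; rewrite eq_le le -{1}[A]trmxK le.
Qed.

Section Cvg.
Context (T : Type) (F : set_system T) {FF : Filter F}.

Lemma cvg_mx m n (f : T -> 'M[R]_(m, n)) (A : 'M[R]_(m, n)) :
  (forall i j, (fun x => f x i j) @ F --> A i j) -> f @ F --> A.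
Proof.
move=> h; apply/cvgrPdist_le => e e0.
have : \forall x \near F, forall ij : 'I_m * 'I_n, `|A ij.1 ij.2 - f x ij.1 ij.2| <= e.
  by apply: filter_forall => -[i j]; have /cvgrPdist_le := h i j; apply.
apply: filterS => x hx; apply: mx_norm_le; first exact: ltW.
by move=> i j; have := hx (i, j); rewrite !mxE.
Qed.

Lemma cvg_entry m n (f : T -> 'M[R]_(m, n)) (A : 'M[R]_(m, n)) i j :
  f @ F --> A -> (fun x => f x i j) @ F --> A i j.
Proof.
move=> h; apply/cvgrPdist_le => e e0; have /cvgrPdist_le/(_ _ e0) := h.
by apply: filterS => x; apply: le_trans; have := mx_entry_le (A - f x) i j; rewrite !mxE.
Qed.

Lemma cvg_mulmx m n p (f : T -> 'M[R]_(m, n)) (g : T -> 'M[R]_(n, p))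
    (A : 'M[R]_(m, n)) (B : 'M[R]_(n, p)) :
  f @ F --> A -> g @ F --> B -> (fun x => f x *m g x) @ F --> A *m B.
Proof.
move=> hf hg; apply: cvg_mx => i j.
have -> : (fun x => (f x *m g x) i j) = (fun x => \sum_k f x i k * g x k j).
  by apply/funext => x; rewrite mxE.
rewrite mxE; apply: cvg_big => [|k _]; first exact: add_continuous.
by apply: cvgM; exact: cvg_entry.
Qed.

Lemma cvg_trmx m n (f : T -> 'M[R]_(m, n)) (A : 'M[R]_(m, n)) :
  f @ F --> A -> (fun x => (f x)^T) @ F --> A^T.
Proof.
move=> hf; apply: cvg_mx => i j; rewrite mxE.
by under eq_fun do rewrite mxE; apply: cvg_entry.
Qed.

End Cvg.

End MatrixNorm.

Section MatrixDerive.
Variable R : realType.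
Implicit Types t : R.

Lemma is_derive_mx m n t (f : R -> 'M[R]_(m, n)) (df : 'M[R]_(m, n)) :
  (forall i j, is_derive t (1 : R) (fun s => f s i j) (df i j)) ->
  is_derive t (1 : R) f df.
Proof.
move=> h; have d : derivable f t 1.
  by apply/derivable_mxP => i j; case: (h i j).
split => //; rewrite derive_mx //; apply/matrixP => i j; rewrite mxE.
by case: (h i j).
Qed.

Lemma is_derive_entry m n t (f : R -> 'M[R]_(m, n)) (df : 'M[R]_(m, n)) i j :
  is_derive t (1 : R) f df -> is_derive t (1 : R) (fun s => f s i j) (df i j).
Proof.
move=> [d <-]; split; first exact: (derivable_mxP _ _ _).1.
by rewrite derive_mx // mxE.
Qed.

Lemma is_derive_mulmx m n p t (f : R -> 'M[R]_(m, n)) (g : R -> 'M[R]_(n, p)) df dg :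
  is_derive t (1 : R) f df -> is_derive t (1 : R) g dg ->
  is_derive t (1 : R) (fun s => f s *m g s) (df *m g t + f t *m dg).
Proof.
move=> hf hg; apply: is_derive_mx => i j.
have -> : (fun s => (f s *m g s) i j) = \sum_k (fun s => f s i k * g s k j).
  by apply/funext => s; rewrite mxE fct_sumE.
have -> : (df *m g t + f t *m dg) i j = \sum_k (f t i k *: dg k j + g t k j *: df i k).
  rewrite !mxE -big_split; apply: eq_bigr => k _ /=; rewrite /GRing.scale /= addrC.
  by rewrite [df i k * _]mulrC.
apply: is_derive_sum => k; exact: (is_deriveM (is_derive_entry i k hf) (is_derive_entry k j hg)).
Qed.

Lemma is_derive_trmx m n t (f : R -> 'M[R]_(m, n)) df :
  is_derive t (1 : R) f df -> is_derive t (1 : R) (fun s => (f s)^T) df^T.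
Proof.
move=> hf; apply: is_derive_mx => i j; rewrite mxE.
by under eq_fun do rewrite mxE; apply: is_derive_entry.
Qed.

Lemma is_derive_mxtrace n t (f : R -> 'M[R]_n) df :
  is_derive t (1 : R) f df -> is_derive t (1 : R) (fun s => \tr (f s)) (\tr df).
Proof.
move=> hf; have -> : (fun s => \tr (f s)) = \sum_k (fun s => f s k k).
  by apply/funext => s; rewrite /mxtrace fct_sumE.
by apply: is_derive_sum => k; exact: is_derive_entry.
Qed.

(** The derivation rules give the derivative in the shape dictated by the
   instance; this restates it up to a provable equation. *)
Lemma is_derive_conv (V : normedModType R) t (f : R -> V) (a b : V) :
  is_derive t (1 : R) f a -> a = b -> is_derive t (1 : R) f b.
Proof. by move=> h <-. Qed.

Section Pointwise.
Variables (V : normedModType R) (t : R) (f g : R -> V) (df dg : V).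
Hypotheses (hf : is_derive t (1 : R) f df) (hg : is_derive t (1 : R) g dg).

Lemma is_derive_add : is_derive t (1 : R) (fun s => f s + g s) (df + dg).
Proof. exact: is_deriveD. Qed.

Lemma is_derive_sub : is_derive t (1 : R) (fun s => f s - g s) (df - dg).
Proof. exact: is_deriveB. Qed.

Lemma is_derive_opp : is_derive t (1 : R) (fun s => - f s) (- df).
Proof. exact: is_deriveN. Qed.

Lemma is_derive_scale (k : R) : is_derive t (1 : R) (fun s => k *: f s) (k *: df).
Proof. exact: is_deriveZ. Qed.

End Pointwise.

Lemma is_derive_mul t (f g : R -> R) df dg :
  is_derive t (1 : R) f df -> is_derive t (1 : R) g dg ->
  is_derive t (1 : R) (fun s => f s * g s) (df * g t + f t * dg).
Proof.
move=> hf hg; apply: (is_derive_conv (is_deriveM hf hg)).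
by rewrite /GRing.scale /= addrC mulrC.
Qed.

End MatrixDerive.

(** * Differential inequalities *)

Section DiffIneq.
Variable R : realType.
Implicit Types (f df V dV : R -> R) (a b c k t nu beta G : R).

Lemma le_of_derive_le0 f df a b : a <= b ->
  {within `[a, b], continuous f} ->
  (forall t, a < t < b -> is_derive t (1 : R) f (df t)) ->
  (forall t, a < t < b -> df t <= 0) -> f b <= f a.
Proof.
rewrite le_eqVlt => /predU1P[->//|ab] cf hd hn.
have hd' x : x \in `]a, b[ -> is_derive x (1 : R) f (df x).
  by rewrite in_itv /=; exact: hd.
have [t + e] := MVT ab hd' cf; rewrite in_itv /= => /hn ht; rewrite -subr_le0 e.
by rewrite mulr_le0_ge0 // subr_ge0 ltW.
Qed.

Lemma le_of_rate_le0 (f : R -> R) a b : a <= b ->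
  {within `[a, b], continuous f} ->
  (forall t, a < t < b -> exists2 d, is_derive t (1 : R) f d & d <= 0) -> f b <= f a.
Proof.
move=> ab cf h; apply: (@le_of_derive_le0 f (derive1 f) a b ab cf) => t ht.
  have [e [h1 _] _] := h t ht; rewrite derive1E; exact: derivableP.
by have [e [_ h2] he] := h t ht; rewrite derive1E h2.
Qed.

Lemma is_derive_expRM c t :
  is_derive t (1 : R) (fun s => expR (c * s)) (c * expR (c * t)).
Proof.
have h1 : is_derive t (1 : R) (fun s => c * s) c.
  have := is_deriveZ (f := @id R) c (is_derive_id t (1 : R)).
  by rewrite /GRing.scale /= mulr1.
have := is_derive1_comp (f := expR) (is_derive_expR (c * t)) h1.
by move=> h; apply: is_derive_conv h _; rewrite /GRing.scale /= mulrC.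
Qed.

Lemma continuous_expRM c : continuous (fun s : R => expR (c * s)).
Proof.
move=> t; apply/differentiable_continuous/derivable1_diffP.
by case: (is_derive_expRM c t).
Qed.

Lemma continuous_withinW (T : topologicalType) (D : set R) (f : R -> T) :
  continuous f -> {within D, continuous f}.
Proof. exact: continuous_subspaceT. Qed.

(** Multiplying by the integrating factor expR (c t) turns the hypothesis into
   a sign condition on a derivative. *)
Lemma gronwall V dV c k a b : c != 0 -> a <= b ->
  {within `[a, b], continuous V} ->
  (forall t, a < t < b -> is_derive t (1 : R) V (dV t)) ->
  (forall t, a < t < b -> dV t <= - c * V t + k) ->
  V b <= k / c + expR (- c * (b - a)) * (V a - k / c).
Proof.
move=> c0 ab cV hV h.
pose f s := expR (c * s) * (V s - k / c).
have : f b <= f a.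
  apply: (@le_of_derive_le0 f (fun t => expR (c * t) * (dV t + c * V t - k))) => //.
  - move=> x; apply: cvgM; first by apply: continuous_withinW; exact: continuous_expRM.
    by apply: cvgB; [exact: cV|exact: cvg_cst].
  - move=> t /hV ht; rewrite /f.
    refine (is_derive_conv (is_derive_mul (is_derive_expRM c t) (is_derive_sub ht (is_derive_cst (k / c) t 1))) _).
    by rewrite /cst subr0 /=; field.
  - move=> t /h ht; rewrite pmulr_rle0 ?expR_gt0 //; lra.
rewrite /f.
have -> : expR (- c * (b - a)) = expR (c * a) / expR (c * b).
  by rewrite -expRN -expRD; congr expR; ring.
move=> h1.
rewrite -lerBlDl -(ler_pM2l (expR_gt0 (c * b))) (le_trans h1) //.
rewrite le_eqVlt; apply/orP; left; apply/eqP.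
have e0 : expR (c * b) != 0 by rewrite gt_eqF ?expR_gt0.
by field; rewrite e0 c0.
Qed.

Lemma gronwall_bound V dV c k a b : 0 < c -> 0 <= k -> 0 <= V a -> a <= b ->
  {within `[a, b], continuous V} ->
  (forall t, a < t < b -> is_derive t (1 : R) V (dV t)) ->
  (forall t, a < t < b -> dV t <= - c * V t + k) ->
  V b <= V a + k / c.
Proof.
move=> c0 k0 Va ab cV hV h.
apply: le_trans (gronwall (lt0r_neq0 c0) ab cV hV h) _.
have e1 : expR (- c * (b - a)) <= 1.
  by rewrite -expR0 ler_expR mulNr oppr_le0 mulr_ge0 ?subr_ge0 // ltW.
have kc : 0 <= k / c by rewrite divr_ge0 // ltW.
have := expR_gt0 (- c * (b - a)); nra.
Qed.

Lemma gronwall_growth V dV c a b : 0 < c -> 0 <= V a -> a <= b ->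
  {within `[a, b], continuous V} ->
  (forall t, a < t < b -> is_derive t (1 : R) V (dV t)) ->
  (forall t, a < t < b -> dV t <= c * V t) ->
  V b <= expR (c * (b - a)) * V a.
Proof.
move=> c0 Va ab cV hV h.
have c0' : - c != 0 by rewrite oppr_eq0 gt_eqF.
have := @gronwall V dV (- c) 0 a b c0' ab cV hV.
rewrite opprK mul0r subr0 add0r; apply => t /h.
by rewrite addr0.
Qed.

(** The rate nu survives a forcing term that decays faster than nu. *)
Lemma gronwall_exp V dV nu beta G b : nu < beta -> 0 <= G -> 0 <= b ->
  {within `[0, b], continuous V} ->
  (forall t, 0 < t < b -> is_derive t (1 : R) V (dV t)) ->
  (forall t, 0 < t < b -> dV t <= - nu * V t + G * expR (- beta * t)) ->
  V b <= (V 0 + G / (beta - nu)) * expR (- nu * b).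
Proof.
move=> nb G0 b0 cV hV h; have bn : 0 < beta - nu by lra.
pose f s := expR (nu * s) * V s + G / (beta - nu) * expR ((nu - beta) * s).
have : f b <= f 0.
  apply: (@le_of_derive_le0 f (fun t => expR (nu * t) * (dV t + nu * V t - G * expR (- beta * t)))) => //.
  - move=> x; apply: cvgD; apply: cvgM.
    + by apply: continuous_withinW; exact: continuous_expRM.
    + exact: cV.
    + exact: cvg_cst.
    + by apply: continuous_withinW; exact: continuous_expRM.
  - move=> t /hV ht; rewrite /f.
    refine (is_derive_conv (is_derive_add (is_derive_mul (is_derive_expRM nu t) ht)
        (is_derive_scale (is_derive_expRM (nu - beta) t) (G / (beta - nu)))) _).
    rewrite /GRing.scale /=.
    have -> : expR ((nu - beta) * t) = expR (nu * t) * expR (- beta * t).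
      by rewrite -expRD; congr expR; ring.
    by field; lra.
  - move=> t /h ht; rewrite pmulr_rle0 ?expR_gt0 //; lra.
rewrite /f.
rewrite !mulr0 expR0 mul1r mulr1 mulNr expRN => h1.
rewrite -ler_pdivrMr ?invr_gt0 ?expR_gt0 // invrK mulrC.
apply: le_trans h1; rewrite lerDl mulr_ge0 ?expR_ge0 // divr_ge0 //; exact: ltW.
Qed.

(** After a time where the forcing is below eps, the solution decays to eps / c. *)
Lemma gronwall_cvg0 V dV g c : 0 < c -> (forall t, 0 <= t -> 0 <= V t) ->
  {within `[0, +oo[, continuous V} ->
  (forall t, 0 < t -> is_derive t (1 : R) V (dV t)) ->
  (forall t, 0 < t -> dV t <= - c * V t + g t) ->
  g t @[t --> +oo] --> (0 : R) -> V t @[t --> +oo] --> (0 : R).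
Proof.
move=> c0 V0 cV hV h /cvgrPdist_le hg; apply/cvgrPdist_le => e e0.
have e1 : 0 < e * c / 2 by rewrite divr_gt0 // mulr_gt0.
have [A [Ar hA]] := hg _ e1.
pose a := `|A| + 1; have a0 : 0 < a by rewrite /a; have := normr_ge0 A; lra.
have Aa t : a <= t -> A < t by move=> h1; have := ler_norm A; rewrite /a in h1; lra.
pose X := Num.max (V a) 0.
have Xp : 0 <= X by rewrite /X le_max lexx orbT.
have hX : V a <= X by rewrite /X le_max lexx.
have key b : a <= b -> V b <= e / 2 + expR (- c * (b - a)) * X.
  move=> ab; have := @gronwall V dV c (e * c / 2) a b (lt0r_neq0 c0) ab.
  have -> : e * c / 2 / c = e / 2 by field; lra.
  move=> H; apply: le_trans (H _ _ _) _.
  - apply: continuous_subspaceW cV => x /=; rewrite !in_itv /= => /andP[ax _].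
    by rewrite andbT (le_trans (ltW a0)).
  - by move=> t /andP[at_ _]; apply: hV; apply: lt_trans at_.
  - move=> t /andP[at_ _]; apply: le_trans (h t (lt_trans a0 at_)) _.
    rewrite lerD2l; have := hA _ (Aa _ (ltW at_)); rewrite sub0r normrN.
    exact: le_trans (ler_norm _).
  - rewrite lerD2l ler_wpM2l ?expR_ge0 //; lra.
have [B hB] : exists B, forall b, B <= b -> expR (- c * (b - a)) * X <= e / 2.
  exists (a + 2 * X / (e * c)) => b hb.
  have h1 : X <= (e / 2) * expR (c * (b - a)).
    apply: le_trans (_ : (e / 2) * (1 + c * (b - a)) <= _); last first.
      by rewrite ler_wpM2l ?expR_ge1Dx // divr_ge0 // ltW.
    have : 2 * X / (e * c) <= b - a by lra.
    rewrite ler_pdivrMr ?mulr_gt0 // => h1.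
    nra.
  rewrite mulNr expRN mulrC ler_pdivrMr ?expR_gt0 //.
exists (Num.max a B); split; first by rewrite num_real.
move=> t; rewrite gt_max => /andP[at_ Bt].
rewrite sub0r normrN ger0_norm ?V0 ?(ltW (lt_trans a0 at_)) //.
have := key _ (ltW at_); have := hB _ (ltW Bt); lra.
Qed.

End DiffIneq.

(** * Continuity on a subset *)

Section Within.
Variables (R : realType) (T : topologicalType) (D : set T).

Lemma within_mulmx m n p (f : T -> 'M[R]_(m, n)) (g : T -> 'M[R]_(n, p)) :
  {within D, continuous f} -> {within D, continuous g} ->
  {within D, continuous (fun t => f t *m g t)}.
Proof.
by move=> cf cg x; exact: (@cvg_mulmx R T (nbhs x) _ _ _ _ f g (f x) (g x) (cf x) (cg x)).
Qed.

Lemma within_entry m n (f : T -> 'M[R]_(m, n)) i j :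
  {within D, continuous f} -> {within D, continuous (fun t => f t i j)}.
Proof.
by move=> cf x; exact: (@cvg_entry R T (nbhs x) _ _ _ f (f x) i j (cf x)).
Qed.

Lemma within_mx m n (f : T -> 'M[R]_(m, n)) :
  (forall i j, {within D, continuous (fun t => f t i j)}) -> {within D, continuous f}.
Proof.
move=> cf x; apply: (@cvg_mx R T (nbhs x) _ _ _ f (f x)) => i j; exact: (cf i j x).
Qed.

Lemma within_trmx m n (f : T -> 'M[R]_(m, n)) :
  {within D, continuous f} -> {within D, continuous (fun t => (f t)^T)}.
Proof.
by move=> cf x; exact: (@cvg_trmx R T (nbhs x) _ _ _ f (f x) (cf x)).
Qed.

Lemma within_cst (V : normedModType R) (A : V) : {within D, continuous (fun=> A)}.
Proof. by move=> x; exact: cvg_cst. Qed.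

Lemma within_add (V : normedModType R) (f g : T -> V) :
  {within D, continuous f} -> {within D, continuous g} ->
  {within D, continuous (fun t => f t + g t)}.
Proof. by move=> cf cg x; exact: cvgD (cf x) (cg x). Qed.

Lemma within_sub (V : normedModType R) (f g : T -> V) :
  {within D, continuous f} -> {within D, continuous g} ->
  {within D, continuous (fun t => f t - g t)}.
Proof. by move=> cf cg x; exact: cvgB (cf x) (cg x). Qed.

Lemma within_scale (V : normedModType R) (k : R) (f : T -> V) :
  {within D, continuous f} -> {within D, continuous (fun t => k *: f t)}.
Proof. by move=> cf x; exact: cvgZl_tmp (cf x). Qed.

Lemma within_comp (U V : topologicalType) (g : U -> V) (f : T -> U) :
  continuous g -> {within D, continuous f} ->
  {within D, continuous (fun t => g (f t))}.
Proof. by move=> cg cf x; exact: (cvg_comp _ _ (cf x) (cg (f x))). Qed.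

Lemma within_pair (U V : topologicalType) (f : T -> U) (g : T -> V) :
  {within D, continuous f} -> {within D, continuous g} ->
  {within D, continuous (fun t => (f t, g t))}.
Proof. by move=> cf cg x; exact: (cvg_pair (cf x) (cg x)). Qed.

Lemma within_proj1 (U V : topologicalType) (f : T -> U * V) :
  {within D, continuous f} -> {within D, continuous (fun t => (f t).1)}.
Proof. by apply: within_comp => -[x y]; exact: cvg_fst. Qed.

Lemma within_proj2 (U V : topologicalType) (f : T -> U * V) :
  {within D, continuous f} -> {within D, continuous (fun t => (f t).2)}.
Proof. by apply: within_comp => -[x y]; exact: cvg_snd. Qed.

End Within.

Section WithinLimits.
Variable R : realType.

Lemma within_fst (U V : topologicalType) (f : R -> V) :
  {within `[0, +oo[, continuous f} ->
  {within [set z : R * U | 0 <= z.1], continuous (fun z => f z.1)}.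
Proof.
move=> /subspace_continuousP cf; apply/subspace_continuousP => z z0.
have z0' : (`[0, +oo[%classic : set R) z.1 by rewrite /= in_itv /= andbT.
move=> A hA; have : nbhs z.1 (fun s => `[0, +oo[%classic s -> A (f s)) by exact: (cf _ z0' _ hA).
move=> h; have h1 : z'.1 @[z' --> z] --> z.1 by exact: cvg_fst.
have := h1 _ h; rewrite /within /nbhs /=.
by apply: filterS => z' H h2; apply: H; rewrite /= in_itv /= andbT.
Qed.

Lemma within_of_derive (V : normedModType R) (D : set R) (f df : R -> V) :
  (forall t, is_derive t (1 : R) f (df t)) -> {within D, continuous f}.
Proof.
move=> h; apply: continuous_subspaceT => t.
by apply/differentiable_continuous/derivable1_diffP; case: (h t).
Qed.

Lemma within_halfline (V : topologicalType) (f : R -> V) T :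
  {within `[0, +oo[, continuous f} -> {within `[0, T], continuous f}.
Proof.
by apply: continuous_subspaceW => t /=; rewrite !in_itv /= => /andP[->].
Qed.

(** Continuity is local, and only a bounded piece of the half-line is near a given
   point. *)
Lemma within_halfline_of (V : topologicalType) (f : R -> V) :
  (forall T, {within `[0, T], continuous f}) -> {within `[0, +oo[, continuous f}.
Proof.
move=> h; apply/subspace_continuousP => x; rewrite /= in_itv /= andbT => x0.
have /subspace_continuousP/(_ x) := h (x + 1).
rewrite /= in_itv /= x0 /= lerDl ler01 => /(_ isT) hx U hU.
have hU' : \forall y \near x, `[0, x + 1]%classic y -> U (f y) := hx U hU.
have hlt : \forall y \near x, y < x + 1 by apply: lt_nbhsl; lra.
have : \forall y \near x, `[0, +oo[%classic y -> U (f y).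
  apply: filterS2 hU' hlt => y yU yx; rewrite /= in_itv /= andbT => y0.
  by apply: yU; rewrite /= in_itv /= y0 ltW.
by [].
Qed.

End WithinLimits.

(** * Quadratic forms and Lyapunov estimates *)

Section QuadraticForms.
Variable R : realType.

(** The squared Frobenius norm. *)
Definition nsq m n (X : 'M[R]_(m, n)) : R := \tr (X^T *m X).

Definition wsq n q (P : 'M[R]_n) (X : 'M[R]_(n, q)) : R := \tr (X^T *m P *m X).

Lemma nsqE m n (X : 'M[R]_(m, n)) : nsq X = \sum_j \sum_i X i j ^+ 2.
Proof.
rewrite /nsq /mxtrace; apply: eq_bigr => j _; rewrite mxE.
by apply: eq_bigr => i _; rewrite mxE expr2.
Qed.

Lemma nsq_wsq n q (X : 'M[R]_(n, q)) : nsq X = wsq 1%:M X.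
Proof. by rewrite /wsq mulmx1. Qed.

Lemma nsq_ge0 m n (X : 'M[R]_(m, n)) : 0 <= nsq X.
Proof. by rewrite nsqE; do 2!apply: sumr_ge0 => ? _; exact: sqr_ge0. Qed.

Lemma norm_le_nsq m n (X : 'M[R]_(m, n)) : `|X| ^+ 2 <= nsq X.
Proof.
have h i j : `|X i j| <= Num.sqrt (nsq X).
  rewrite -sqrtr_sqr ler_wsqrtr // nsqE (bigD1 j) //= (bigD1 i) //=.
  rewrite -addrA lerDl addr_ge0 //; first by apply: sumr_ge0 => ? _; exact: sqr_ge0.
  by do 2!apply: sumr_ge0 => ? _; exact: sqr_ge0.
rewrite -[leRHS]sqr_sqrtr ?nsq_ge0 // lerXn2r ?nnegrE ?sqrtr_ge0 //.
by apply: mx_norm_le; rewrite ?sqrtr_ge0.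
Qed.

Lemma norm_of_nsq_le q1 q2 (x : 'M[R]_(q1, q2)) (k V : R) : 0 < k -> k * nsq x <= V ->
  `|x| <= Num.sqrt (V / k).
Proof.
move=> k0 h.
have V0 : 0 <= V by apply: le_trans h; rewrite mulr_ge0 ?nsq_ge0 // ltW.
rewrite -(@ler_pXn2r _ 2) ?nnegrE ?sqrtr_ge0 // sqr_sqrtr ?divr_ge0 ?(ltW k0) //.
rewrite ler_pdivlMr // mulrC; apply: le_trans h.
by rewrite ler_pM2l // norm_le_nsq.
Qed.

Lemma cvg0_of_nsq m n (f : R -> 'M[R]_(m, n)) :
  nsq (f t) @[t --> +oo] --> (0 : R) -> f t @[t --> +oo] --> (0 : 'M[R]_(m, n)).
Proof.
move=> h; apply/cvgr0Pnorm_le => eps e0.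
have e2 : 0 < eps ^+ 2 by rewrite exprn_gt0.
have hn : \forall t \near +oo, `|nsq (f t)| <= eps ^+ 2 by move/cvgr0Pnorm_le: h; apply.
apply: filterS hn => t ht; rewrite -(@ler_pXn2r _ 2) ?nnegrE ?(ltW e0) //.
apply: le_trans (norm_le_nsq _) _; apply: le_trans ht; exact: ler_norm.
Qed.

Lemma nsq_le_norm m n (X : 'M[R]_(m, n)) : nsq X <= (m * n)%:R * `|X| ^+ 2.
Proof.
rewrite nsqE; apply: (@le_trans _ _ (\sum_(j < n) \sum_(i < m) `|X| ^+ 2)).
  do 2!apply: ler_sum => ? _; rewrite -real_normK ?num_real // lerXn2r ?nnegrE //.
  exact: mx_entry_le.
by rewrite !sumr_const !card_ord -mulrnA mulr_natl.
Qed.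

Lemma nsq_eq0 m n (X : 'M[R]_(m, n)) : (nsq X == 0) = (X == 0).
Proof.
apply/eqP/eqP => [h|->]; last by rewrite /nsq mulmx0 mxtrace0.
by have := norm_le_nsq X; rewrite h => h1; apply/eqP; rewrite -normr_eq0 -sqrf_eq0 eq_le h1 sqr_ge0.
Qed.

Lemma nsq_cV n (x : 'cV[R]_n) : nsq x = (x^T *m x) 0 0.
Proof. by rewrite /nsq /mxtrace big_ord1. Qed.

Lemma wsq_cV n (P : 'M[R]_n) (x : 'cV[R]_n) : wsq P x = qform P x.
Proof. by rewrite /wsq /mxtrace big_ord1. Qed.

Lemma trace_col m n (X Y : 'M[R]_(m, n)) :
  \tr (X^T *m Y) = \sum_j ((col j X)^T *m col j Y) 0 0.
Proof.
apply: eq_bigr => j _; rewrite !mxE; apply: eq_bigr => i _.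
by rewrite !mxE.
Qed.

Lemma wsq_col n q (P : 'M[R]_n) (X : 'M[R]_(n, q)) :
  wsq P X = \sum_j qform P (col j X).
Proof.
rewrite /wsq -mulmxA trace_col; apply: eq_bigr => j _.
by rewrite /qform [col j (P *m X)]colE -mulmxA -colE mulmxA.
Qed.

Lemma wsqZ n q (P : 'M[R]_n) k (X : 'M[R]_(n, q)) : wsq P (k *: X) = k ^+ 2 * wsq P X.
Proof.
by rewrite /wsq [(_ *: _)^T]linearZ /= -scalemxAr -!scalemxAl !mxtraceZ mulrA expr2.
Qed.

Lemma trace_sym n q (P : 'M[R]_n) (X Y : 'M[R]_(n, q)) : P^T = P ->
  \tr (X^T *m P *m Y) = \tr (Y^T *m P *m X).
Proof. by move=> hP; rewrite -mxtrace_tr !trmx_mul trmxK hP mulmxA. Qed.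

Lemma wsqD n q (P : 'M[R]_n) (X Y : 'M[R]_(n, q)) : P^T = P ->
  wsq P (X + Y) = wsq P X + wsq P Y + 2 * \tr (X^T *m P *m Y).
Proof.
move=> hP; rewrite /wsq [(_ + _)^T]linearD /= mulmxDr !mulmxDl !mxtraceD.
by rewrite (trace_sym Y X hP); ring.
Qed.

Lemma nsqZ n q k (X : 'M[R]_(n, q)) : nsq (k *: X) = k ^+ 2 * nsq X.
Proof. by rewrite !nsq_wsq wsqZ. Qed.

(** Weighted Young inequality, from the nonnegativity of the form at a
   combination of X and Y. *)
Lemma wsq_young n q (P : 'M[R]_n) (X Y : 'M[R]_(n, q)) d : P^T = P ->
  (forall Z : 'M[R]_(n, q), 0 <= wsq P Z) -> 0 < d ->
  2 * \tr (X^T *m P *m Y) <= d * wsq P X + d^-1 * wsq P Y.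
Proof.
move=> hP h0 d0; have := h0 (d *: X + - Y).
rewrite wsqD // wsqZ -scaleN1r wsqZ [(_ *: _)^T]linearZ /= -scalemxAr -!scalemxAl !mxtraceZ.
rewrite sqrrN expr1n mul1r => h.
rewrite -(ler_pM2l d0) mulrDr mulrA mulVKf ?gt_eqF //.
move: h; rewrite -/(wsq P X) -/(wsq P Y); nra.
Qed.

Lemma wsq_bound n q (P : 'M[R]_n) :
  exists2 K, 0 <= K & forall X : 'M[R]_(n, q), wsq P X <= K * `|X| ^+ 2.
Proof.
exists (q%:R * (n%:R * (n%:R * `|P|))); first by rewrite !mulr_ge0.
move=> X; rewrite /wsq /mxtrace.
apply: (@le_trans _ _ (\sum_(j < q) `|X^T *m P *m X|)).
  by apply: ler_sum => j _; apply: le_trans (ler_norm _) (mx_entry_le _ _ _).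
rewrite sumr_const card_ord -[leLHS]mulr_natl -!mulrA ler_wpM2l // .
apply: le_trans (norm_mulmx _ _) _; rewrite -!mulrA ler_wpM2l //.
apply: le_trans (ler_wpM2r _ (norm_mulmx _ _)) _ => //.
by rewrite norm_trmx; lra.
Qed.

Lemma is_derive_wsq n q (P : 'M[R]_n) t (X : R -> 'M[R]_(n, q)) dX : P^T = P ->
  is_derive t (1 : R) X dX ->
  is_derive t (1 : R) (fun s => wsq P (X s)) (2 * \tr ((X t)^T *m P *m dX)).
Proof.
move=> hP hX.
have hXP : is_derive t (1 : R) (fun s => (X s)^T *m P) (dX^T *m P + (X t)^T *m 0).
  exact: is_derive_mulmx (is_derive_trmx hX) (is_derive_cst P t 1).
apply: (is_derive_conv (is_derive_mxtrace (is_derive_mulmx hXP hX))).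
by rewrite mulmx0 addr0 mxtraceD (trace_sym dX _ hP); ring.
Qed.

Lemma cvg_wsq (T : Type) (F : set_system T) {FF : Filter F} n q (P : 'M[R]_n)
    (X : T -> 'M[R]_(n, q)) (A : 'M[R]_(n, q)) :
  X @ F --> A -> (fun s => wsq P (X s)) @ F --> wsq P A.
Proof.
move=> hX; rewrite /wsq /mxtrace; apply: cvg_big => [|k _]; first exact: add_continuous.
apply: cvg_entry; apply: cvg_mulmx => //; apply: cvg_mulmx; last exact: cvg_cst.
exact: cvg_trmx.
Qed.

(** Transported from row vectors through mxvec. *)
Lemma compact_mx_ball m n (r : R) : compact [set X : 'M[R]_(m, n) | `|X| <= r].
Proof.
have c : compact [set x : 'rV[R]_(m * n) | `|x| <= r].
  apply: bounded_closed_compact.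
    by exists r; split; rewrite ?num_real // => x rx y /= hy; apply: le_trans hy (ltW rx).
  apply: (@closed_comp _ _ (fun x : 'rV[R]_(m * n) => `|x|) [set y | y <= r]).
    by move=> x _; exact: norm_continuous.
  exact: closed_le.
suff -> : [set X : 'M[R]_(m, n) | `|X| <= r] = vec_mx @` [set x : 'rV[R]_(m * n) | `|x| <= r].
  apply: continuous_compact c; apply: continuous_subspaceT => x.
  by apply: (@cvg_mx _ _ (nbhs x) _) => i j; rewrite mxE; under eq_fun do rewrite mxE; exact: coord_continuous.
apply/seteqP; split => X /=.
  move=> h; exists (mxvec X); last by rewrite mxvecK.
  apply: mx_norm_le; first exact: le_trans h.
  move=> i j; rewrite ord1; case/mxvec_indexP: j => a b.
  by rewrite mxvecE; apply: le_trans h; exact: mx_entry_le.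
case=> x hx <-; apply: mx_norm_le; first exact: le_trans hx.
by move=> i j; rewrite mxE; apply: le_trans hx; exact: mx_entry_le.
Qed.

Lemma within_compact_bounded (T : topologicalType) (V : normedModType R)
   (f : T -> V) (K : set T) : compact K -> {within K, continuous f} ->
  exists B : R, forall x, K x -> `|f x| <= B.
Proof.
move=> cK cf.
have : compact (f @` K) by apply: continuous_compact.
move=> /compact_bounded [M [_ hM]]; exists (M + 1) => x Kx.
by apply: (hM (M + 1)); [lra|exists x].
Qed.

Lemma continuous_compact_bounded (T : topologicalType) (V : normedModType R)
   (f : T -> V) (K : set T) : compact K -> continuous f ->
  exists B : R, forall x, K x -> `|f x| <= B.
Proof. by move=> cK cf; apply: within_compact_bounded => //; exact: continuous_subspaceT. Qed.

(** Positive definiteness is coercivity, by compactness of the unit sphere. *)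
Lemma posdef_coercive n (K : 'M[R]_n) : posdef K ->
  exists2 k, 0 < k & forall x : 'cV[R]_n, k * nsq x <= qform K x.
Proof.
move=> pK.
pose S := [set x : 'cV[R]_n | nsq x = 1].
have cont_nsq : continuous (fun x : 'cV[R]_n => nsq x).
  have -> : (fun x : 'cV[R]_n => nsq x) = wsq 1%:M by apply/funext => x; exact: nsq_wsq.
  by move=> x; apply: (@cvg_wsq _ (nbhs x) _ _ _ _ id); exact: cvg_id.
have cont_q : continuous (fun x : 'cV[R]_n => qform K x).
  have -> : (fun x : 'cV[R]_n => qform K x) = wsq K by apply/funext => x; rewrite wsq_cV.
  by move=> x; apply: (@cvg_wsq _ (nbhs x) _ _ _ _ id); exact: cvg_id.
have cS : compact S.
  apply: (@subclosed_compact _ S [set x : 'cV[R]_n | `|x| <= 1]).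
  - apply: (@closed_comp _ _ (fun x : 'cV[R]_n => nsq x) [set y | y = 1]).
      by move=> x _; exact: cont_nsq.
    exact: closed_eq.
  - exact: compact_mx_ball.
  - move=> x /= hx; have := norm_le_nsq x; rewrite hx => h.
    by rewrite -(@ler_pXn2r _ 2) ?nnegrE // expr1n.
have scale (x : 'cV[R]_n) : x != 0 -> exists2 y, S y & qform K x = nsq x * qform K y.
  move=> x0; have nx : 0 < nsq x by rewrite lt_def nsq_eq0 x0 nsq_ge0.
  exists ((Num.sqrt (nsq x))^-1 *: x).
    by rewrite /S /= nsqZ exprVn sqr_sqrtr ?ltW // mulVf ?gt_eqF.
  by rewrite -!wsq_cV wsqZ exprVn sqr_sqrtr ?ltW // mulVKf ?gt_eqF.
have [[y0 Sy0]|S0] := pselect (S !=set0); last first.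
  exists 1 => // x; have [->|/scale [y Sy _]] := eqVneq x 0; last by case: S0; exists y.
  by rewrite [qform K 0]/qform /nsq !mulmx0 mxtrace0 mxE mulr0.
have [y Sy hy] : exists2 y, S y & forall z, S z -> qform K y <= qform K z.
  have S1 : S !=set0 by exists y0.
  have cq : {within S, continuous (fun x : 'cV[R]_n => qform K x)}.
    exact: continuous_subspaceT.
  have [y Sy hy] := compact_EVT_min S1 cS cq; exists y; first by rewrite inE in Sy.
  by move=> z Sz; apply: hy; rewrite inE.
have ynz : y != 0.
  by apply/eqP => yz; move: Sy; rewrite /S /= yz /nsq mulmx0 mxtrace0 => /esym/eqP; rewrite oner_eq0.
exists (qform K y); first exact: pK.
move=> x; have [->|/scale [z Sz ->]] := eqVneq x 0.
  by rewrite [qform K 0]/qform /nsq !mulmx0 mxtrace0 mxE mulr0.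
by rewrite mulrC ler_wpM2l ?nsq_ge0 // hy.
Qed.

Lemma coercive_wsq n q (P : 'M[R]_n) k (X : 'M[R]_(n, q)) :
  (forall x : 'cV[R]_n, k * nsq x <= qform P x) -> k * nsq X <= wsq P X.
Proof.
move=> h; rewrite wsq_col [X in _ * X]/nsq trace_col mulr_sumr.
by apply: ler_sum => j _; rewrite -nsq_cV.
Qed.

End QuadraticForms.

Section Lyapunov.
Variable R : realType.

(** qform P decays at the rate 2 c along x' = A x; k is its coercivity constant. *)
Definition lyapunov n (A P : 'M[R]_n) (c k : R) : Prop :=
  [/\ P^T = P, 0 < c, 0 < k,
      forall x : 'cV[R]_n, k * nsq x <= qform P x &
      forall x : 'cV[R]_n, (x^T *m P *m (A *m x)) 0 0 <= - c * qform P x].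

Variables (n : nat) (A P : 'M[R]_n) (c k : R).
Hypothesis L : lyapunov A P c k.

Lemma lyapunov_coercive q (X : 'M[R]_(n, q)) : k * nsq X <= wsq P X.
Proof. by case: L => _ _ _ h _; exact: coercive_wsq. Qed.

Lemma lyapunov_ge0 q (X : 'M[R]_(n, q)) : 0 <= wsq P X.
Proof.
apply: le_trans (lyapunov_coercive X); rewrite mulr_ge0 ?nsq_ge0 //.
by case: L => _ _ /ltW.
Qed.

Lemma lyapunov_decr q (X : 'M[R]_(n, q)) :
  \tr (X^T *m P *m (A *m X)) <= - c * wsq P X.
Proof.
rewrite wsq_col -mulmxA trace_col mulr_sumr; apply: ler_sum => j _.
case: L => _ _ _ _ h; apply: le_trans (h _).
by rewrite !colE !mulmxA.
Qed.

(** Half of the decay absorbs the cross term with the forcing. *)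
Lemma lyapunov_forced q (X F : 'M[R]_(n, q)) :
  2 * \tr (X^T *m P *m (A *m X + F)) <= - c * wsq P X + c^-1 * wsq P F.
Proof.
have [hP c0 _ _ _] := L.
rewrite mulmxDr mxtraceD mulrDr.
have h1 := lyapunov_decr X.
have h2 := wsq_young X F hP (@lyapunov_ge0 q) c0.
lra.
Qed.

(** As B is chosen before T, this also serves as an a priori bound for existence. *)
Lemma lyapunov_bounded q (b0 f : R) : 0 <= b0 -> 0 <= f ->
  exists2 B, 0 <= B & forall T (X F : R -> 'M[R]_(n, q)), 0 <= T -> `|X 0| <= b0 ->
    {within `[0, T], continuous X} ->
    (forall t, 0 < t < T -> is_derive t (1 : R) X (A *m X t + F t)) ->
    (forall t, 0 < t < T -> `|F t| <= f) -> `|X T| <= B.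
Proof.
move=> b00 f0; have [hP c0 k0 _ _] := L.
have [K K0 hK] := wsq_bound q P.
pose D := K * b0 ^+ 2 + c^-1 * (K * f ^+ 2) / c.
have D0 : 0 <= D by rewrite addr_ge0 // ?mulr_ge0 ?sqr_ge0 ?invr_ge0 ?(ltW c0).
exists (Num.sqrt (D / k)); first exact: sqrtr_ge0.
move=> T X F T0 hX0 cX hX hF.
have Xsq t : wsq P (X t) <= D -> `|X t| <= Num.sqrt (D / k).
  move=> h; rewrite -[leLHS]ger0_norm // -sqrtr_sqr ler_wsqrtr //.
  rewrite ler_pdivlMr // mulrC; apply: le_trans h; apply: le_trans (lyapunov_coercive _).
  by rewrite ler_pM2l // norm_le_nsq.
apply: Xsq.
have := @gronwall_bound _ (fun t => wsq P (X t)) _ c (c^-1 * (K * f ^+ 2)) 0 T c0 _ _ T0 _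
   (fun t ht => is_derive_wsq hP (hX t ht)).
have kf : 0 <= c^-1 * (K * f ^+ 2) by rewrite !mulr_ge0 ?sqr_ge0 ?invr_ge0 ?(ltW c0).
move=> H; apply: le_trans (H _ _ _ _) _ => //.
- exact: lyapunov_ge0.
- by move=> x; apply: cvg_wsq; exact: cX.
- move=> t ht; apply: le_trans (lyapunov_forced _ _) _.
  rewrite lerD2l ler_pM2l ?invr_gt0 //; apply: le_trans (hK _) _.
  by rewrite ler_wpM2l // lerXn2r ?nnegrE // hF.
- rewrite lerD2r; apply: le_trans (hK _) _.
  by rewrite ler_wpM2l // lerXn2r ?nnegrE.
Qed.

End Lyapunov.

Lemma lyapunov_scalar (R : realType) n (k : R) : 0 < k ->
  lyapunov (- k%:M : 'M[R]_n) (1%:M : 'M[R]_n) k 1.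
Proof.
move=> k0; split => //; first by rewrite trmx1.
- by move=> x; rewrite mul1r nsq_cV /qform mulmx1.
- move=> x; rewrite /qform !mulmx1 mulNmx mul_scalar_mx mulmxN -scalemxAr.
  by rewrite !mxE mulNr.
Qed.


(** * Solutions of ordinary differential equations with continuous data *)

Section EpsDelta.
Variables (R : realType) (V : normedModType R).
Implicit Types (e d s t : R).

Lemma is_derive_of_eps (x : R -> V) (t : R) (w : V) :
  (forall e, 0 < e -> exists2 d : R, 0 < d & forall h, `|h| < d ->
     `|x (t + h) - x t - h *: w| <= e * `|h|) ->
  is_derive t (1 : R) x w.
Proof.
move=> H.
have cv : h^-1 *: (x (h *: (1 : R) + t) - x t) @[h --> (0 : R)^'] --> w.
  apply/cvgrPdist_le => e e0; have [d d0 hd] := H e e0.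
  near=> h.
  have h0 : h != 0 by near: h; exact: nbhs_dnbhs_neq.
  have hlt : `|h| < d by near: h; exact: dnbhs0_lt.
  have hE : h *: (1 : R) = h by rewrite /GRing.scale /= mulr1.
  have := hd h hlt; rewrite [t + h]addrC distrC hE => {}hd.
  have -> : w - h^-1 *: (x (h + t) - x t) = h^-1 *: (h *: w - (x (h + t) - x t)).
    by rewrite [in RHS]scalerBr scalerA mulVf // scale1r.
  rewrite normrZ normfV mulrC ler_pdivrMr ?normr_gt0 //.
split; first by apply/cvg_ex; exists w.
by apply/cvg_lim.
Unshelve. all: by end_near. Qed.

Lemma within_continuous_of_eps (x : R -> V) :
  (forall t e, 0 <= t -> 0 < e -> exists2 d : R, 0 < d & forall s, 0 <= s ->
     `|s - t| < d -> `|x s - x t| <= e) ->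
  {within `[0, +oo[, continuous x}.
Proof.
move=> H; apply/subspace_continuousP => t; rewrite /= in_itv /= andbT => t0.
apply/cvgrPdist_le => e e0; have [d d0 hd] := H t e t0 e0.
near=> s; rewrite distrC; apply: hd.
  suff : (`[0, +oo[%classic : set R) s by rewrite /= in_itv /= andbT.
  by near: s; exact: withinT.
rewrite distrC; near: s; apply: cvg_within.
by have /cvgrPdist_lt := @cvg_id _ (nbhs t); apply.
Unshelve. all: by end_near. Qed.

End EpsDelta.

Section Peano.
Variables (R : realType) (V : normedModType R).
Implicit Types (e d s t : R).
Hypothesis cV : forall r : R, compact [set x : V | `|x| <= r].
Variables (F : R -> V -> V) (M : R -> R) (x0 : V).
Hypothesis cF : forall t x, 0 <= t -> forall e, 0 < e -> exists2 d : R, 0 < d &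
  forall s y, 0 <= s -> `|s - t| < d -> `|y - x| < d -> `|F s y - F t x| <= e.
Hypothesis M0 : forall t, 0 <= M t.
Hypothesis FM : forall T t x, 0 <= t <= T -> `|F t x| <= M T.

Let h k : R := k.+1%:R^-1.

Let h0 k : 0 < h k. Proof. by rewrite /h invr_gt0 ltr0n. Qed.

Fixpoint euler k j : V :=
  if j is j'.+1 then euler k j' + h k *: F (j'%:R * h k) (euler k j') else x0.

(** Along the polygon the increments add up, so an approximate constancy of the
   vector field transfers to the displacement. *)
Lemma euler_sum k i j w e : (i <= j)%N ->
  (forall l, (i <= l < j)%N -> `|F (l%:R * h k) (euler k l) - w| <= e) ->
  `|euler k j - euler k i - ((j - i)%:R * h k) *: w| <= (j - i)%:R * h k * e.
Proof.
move=> /subnKC <-; rewrite addKn; move: (j - i)%N => d {j}.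
elim: d => [|d IH] H; first by rewrite addn0 !mul0r scale0r subr0 subrr normr0.
rewrite addnS /=.
have -> : euler k (i + d) + h k *: F ((i + d)%:R * h k) (euler k (i + d)) - euler k i
    - (d.+1%:R * h k) *: w = (euler k (i + d) - euler k i - (d%:R * h k) *: w)
    + h k *: (F ((i + d)%:R * h k) (euler k (i + d)) - w).
  rewrite -natr1 mulrDl mul1r scalerDl scalerBr.
  rewrite -!addrA; congr (_ + _); rewrite opprD.
  by rewrite addrCA; congr (_ + _); rewrite [RHS]addrCA; congr (_ + _); rewrite addrC.
apply: le_trans (ler_normD _ _) _.
rewrite -natr1 !mulrDl mul1r lerD //.
  by apply: IH => l /andP[il ld]; apply: H; rewrite il addnS ltnS ltnW.
rewrite normrZ gtr0_norm ?h0 // ler_wpM2l ?(ltW (h0 k)) //; apply: H.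
by rewrite leq_addr addnS ltnSn.
Qed.

Let J k (t : R) : nat := Num.truncn (t * k.+1%:R).

Let J_le k t : 0 <= t -> (J k t)%:R * h k <= t.
Proof.
by move=> t0; rewrite ler_pdivrMr ?ltr0n // truncn_le mulr_ge0.
Qed.

Let J_gt k t : t < (J k t)%:R * h k + h k.
Proof.
rewrite -{2}[h k]mul1r -mulrDl natr1 ltr_pdivlMr ?ltr0n //.
exact: truncnS_gt.
Qed.

Let J_mono k s t : s <= t -> (J k s <= J k t)%N.
Proof. by move=> st; apply: le_truncn; rewrite ler_wpM2r. Qed.

Let J_diff k s t : 0 <= s <= t -> (J k t - J k s)%:R * h k <= t - s + h k.
Proof.
move=> /andP[s0 st]; rewrite natrB ?J_mono // mulrBl.
have := J_gt k s; have := J_le k (le_trans s0 st); lra.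
Qed.

Let J_diff2 k s t : 0 <= s <= t -> `|(J k t - J k s)%:R * h k - (t - s)| <= h k.
Proof.
move=> /andP[s0 st]; rewrite natrB ?J_mono // mulrBl ler_norml.
have := J_gt k s; have := J_le k (le_trans s0 st).
have := J_gt k t; have := J_le k s0; lra.
Qed.

Let euler_lip k T i j : (i <= j)%N -> (j <= J k T)%N -> 0 <= T ->
  `|euler k j - euler k i| <= (j - i)%:R * h k * M T.
Proof.
move=> ij jT T0; have := @euler_sum k i j 0 (M T) ij.
rewrite scaler0 subr0; apply => l /andP[_ lj]; rewrite subr0; apply: FM.
rewrite mulr_ge0 ?(ltW (h0 k)) //=; apply: le_trans (J_le k T0).
by rewrite ler_wpM2r ?(ltW (h0 k)) // ler_nat (leq_trans (ltnW lj)).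
Qed.

Let X k t : V := euler k (J k t).

Let X_lip k T s t : 0 <= s <= t -> t <= T -> `|X k t - X k s| <= (t - s + h k) * M T.
Proof.
move=> /andP[s0 st] tT.
have T0 : 0 <= T by apply: le_trans tT; apply: le_trans st.
apply: le_trans (euler_lip (J_mono k st) (J_mono k tT) T0) _.
by rewrite ler_wpM2r // J_diff // s0 st.
Qed.

Let h_le1 k : h k <= 1.
Proof. by rewrite /h invf_le1 ?ltr0n // ler1n. Qed.

Let X0 k : X k 0 = x0.
Proof. by rewrite /X /J mul0r truncn0. Qed.

Let X_ball k t : 0 <= t -> `|X k t| <= `|x0| + (t + 1) * M t.
Proof.
move=> t0; rewrite -[X k t](subrK (X k 0)) addrC X0.
apply: le_trans (ler_normD _ _) _; rewrite lerD2l -(X0 k).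
apply: le_trans (X_lip k (T := t) _ _) _; rewrite ?lexx ?t0 //.
by rewrite ler_wpM2r // subr0 lerD2l.
Qed.

(** Step-function Euler approximations X k stay in a compact ball at each time,
   so they converge pointwise along an ultrafilter.  The defining property of
   the derivative at a time t is a family of inequalities between finitely many
   values, hence survives the pointwise limit: no uniform convergence and no
   integral equation is involved. *)
Theorem peano_bounded : exists x : R -> V, [/\ x 0 = x0,
  {within `[0, +oo[, continuous x} &
  forall t, 0 < t -> is_derive t (1 : R) x (F t (x t))].
Proof.
have [U [UU subU]] := @ultraFilterLemma nat \oo _.
have PU : ProperFilter U by exact: ultra_proper.
have ex t : exists y : V, 0 <= t -> X k t @[k --> U] --> y.
  have [t0|_] := leP 0 t; last by exists 0.
  have fB : (X k t @[k --> U]) [set x : V | `|x| <= `|x0| + (t + 1) * M t].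
    by apply: (@filterS _ U _ setT); [move=> k _ /=; exact: X_ball|exact: filterT].
  have [y [_ cy]] := @cV _ (X k t @[k --> U]) (fmap_proper_filter _ _) fB.
  exists y => _ A Ay; have [//|nA] := in_ultra_setVsetC (X ^~ t @^-1` A) UU.
  have [z [zA nz]] := cy (~` A) A nA Ay.
  by case: zA.
have [x hx] := choice ex.
have hU : h k @[k --> U] --> (0 : R).
  by apply: (cvg_trans _ (@cvg_harmonic R)); move=> A hA; exact: subU.
(* inequalities between finitely many values, up to O(h k), pass to the limit *)
have limle (a b : R) (w : V) (B C : R) : 0 <= a -> 0 <= b ->
    (\forall k \near U, `|X k a - X k b - w| <= B + C * h k) ->
    `|x a - x b - w| <= B.
  move=> a0 b0 H.
  have c1 : `|X k a - X k b - w| @[k --> U] --> `|x a - x b - w|.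
    by apply: cvg_norm; apply: cvgB; [apply: cvgB; exact: hx|exact: cvg_cst].
  have c2 : B + C * h k @[k --> U] --> B.
    rewrite -[X in _ --> X]addr0; apply: cvgD; first exact: cvg_cst.
    by rewrite -[X in _ --> X](mulr0 C); apply: cvgM => //; exact: cvg_cst.
  exact: (ler_cvg_to c1 c2 H).
have xlip T s t : 0 <= s <= t -> t <= T -> `|x t - x s| <= (t - s) * M T.
  move=> /andP[s0 st] tT; rewrite -[x t - x s]subr0.
  apply: (limle t s 0 _ (M T)) => //; first exact: le_trans st.
  apply: (@filterS _ U _ setT); last exact: filterT.
  move=> k _ /=; rewrite subr0; apply: le_trans (X_lip k (T := T) _ _) _ => //.
    by rewrite s0 st.
  by rewrite mulrDl [h k * _]mulrC.
exists x; split.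
- apply/eqP; rewrite -subr_eq0 -normr_le0.
  have h1 : X k 0 @[k --> U] --> x0.
    by under eq_fun do rewrite X0; exact: cvg_cst.
  have -> : x 0 = x0 by apply: (cvg_unique _ (hx 0 (lexx _)) h1); exact: norm_hausdorff.
  by rewrite subrr normr0.
- apply: within_continuous_of_eps => t e t0 e0.
  have M1 : 0 < M (t + 1) + 1 by have := M0 (t + 1); lra.
  exists (Num.min 1 (e / (M (t + 1) + 1))).
    by rewrite lt_min ltr01 divr_gt0.
  move=> s s0; rewrite lt_min => /andP[st1]; rewrite ltr_pdivlMr // => st2.
  have [s1 t1] : s <= t + 1 /\ t <= t + 1.
    by move: st1; rewrite ltr_norml => /andP[]; lra.
  apply: le_trans (ltW st2); apply: le_trans (_ : `|s - t| * M (t + 1) <= _); last first.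
    by rewrite ler_wpM2l // lerDl.
  have [st|/ltW ts] := leP s t.
    rewrite distrC [`|s - t|]distrC [`|t - s|]ger0_norm ?subr_ge0 //.
    by apply: xlip; rewrite ?s0.
  rewrite [`|s - t|]ger0_norm ?subr_ge0 //.
  by apply: xlip; rewrite ?t0.
- move=> t t0; apply: is_derive_of_eps => e e0.
  set w := F t (x t); set B := M (t + 1) + 1.
  have MB : M (t + 1) <= B by rewrite /B; lra.
  have B1 : 1 <= B by rewrite /B; have := M0 (t + 1); lra.
  have B0 : 0 < B by lra.
  have [d d0 hd] := cF (x t) (ltW t0) e0.
  (* within d1 of t, once h k < d / (4 B), the polygon stays within d of (t, x t) *)
  pose d1 := Num.min (Num.min t 1) (d / (4 * B)).
  have B4 : 0 < 4 * B by lra.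
  have d10 : 0 < d1 by rewrite /d1 !lt_min t0 ltr01 divr_gt0.
  (* the estimate between two times a <= t <= b close to t *)
  have key (a b : R) : 0 <= a -> a <= t <= b -> b - a < d1 ->
      `|x b - x a - (b - a) *: w| <= e * (b - a).
    move=> a0 /andP[at_ tb]; rewrite /d1 !lt_min => /andP[/andP[ba1 ba2]].
    rewrite ltr_pdivlMr // => ba3.
    have ab : 0 <= a <= b by rewrite a0 (le_trans at_).
    have bT : b <= t + 1 by lra.
    have b0 : 0 <= b by lra.
    apply: (limle b a ((b - a) *: w) _ (e + `|w|)) => //.
    have n1 : \forall k \near U, `|x t - X k t| < d / 2.
      by have /cvgrPdist_lt := hx t (ltW t0); apply; lra.
    have n2 : \forall k \near U, `|0 - h k| < d / (4 * B).
      by move/cvgrPdist_lt: hU; apply; rewrite divr_gt0.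
    near=> k.
    have k1 : `|x t - X k t| < d / 2 by near: k.
    have k2 : h k * (4 * B) < d.
      have : `|0 - h k| < d / (4 * B) by near: k.
      by rewrite sub0r normrN gtr0_norm ?h0 // ltr_pdivlMr.
    have hk := h0 k.
    have hJ l : (J k a <= l < J k b)%N -> `|F (l%:R * h k) (euler k l) - w| <= e.
      move=> /andP[al lb].
      have l1 : l%:R * h k <= b.
        by apply: le_trans (J_le k b0); rewrite ler_wpM2r ?(ltW hk) // ler_nat ltnW.
      have l2 : a - h k <= l%:R * h k.
        have := J_gt k a; have : (J k a)%:R * h k <= l%:R * h k.
          by rewrite ler_wpM2r ?(ltW hk) // ler_nat.
        lra.
      have hkd : h k * 4 <= h k * (4 * B) by nra.
      have bad : (b - a) * 4 <= (b - a) * (4 * B) by nra.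
      apply: hd.
      - by rewrite mulr_ge0 // ltW.
      - by rewrite ltr_norml; apply/andP; split; lra.
      - have jj : `|euler k l - X k t| <= (b - a + h k) * M (t + 1).
          have c1 := J_mono k at_; have c2 := J_mono k tb; have c3 := J_mono k bT.
          have c4 : (J k b - J k a)%:R * h k * M (t + 1) <= (b - a + h k) * M (t + 1).
            by rewrite ler_wpM2r // J_diff.
          have t10 : 0 <= t + 1 by lra.
          apply: le_trans c4; have [lt_|/ltnW tl] := leqP l (J k t).
            rewrite distrC; apply: le_trans (euler_lip lt_ (leq_trans c2 c3) t10) _.
            rewrite ler_wpM2r // ler_wpM2r ?(ltW hk) // ler_nat.
            exact: leq_trans (leq_sub2l _ al) (leq_sub2r _ c2).
          apply: le_trans (euler_lip tl (leq_trans (ltnW lb) c3) t10) _.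
          rewrite ler_wpM2r // ler_wpM2r ?(ltW hk) // ler_nat.
          exact: leq_trans (leq_sub2l _ c1) (leq_sub2r _ (ltnW lb)).
        have jj2 : (b - a + h k) * M (t + 1) <= (b - a + h k) * B.
          by rewrite ler_wpM2l //; lra.
        rewrite -[euler k l - x t](subrKA (X k t)).
        apply: le_lt_trans (ler_normD _ _) _; rewrite [`|X k t - _|]distrC.
        nra.
    have D3 := euler_sum (J_mono k (le_trans at_ tb)) hJ.
    have D1 := J_diff k ab; have D2 := J_diff2 k ab.
    have -> : X k b - X k a - (b - a) *: w =
        (euler k (J k b) - euler k (J k a) - ((J k b - J k a)%:R * h k) *: w)
        + ((J k b - J k a)%:R * h k - (b - a)) *: w.
      by rewrite [in RHS]scalerBl subrKA.
    apply: le_trans (ler_normD _ _) _; rewrite normrZ.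
    have D4 := ler_wpM2r (normr_ge0 w) D2.
    have D5 := ler_wpM2r (ltW e0) D1.
    lra.
  exists d1 => // k hk; have [k0|k0] := leP 0 k.
    rewrite ger0_norm //; have := key t (t + k) (ltW t0).
    have -> : t + k - t = k by ring.
    by apply; rewrite ?lexx ?lerDl //; move: hk; rewrite ger0_norm.
  have kt : - k < t.
    move: hk; rewrite ltr0_norm // /d1 !lt_min => /andP[/andP[]]; lra.
  rewrite ltr0_norm //; have := key (t + k) t.
  have -> : t - (t + k) = - k by ring.
  have -> : `|x (t + k) - x t - k *: w| = `|x t - x (t + k) - (- k) *: w|.
    by rewrite scaleNr opprK -normrN !opprB addrC.
  apply; first lra.
    by apply/andP; split; lra.
  by move: hk; rewrite ltr0_norm.
Unshelve. all: by end_near. Qed.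

End Peano.

Section PeanoGlobal.
Variables (R : realType) (V : normedModType R).
Implicit Types (e d s t T : R).
Hypothesis cV : forall r : R, compact [set x : V | `|x| <= r].
Variables (F : R -> V -> V) (r : R -> R) (x0 : V).
Let D : set (R * V) := [set z | 0 <= z.1].
Hypothesis cF : {within D, continuous (fun z => F z.1 z.2)}.
Hypotheses (cr : continuous r) (r0 : forall t, 0 < r t).

Let clip t (x : V) : V := (r t / Num.max (r t) `|x|) *: x.

Let clip_norm t x : `|clip t x| <= r t.
Proof.
have m0 : 0 < Num.max (r t) `|x| by rewrite lt_max r0.
rewrite /clip normrZ ger0_norm ?divr_ge0 ?(ltW m0) ?(ltW (r0 t)) //.
rewrite mulrAC ler_pdivrMr //.
by rewrite ler_wpM2l ?(ltW (r0 t)) // le_max lexx orbT.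
Qed.

Let clip_id t x : `|x| < r t -> clip t x = x.
Proof. by move=> h; rewrite /clip max_l ?(ltW h) // divff ?scale1r // gt_eqF. Qed.

Let clip_cont : continuous (fun z : R * V => clip z.1 z.2).
Proof.
move=> z; rewrite /continuous_at /clip.
have c1 : r z'.1 @[z' --> z] --> r z.1.
  by apply: (@cvg_comp _ _ _ (fun z' : R * V => z'.1) r); [exact: cvg_fst|exact: cr].
have c2 : z'.2 @[z' --> z] --> z.2 by exact: cvg_snd.
apply: cvgZ => //; apply: cvgM => //; apply: cvgV.
  by rewrite gt_eqF // lt_max r0.
apply: (@continuous_max _ _ (fun z' : R * V => r z'.1) (fun z' => `|z'.2|) z); first exact: c1.
exact: cvg_norm.
Qed.

(** Global existence from an a priori bound: the field is made bounded by
   clipping its argument to the bound, and a solution of the clipped equation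
   cannot reach the bound for a first time. *)
Theorem peano_apriori :
  (forall T (x : R -> V), 0 <= T -> x 0 = x0 -> {within `[0, T], continuous x} ->
     (forall t, 0 < t < T -> is_derive t (1 : R) x (F t (x t))) -> `|x T| < r T) ->
  exists x : R -> V, [/\ x 0 = x0,
    {within `[0, +oo[, continuous x} &
    forall t, 0 < t -> is_derive t (1 : R) x (F t (x t))].
Proof.
move=> ap.
pose G t x := F t (clip t x).
have cG : {within D, continuous (fun z => G z.1 z.2)}.
  apply/subspace_continuousP => z Dz.
  have /subspace_continuousP/(_ (z.1, clip z.1 z.2) Dz) := cF.
  apply: (@cvg_comp _ _ _ (fun z' : R * V => (z'.1, clip z'.1 z'.2)) (fun z => F z.1 z.2)).
  move=> A hA.
  have c2 : (z'.1, clip z'.1 z'.2) @[z' --> z] --> (z.1, clip z.1 z.2).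
    have f1 : z'.1 @[z' --> z] --> z.1 by exact: cvg_fst.
    exact: (cvg_pair f1 (@clip_cont z)).
  exact: (c2 _ hA).
have bG T : exists m : R, 0 <= m /\ forall t x, 0 <= t <= T -> `|G t x| <= m.
  have ct : compact (`[0, T]%classic : set R) by exact: segment_compact.
  have [rm hrm] := continuous_compact_bounded ct cr.
  pose K := `[0, T]%classic `*` [set x : V | `|x| <= rm].
  have cK : compact K by apply: compact_setX.
  have : compact ((fun z => F z.1 z.2) @` K).
    apply: continuous_compact cK; apply: continuous_subspaceW cF.
    by move=> z [/=]; rewrite in_itv /= => /andP[].
  move=> /compact_bounded [m [mr h]].
  exists (`|m| + 1); split; first by rewrite addr_ge0.
  move=> t x tT; apply: (h (`|m| + 1)); first by rewrite (le_lt_trans (ler_norm m)) // ltrDl.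
  exists (t, clip t x) => //; split; rewrite /= ?in_itv //=.
  by apply: le_trans (clip_norm _ _) _; apply: le_trans (ler_norm _) (hrm t _); rewrite /= in_itv.
have [M hM] := choice bG.
have eG t x : 0 <= t -> forall e, 0 < e -> exists2 d : R, 0 < d &
    forall s y, 0 <= s -> `|s - t| < d -> `|y - x| < d -> `|G s y - G t x| <= e.
  move=> t0 e e0; have /subspace_continuousP/(_ (t, x) t0) := cG.
  move=> /cvgrPdist_le/(_ e e0); rewrite /within /= => /nbhs_ballP[d /= d0 hd].
  exists d => // s y s0 st yx; rewrite distrC; apply: (hd (s, y)) => //.
  by split; rewrite /= -ball_normE /= distrC.
have [x [hx0 cx hx]] := peano_bounded cV x0 eG (fun T => (hM T).1) (fun T => (hM T).2).
have cxT T : {within `[0, T], continuous x}.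
  apply: continuous_subspaceW cx => t /=; rewrite !in_itv /= andbT.
  by case/andP.
suff small t : 0 <= t -> `|x t| < r t.
  exists x; split => // t t0; have := hx t t0.
  by rewrite /G clip_id // small // ltW.
move=> t0; rewrite ltNge; apply/negP => tZ.
(* the first time b at which the solution would reach the bound *)
pose Z := [set s | 0 <= s /\ r s <= `|x s|].
have iZ : has_inf Z by split; [exists t|exists 0 => s []].
pose b := inf Z.
have b0 : 0 <= b by apply: lb_le_inf; [exists t|move=> s []].
have bb : `|x b| < r b.
  apply: ap => // s /andP[s0 sb]; have := hx s s0.
  rewrite /G clip_id // ltNge; apply/negP => sZ.
  by move: sb; rewrite ltNge ge_inf //; [exact: iZ.2|split => //; exact: ltW].
have /subspace_continuousP/(_ b) := cx; rewrite /= in_itv /= andbT => /(_ b0) cb.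
have c1 : r s - `|x s| @[s --> within `[0, +oo[ (nbhs b)] --> r b - `|x b|.
  have ca : r s @[s --> within `[0, +oo[ (nbhs b)] --> r b.
    by move=> A hA; exact: (@filterS _ (nbhs b) _ _ _ (fun s h _ => h) (@cr b A hA)).
  exact: (cvgB ca (cvg_norm cb)).
have rb : 0 < r b - `|x b| by rewrite subr_gt0.
have hb : nbhs b [set s | `[0, +oo[%classic s -> 0 < r s - `|x s|].
  exact: (cvgr_gt _ c1 _ rb).
move/nbhs_ballP: hb => [d /= d0 hd].
have [s [s0 hs] sb] := inf_adherent d0 iZ.
have bs : b <= s by apply: ge_inf; [exact: iZ.2|split].
have : 0 < r s - `|x s|.
  apply: hd; last by rewrite /= in_itv /= s0.
  rewrite -ball_normE /= distrC ger0_norm ?subr_ge0 //.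
  by rewrite ltrBlDl.
by rewrite subr_gt0 ltNge hs.
Qed.

End PeanoGlobal.

(** * Lyapunov forms of Hurwitz matrices *)

Section ComplexParts.
Variable R : realType.
Local Notation C := R[i].
Local Notation re := (@complex.Re R).
Local Notation im := (@complex.Im R).

Lemma reM (x y : C) : re (x * y) = re x * re y - im x * im y.
Proof. by case: x => a b; case: y => c d. Qed.

Lemma imM (x y : C) : im (x * y) = re x * im y + im x * re y.
Proof. by case: x => a b; case: y => c d. Qed.

Lemma re_sum (I : Type) (r : seq I) (P : pred I) (F : I -> C) :
  re (\sum_(i <- r | P i) F i) = \sum_(i <- r | P i) re (F i).
Proof.
have h : {morph re : x y / x + y} by move=> [a b] [c d].
exact: (big_morph _ h (erefl _)).
Qed.

Lemma im_sum (I : Type) (r : seq I) (P : pred I) (F : I -> C) :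
  im (\sum_(i <- r | P i) F i) = \sum_(i <- r | P i) im (F i).
Proof.
have h : {morph im : x y / x + y} by move=> [a b] [c d].
exact: (big_morph _ h (erefl _)).
Qed.

Lemma re_mulmx m n p (A : 'M[C]_(m, n)) (B : 'M[C]_(n, p)) :
  map_mx re (A *m B) =
  map_mx re A *m map_mx re B - map_mx im A *m map_mx im B.
Proof.
apply/matrixP => i j; rewrite !mxE re_sum -sumrB.
by apply: eq_bigr => k _; rewrite !mxE reM.
Qed.

Lemma im_mulmx m n p (A : 'M[C]_(m, n)) (B : 'M[C]_(n, p)) :
  map_mx im (A *m B) =
  map_mx re A *m map_mx im B + map_mx im A *m map_mx re B.
Proof.
apply/matrixP => i j; rewrite !mxE im_sum -big_split.
by apply: eq_bigr => k _; rewrite !mxE imM.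
Qed.

Lemma map_re_real m n (A : 'M[R]_(m, n)) : map_mx re (map_mx (real_complex R) A) = A.
Proof. by apply/matrixP => i j; rewrite !mxE. Qed.

Lemma map_im_real m n (A : 'M[R]_(m, n)) : map_mx im (map_mx (real_complex R) A) = 0.
Proof. by apply/matrixP => i j; rewrite !mxE. Qed.

Lemma complexmx0P m n (A : 'M[C]_(m, n)) : map_mx re A = 0 -> map_mx im A = 0 -> A = 0.
Proof.
move=> hr hi; apply/matrixP => i j.
have := congr1 (fun M : 'M[R]_(m, n) => M i j) hr; have := congr1 (fun M : 'M[R]_(m, n) => M i j) hi.
by rewrite !mxE; case: (A i j) => a b /= -> ->.
Qed.

End ComplexParts.

Section Hurwitz.
Variable R : realType.
Local Notation C := R[i].
Local Notation re := (@complex.Re R).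
Local Notation im := (@complex.Im R).

Lemma mul_tr_diag n (a b : 'cV[R]_n) : (a^T *m b) 0 0 = \sum_k a k 0 * b k 0.
Proof. by rewrite mxE; apply: eq_bigr => k _; rewrite mxE. Qed.

(** In triangular coordinates, weighted by powers of a small d, the off-diagonal
   entries become of order d and the diagonal dominates. *)
Lemma hurwitz_lyapunov n (A : 'M[R]_n) : hurwitz A ->
  exists P c k, lyapunov A P c k.
Proof.
case: n A => [|n0] A hA.
  (* the Schur decomposition needs a positive dimension *)
  exists 1%:M, 1, 1; split; rewrite ?trmx1 // => x.
  - by rewrite -wsq_cV -nsq_wsq mul1r.
  - by rewrite -wsq_cV (flatmx0 x) /wsq /qform !mulmx0 mxtrace0 mxE mulr0.
pose n := n0.+1; pose Ac := map_mx (real_complex R) A.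
(* T = Q A Q^-1 is lower triangular, with the eigenvalues on the diagonal *)
have [Q /unitarymx_unit Qu] := @Schur _ n Ac isT.
rewrite /similar_to conjumx // => Ttrig.
set T := Q *m Ac *m invmx Q in Ttrig.
have QA : Q *m Ac = T *m Q by rewrite /T mulmxKV.
clearbody T.
have Tlow (i j : 'I_n) : (i < j)%N -> T i j = 0 by move: i j; exact/is_trig_mxP.
have Tre k : re (T k k) < 0.
  apply: hA; have : eigenvalue T (T k k).
    rewrite eigenvalue_root_char char_poly_trig // rootE horner_prod.
    by apply/prodf_eq0; exists k; rewrite // hornerXsubC subrr.
  move/eigenvalueP => [v vT v0]; apply/eigenvalueP; exists (v *m Q).
    by rewrite -mulmxA -/Ac QA mulmxA vT scalemxAl.
  by rewrite -(mul0mx _ Q) (inj_eq (can_inj (mulmxK Qu))).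
pose c := \big[Num.min/1]_(k < n) (- re (T k k) / 2).
have c0 : 0 < c.
  by apply/bigmin_gtP; split => // k _; rewrite divr_gt0 // oppr_gt0.
have cT k : re (T k k) <= - (2 * c).
  have : c <= - re (T k k) / 2 by exact: bigmin_le.
  lra.
pose tau := \big[Num.max/1]_(ij : 'I_n * 'I_n) (`|re (T ij.1 ij.2)| + `|im (T ij.1 ij.2)|).
have tauT i j : `|re (T i j)| + `|im (T i j)| <= tau.
  exact: (le_bigmax _ (fun ij : 'I_n * 'I_n => `|re (T ij.1 ij.2)| + `|im (T ij.1 ij.2)|) (i, j)).
have tau1 : 1 <= tau by apply: bigmax_ge_id.
have tn0 : 0 < tau * n%:R + c.
  by rewrite ltr_pwDr // mulr_ge0 //; lra.
(* the n off-diagonal terms of a row, each at most d * tau, add up to at most c *)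
pose d := c / (tau * n%:R + c).
have d0 : 0 < d by rewrite divr_gt0.
have d1 : d <= 1 by rewrite ler_pdivrMr // mul1r lerDr mulr_ge0 //; lra.
have dc : d * (tau * n%:R) <= c.
  rewrite mulrAC ler_pdivrMr // ler_wpM2l ?lerDl ?(ltW c0) //.
pose dC i : C := real_complex R (d ^+ i).
(* Z = diag(d^i) Q conjugates A to S = (d^(i - j) T_ij), which is still lower
   triangular with the same diagonal *)
pose Z : 'M[C]_n := \matrix_(i, j) (dC i * Q i j).
pose S : 'M[C]_n := \matrix_(i, j) (dC (i - j)%N * T i j).
have ZA : Z *m Ac = S *m Z.
  apply/matrixP => i j; rewrite !mxE.
  transitivity (dC i * (Q *m Ac) i j).
    by rewrite mxE mulr_sumr; apply: eq_bigr => k _; rewrite mxE mulrA.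
  rewrite QA mxE mulr_sumr; apply: eq_bigr => k _; rewrite !mxE.
  have [ik|ki] := ltnP i k; first by rewrite Tlow // !(mul0r, mulr0).
  have -> : dC i = dC (i - k)%N * dC k by rewrite /dC -rmorphM -exprD subnK.
  by rewrite mulrACA.
have Soff i j : i != j -> `|re (S i j)| + `|im (S i j)| <= d * tau.
  move=> ij; rewrite mxE reM imM /= !mul0r subr0 addr0 !normrM -mulrDr.
  have [lij|lji] := ltnP i j.
    by rewrite Tlow // !normr0 addr0 mulr0 mulr_ge0 ?(ltW d0) //; lra.
  have lt : (0 < i - j)%N by rewrite subn_gt0 ltn_neqAle eq_sym ij.
  apply: ler_pM => //.
  rewrite ger0_norm ?exprn_ge0 ?(ltW d0) //.
  rewrite -(prednK lt) exprS ler_piMr ?(ltW d0) // exprn_ile1 ?(ltW d0) //.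
have Sdiag i : re (S i i) <= - (2 * c).
  by rewrite mxE subnn reM /= expr0 mul1r mul0r subr0.
clearbody S.
pose Zr := map_mx re Z; pose Zi := map_mx im Z.
pose P := Zr^T *m Zr + Zi^T *m Zi.
have qP x : qform P x = nsq (Zr *m x) + nsq (Zi *m x).
  by rewrite /qform /P !nsq_cV mulmxDr mulmxDl mxE !trmx_mul !mulmxA.
have pP : posdef P.
  move=> x x0; rewrite qP lt_def addr_ge0 ?nsq_ge0 // andbT.
  apply: contra x0; rewrite paddr_eq0 ?nsq_ge0 // !nsq_eq0 => /andP[/eqP zr /eqP zi].
  pose xc := map_mx (real_complex R) x.
  have Zx : Z *m xc = 0.
    apply: complexmx0P.
      by rewrite re_mulmx map_re_real map_im_real mulmx0 subr0.
    by rewrite im_mulmx map_re_real map_im_real mulmx0 add0r.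
  have Qx : Q *m xc = 0.
    apply/matrixP => i j; have := congr1 (fun M : 'M[C]_(n, 1) => M i j) Zx; rewrite !mxE.
    under eq_bigr do rewrite mxE -mulrA.
    rewrite -mulr_sumr => /eqP; rewrite mulf_eq0 => /orP[/eqP h|/eqP //].
    by have := congr1 re h; move/eqP; rewrite /= expf_eq0 gt_eqF ?andbF.
  have xc0 : xc = 0 by rewrite -(mulKmx Qu xc) Qx mulmx0.
  by rewrite -(map_re_real x) -/xc xc0; apply/eqP/matrixP => i j; rewrite !mxE.
have [k k0 hk] := posdef_coercive pP.
exists P, c, k; split => //.
  by rewrite /P linearD /= !trmx_mul !trmxK.
move=> x.
pose Sr := map_mx re S; pose Si := map_mx im S.
have Zr_A : Zr *m A = Sr *m Zr - Si *m Zi.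
  have := congr1 (map_mx re) ZA; rewrite !re_mulmx /Ac map_re_real map_im_real mulmx0 subr0.
  exact.
have Zi_A : Zi *m A = Sr *m Zi + Si *m Zr.
  have := congr1 (map_mx im) ZA; rewrite !im_mulmx /Ac map_re_real map_im_real mulmx0 add0r.
  exact.
pose a := Zr *m x; pose b := Zi *m x.
have -> : x^T *m P *m (A *m x) =
    a^T *m (Sr *m a - Si *m b) + b^T *m (Sr *m b + Si *m a).
  have h1 : Zr *m (A *m x) = Sr *m a - Si *m b.
    by rewrite [LHS]mulmxA Zr_A mulmxBl /a /b !mulmxA.
  have h2 : Zi *m (A *m x) = Sr *m b + Si *m a.
    by rewrite [LHS]mulmxA Zi_A mulmxDl /a /b !mulmxA.
  by rewrite -h1 -h2 /P [in LHS]mulmxDr [in LHS]mulmxDl /a /b !trmx_mul -!mulmxA.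
rewrite qP -/a -/b; clearbody a b; rewrite mxE !mul_tr_diag -big_split /=.
pose m k := a k 0 ^+ 2 + b k 0 ^+ 2.
have m0 i : 0 <= m i by rewrite addr_ge0 ?sqr_ge0.
have -> : nsq a + nsq b = \sum_i m i.
  rewrite !nsq_cV !mul_tr_diag -big_split; apply: eq_bigr => i _.
  by rewrite /m !expr2.
pose term i j := re (S i j) * (a i 0 * a j 0 + b i 0 * b j 0)
  + im (S i j) * (b i 0 * a j 0 - a i 0 * b j 0).
have termle i j : term i j <= (if i == j then - (2 * c) * m i else 0)
     + d * tau / 2 * (m i + m j).
  have dt0 : 0 <= d * tau by rewrite mulr_ge0 ?(ltW d0) //; lra.
  have [<-|ij] := eqVneq i j.
    have h1 : re (S i i) * m i <= - (2 * c) * m i by rewrite ler_wpM2r.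
    have h2 : 0 <= d * tau / 2 * (m i + m i) by have := m0 i; nra.
    have -> : term i i = re (S i i) * m i by rewrite /term /m; ring.
    lra.
  rewrite add0r; have := Soff i j ij; rewrite /term /m.
  move: (re (S i j)) (im (S i j)) (a i 0) (a j 0) (b i 0) (b j 0) => r s a1 a2 b1 b2 h.
  have p1 := sqr_ge0 (a1 + a2); have p2 := sqr_ge0 (a1 - a2).
  have p3 := sqr_ge0 (b1 + b2); have p4 := sqr_ge0 (b1 - b2).
  have p5 := sqr_ge0 (b1 + a2); have p6 := sqr_ge0 (b1 - a2).
  have p7 := sqr_ge0 (a1 + b2); have p8 := sqr_ge0 (a1 - b2).
  have e1 : `|a1 * a2 + b1 * b2| <= (a1 ^+ 2 + b1 ^+ 2 + (a2 ^+ 2 + b2 ^+ 2)) / 2.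
    by rewrite ler_norml; apply/andP; split; lra.
  have e2 : `|b1 * a2 - a1 * b2| <= (a1 ^+ 2 + b1 ^+ 2 + (a2 ^+ 2 + b2 ^+ 2)) / 2.
    by rewrite ler_norml; apply/andP; split; lra.
  apply: le_trans (ler_norm _) _; apply: le_trans (ler_normD _ _) _.
  rewrite !normrM.
  set q := (_ / 2) in e1 e2.
  have q0 : 0 <= q by apply: le_trans e1.
  have f1 : `|r| * `|a1 * a2 + b1 * b2| <= `|r| * q by rewrite ler_wpM2l.
  have f2 : `|s| * `|b1 * a2 - a1 * b2| <= `|s| * q by rewrite ler_wpM2l.
  have f3 : (`|r| + `|s|) * q <= d * tau * q by rewrite ler_wpM2r.
  have -> : d * tau / 2 * (a1 ^+ 2 + b1 ^+ 2 + (a2 ^+ 2 + b2 ^+ 2)) = d * tau * q.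
    by rewrite /q; ring.
  lra.
have -> : \sum_i (a i 0 * (Sr *m a - Si *m b) i 0 + b i 0 * (Sr *m b + Si *m a) i 0)
    = \sum_i \sum_j term i j.
  apply: eq_bigr => i _; rewrite !mxE -sumrB -big_split !mulr_sumr -big_split /=.
  by apply: eq_bigr => j _; rewrite !mxE /term; ring.
apply: le_trans (ler_sum _ (fun i _ => ler_sum _ (fun j _ => termle i j))) _.
have -> : \sum_i \sum_j ((if i == j then - (2 * c) * m i else 0) + d * tau / 2 * (m i + m j))
   = - (2 * c) * (\sum_i m i) + d * (tau * n%:R) * (\sum_i m i).
  under eq_bigr => i _ do rewrite big_split /= -big_mkcond /= (big_pred1 i) //
     -mulr_sumr big_split /= sumr_const card_ord.
  rewrite big_split /= -mulr_sumr; congr (_ + _).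
  rewrite -mulr_sumr big_split /= sumr_const card_ord sumrMnl.
  rewrite -[(\sum_(i < n) m i) *+ n]mulr_natr; move: (n%:R : R) (\sum_(i < n) m i) => nn s; by field.
have s0 : 0 <= \sum_i m i by apply: sumr_ge0.
have : d * (tau * n%:R) * (\sum_i m i) <= c * (\sum_i m i) by rewrite ler_wpM2r.
lra.
Qed.

End Hurwitz.

(** * The Laplacian of a graph with a spanning tree *)

Section Laplacian.
Variables (R : realType) (N : nat) (e : rel 'I_N) (a : 'M[R]_N) (u : 'rV[R]_N).
Hypotheses (hadj : adjacency e a) (htree : has_spanning_tree e).
Hypotheses (hu : (u <= eigenspace (laplacian a) 0)%MS) (hu1 : \sum_i u 0 i = 1).

Lemma laplacian_mulE q (X : 'M[R]_(N, q)) i j :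
  (laplacian a *m X) i j = \sum_k a i k * (X i j - X k j).
Proof.
rewrite mxE (bigD1 i) //= mxE eqxx mulr_suml -big_split /=.
rewrite [RHS](bigD1 i) //= subrr mulr0 add0r.
apply: eq_bigr => k ki; rewrite !mxE eq_sym (negbTE ki); ring.
Qed.

Lemma adjacency_ge0 i j : 0 <= a i j.
Proof.
by have [h1 h2] := hadj i j; case: (boolP (e j i)) => [/h1/ltW //|/h2 ->].
Qed.

Lemma left_eigen_laplacian : u *m laplacian a = 0.
Proof. by have /eigenspaceP := hu; rewrite scale0r. Qed.

Let m (r s : 'cV[R]_N) i := r i 0 ^+ 2 + s i 0 ^+ 2.

(** At a component of maximal modulus of an eigenvector, a nonpositive real part
   of the eigenvalue forces equality with all the in-neighbours. *)
Lemma laplacian_max_modulus (r s : 'cV[R]_N) (p q : R) i :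
  laplacian a *m r = p *: r - q *: s -> laplacian a *m s = p *: s + q *: r ->
  p <= 0 -> (forall j, m r s j <= m r s i) ->
  forall j, 0 < a i j -> r j 0 = r i 0 /\ s j 0 = s i 0.
Proof.
move=> Lr Ls p0 hi j aij.
have Er := congr1 (fun M : 'cV[R]_N => M i 0) Lr.
have Es := congr1 (fun M : 'cV[R]_N => M i 0) Ls.
rewrite laplacian_mulE !mxE in Er; rewrite laplacian_mulE !mxE in Es.
have tge k : 0 <= a i k * (m r s i - (r i 0 * r k 0 + s i 0 * s k 0)).
  apply: mulr_ge0; first exact: adjacency_ge0.
  have := hi k; rewrite /m => hk.
  have := sqr_ge0 (r i 0 - r k 0); have := sqr_ge0 (s i 0 - s k 0); lra.
have sum0 : \sum_k a i k * (m r s i - (r i 0 * r k 0 + s i 0 * s k 0)) <= 0.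
  have -> : \sum_k a i k * (m r s i - (r i 0 * r k 0 + s i 0 * s k 0))
     = r i 0 * (\sum_k a i k * (r i 0 - r k 0)) + s i 0 * (\sum_k a i k * (s i 0 - s k 0)).
    rewrite !mulr_sumr -big_split; apply: eq_bigr => k _ /=; rewrite /m; ring.
  rewrite Er Es.
  have -> : r i 0 * (p * r i 0 - q * s i 0) + s i 0 * (p * s i 0 + q * r i 0)
    = p * m r s i by rewrite /m; ring.
  by rewrite mulr_le0_ge0 // addr_ge0 ?sqr_ge0.
have tj : a i j * (m r s i - (r i 0 * r j 0 + s i 0 * s j 0)) = 0.
  apply/eqP; rewrite eq_le tge andbT; apply: le_trans sum0.
  by rewrite (bigD1 j) //= lerDl sumr_ge0.
move/eqP: tj; rewrite mulf_eq0 gt_eqF //= => /eqP tj.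
have := hi j; move: tj; rewrite /m => tj hj.
have q1 := sqr_ge0 (r j 0 - r i 0); have q2 := sqr_ge0 (s j 0 - s i 0).
split; apply/eqP; rewrite -subr_eq0 -sqrf_eq0; apply/eqP; lra.
Qed.

Lemma exists_max_modulus (r s : 'cV[R]_N) (i0 : 'I_N) :
  exists i, forall j, m r s j <= m r s i.
Proof.
have [i _ hi] := @Order.TotalTheory.arg_maxP _ _ _ i0 xpredT (m r s) isT.
by exists i => j; exact: hi.
Qed.

(** Equality with the in-neighbours propagates against the edges up to the root. *)
Lemma laplacian_root_max (r s : 'cV[R]_N) (p q : R) i k :
  laplacian a *m r = p *: r - q *: s -> laplacian a *m s = p *: s + q *: r ->
  p <= 0 -> (forall j, m r s j <= m r s i) -> connect e k i ->
  r k 0 = r i 0 /\ s k 0 = s i 0.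
Proof.
move=> Lr Ls p0 hi /connectP[w].
elim: w k => [|y w IH] k /=; first by move=> _ ->.
case/andP=> ky pw lw; have [ry sy] := IH y pw lw.
have my j : m r s j <= m r s y by rewrite {2}/m ry sy; exact: hi.
rewrite -ry -sy; apply: (laplacian_max_modulus Lr Ls p0 my).
by have [h _] := hadj y k; exact: h.
Qed.

(** Subtract the value at the root: the component of maximal modulus then agrees
   with the root, where the difference vanishes. *)
Lemma laplacian_kernel (r : 'cV[R]_N) : laplacian a *m r = 0 ->
  exists c, forall i, r i 0 = c.
Proof.
move=> Lr; have [k hk] := htree; exists (r k 0) => i.
pose r' : 'cV[R]_N := r - const_mx (r k 0).
have L' : laplacian a *m r' = 0.
  apply/matrixP => x y; rewrite laplacian_mulE [RHS]mxE.
  have := congr1 (fun M : 'cV[R]_N => M x y) Lr; rewrite laplacian_mulE [RHS]mxE => h.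
  rewrite -[RHS]h.
  by apply: eq_bigr => z _; rewrite !mxE; congr (_ * _); ring.
have [i1 hi1] := exists_max_modulus r' 0 i.
have [r1 _] : r' k 0 = r' i1 0 /\ (0 : 'cV[R]_N) k 0 = (0 : 'cV[R]_N) i1 0.
  apply: (@laplacian_root_max r' 0 0 0 i1 k) => //.
    by rewrite L' !scale0r subr0.
  by rewrite mulmx0 !scale0r addr0.
have := hi1 i; rewrite /m -r1 !mxE subrr expr0n /= addr0 => h.
apply/eqP; rewrite -subr_eq0 -sqrf_eq0 eq_le sqr_ge0 andbT.
by move: h; rewrite ?addr0.
Qed.

(** Minus the Laplacian with its zero eigenvalue moved to -1 by a rank-one term. *)
Definition grounded_laplacian : 'M[R]_N := - (laplacian a + const_mx 1 *m u).

Let ue (x : 'cV[R]_N) : R := (u *m x) 0 0.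

Let u_grounded (x : 'cV[R]_N) : ue (grounded_laplacian *m x) = - ue x.
Proof.
rewrite /ue /grounded_laplacian mulNmx mulmxN mulmxA mulmxDr left_eigen_laplacian add0r.
rewrite mulmxA -mulmxA [u *m const_mx 1]mx11_scalar mul_scalar_mx.
by rewrite !mxE; under eq_bigr do rewrite mxE mulr1; rewrite hu1 mul1r.
Qed.

Let groundedE (x : 'cV[R]_N) i : (grounded_laplacian *m x) i 0 = - (laplacian a *m x) i 0 - ue x.
Proof.
rewrite mulNmx mulmxDl -mulmxA !mxE opprD; congr (_ + - _).
by rewrite big_ord1 mxE mul1r.
Qed.

(** An eigenvector for another eigenvalue than -1 has zero weighted mean, hence is
   an eigenvector of the Laplacian for the opposite eigenvalue.  By the maximum
   modulus argument the latter has positive real part unless the vector is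
   constant, and a constant vector of zero mean vanishes. *)
Lemma hurwitz_grounded : hurwitz grounded_laplacian.
Proof.
set G := grounded_laplacian.
move=> z hz.
have {hz} : eigenvalue (map_mx (real_complex R) G)^T z.
  rewrite eigenvalue_root_char; move: hz; rewrite eigenvalue_root_char.
  rewrite /char_poly -det_tr; congr (root (\det _) z).
  by apply/matrixP => x y; rewrite !mxE eq_sym.
move/eigenvalueP => [v /(congr1 trmx)]; rewrite trmx_mul trmxK linearZ /=.
set w := v^T => Gw v0.
have w0 : w != 0 by rewrite /w trmx_eq0.
pose r := map_mx (@complex.Re R) w; pose s := map_mx (@complex.Im R) w.
pose p := - complex.Re z; pose q := - complex.Im z.
have Gr : G *m r = - p *: r + q *: s.
  have := congr1 (map_mx (@complex.Re R)) Gw.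
  rewrite re_mulmx map_re_real map_im_real mul0mx subr0 => ->.
  by apply/matrixP => x y; rewrite !mxE reM /p /q; ring.
have Gs : G *m s = - p *: s - q *: r.
  have := congr1 (map_mx (@complex.Im R)) Gw.
  rewrite im_mulmx map_re_real map_im_real mul0mx addr0 => ->.
  by apply/matrixP => x y; rewrite !mxE imM /p /q; ring.
rewrite -oppr_gt0 -/p ltNge; apply/negP => p0.
(* u is a left eigenvector for -1, and z <> -1 as its real part is now assumed
   nonnegative *)
have [ur us] : ue r = 0 /\ ue s = 0.
  have := u_grounded r; have := u_grounded s; rewrite -/G Gr Gs /ue.
  rewrite !mulmxDr ?mulmxN -!scalemxAr.
  have eD (x y : 'M[R]_1) : (x + y) 0 0 = x 0 0 + y 0 0 by rewrite mxE.
  have eN (x : 'M[R]_1) : (- x) 0 0 = - x 0 0 by rewrite mxE.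
  have eZ k (x : 'M[R]_1) : (k *: x) 0 0 = k * x 0 0 by rewrite mxE.
  rewrite !eD ?eN !eZ -/(ue r) -/(ue s) => h1 h2.
  have k1 : ue r * (1 - p) = - q * ue s by lra.
  have k2 : ue s * (1 - p) = q * ue r by lra.
  have s2 : (ue r ^+ 2 + ue s ^+ 2) * (1 - p) = 0.
    have -> : (ue r ^+ 2 + ue s ^+ 2) * (1 - p) = ue r * (ue r * (1 - p)) + ue s * (ue s * (1 - p)) by ring.
    by rewrite k1 k2; ring.
  have p1 : 0 < 1 - p by lra.
  move/eqP: s2; rewrite mulf_eq0 (gt_eqF p1) orbF paddr_eq0 ?sqr_ge0 // !sqrf_eq0.
  by case/andP => /eqP -> /eqP ->.
(* hence w is an eigenvector of the Laplacian, for p + i q = - z *)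
have Lr : laplacian a *m r = p *: r - q *: s.
  apply/matrixP => i j; rewrite ord1; have := groundedE r i; rewrite -/G Gr ur !mxE; lra.
have Ls : laplacian a *m s = p *: s + q *: r.
  apply/matrixP => i j; rewrite ord1; have := groundedE s i; rewrite -/G Gs us !mxE; lra.
have [i0 wi0] : exists i, w i 0 != 0.
  apply/existsP; apply: contraNT w0 => /existsPn h.
  by apply/eqP/matrixP => i j; rewrite ord1 [RHS]mxE; apply/eqP; move: (h i); rewrite negbK.
have m0 : 0 < m r s i0.
  rewrite lt_def addr_ge0 ?sqr_ge0 // andbT; apply: contra wi0.
  rewrite paddr_eq0 ?sqr_ge0 // !sqrf_eq0 [r i0 0]mxE [s i0 0]mxE => /andP[/eqP h1 /eqP h2].
  by apply/eqP; move: h1 h2; case: (w i0 0) => x y /= -> ->.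
have [i hi] := exists_max_modulus r s i0.
have mi : 0 < m r s i by apply: lt_le_trans (hi i0).
have nb := laplacian_max_modulus Lr Ls p0 hi.
have zero (x : 'cV[R]_N) : (forall j, 0 < a i j -> x j 0 = x i 0) -> (laplacian a *m x) i 0 = 0.
  move=> h; rewrite laplacian_mulE big1 // => j _.
  have := adjacency_ge0 i j; rewrite le_eqVlt => /predU1P[<-|/h ->]; first by rewrite mul0r.
  by rewrite subrr mulr0.
have z1 := zero r (fun j h => (nb j h).1); have z2 := zero s (fun j h => (nb j h).2).
rewrite Lr !mxE in z1; rewrite Ls !mxE in z2.
(* at the maximum the Laplacian vanishes, so p + i q = 0 *)
have pq : (p ^+ 2 + q ^+ 2) * m r s i = 0.
  have -> : (p ^+ 2 + q ^+ 2) * m r s i = (p * r i 0 - q * s i 0) ^+ 2 + (p * s i 0 + q * r i 0) ^+ 2.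
    by rewrite /m; ring.
  by rewrite !mxE z1 z2 expr0n addr0.
move/eqP: pq; rewrite mulf_eq0 (gt_eqF mi) orbF paddr_eq0 ?sqr_ge0 // !sqrf_eq0.
case/andP => /eqP pz /eqP qz.
(* so w is constant, with zero weighted mean *)
have [cr hr] : exists c, forall i, r i 0 = c.
  by apply: laplacian_kernel; rewrite Lr pz qz !scale0r subr0.
have [cs hs] : exists c, forall i, s i 0 = c.
  by apply: laplacian_kernel; rewrite Ls pz qz !scale0r addr0.
have uec (x : 'cV[R]_N) c : (forall i, x i 0 = c) -> ue x = c.
  move=> h; rewrite /ue mxE -[RHS]mul1r -hu1 mulr_suml.
  by apply: eq_bigr => j _; rewrite h.
have cr0 : cr = 0 by rewrite -(uec _ _ hr).
have cs0 : cs = 0 by rewrite -(uec _ _ hs).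
by move: mi; rewrite /m hr hs cr0 cs0 expr0n addr0 ltxx.
Qed.

End Laplacian.

(** * The matrix exponential *)

Section Expmx.
Variables (R : realType) (n : nat).
Implicit Types (A : 'M[R]_n) (t : R).

Let exp_coef A d (i j : 'I_n) (k : nat) : R := (A ^+ (k + d)) i j / k`!%:R.

Lemma norm_mx1 : `|1%:M : 'M[R]_n| <= 1.
Proof.
apply: mx_norm_le => // i j; rewrite mxE.
by case: eqP => _; rewrite ?normr1 ?normr0.
Qed.

Lemma norm_expmx_le A k : `|A ^+ k| <= (n%:R * `|A|) ^+ k.
Proof.
elim: k => [|k IH]; first by rewrite !expr0 norm_mx1.
rewrite !exprS; apply: le_trans (norm_mulmx _ _) _.
by rewrite ler_wpM2l // mulr_ge0.
Qed.

Let cvg_exp_coef A d i j x : cvgn (pseries (exp_coef A d i j) x).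
Proof.
apply: normed_cvg.
pose b := n%:R * `|A|; have b0 : 0 <= b by rewrite mulr_ge0.
apply: (@series_le_cvg _ _ (b ^+ d *: exp_coeff (b * `|x|))).
- by move=> k /=.
- by move=> k; rewrite mulr_ge0 ?exprn_ge0 ?exp_coeff_ge0 ?mulr_ge0.
- move=> k; rewrite /= /exp_coef normrM normrM normfV normr_nat normrX.
  rewrite -[X in _ <= X]/(b ^+ d * ((b * `|x|) ^+ k / k`!%:R)).
  have -> : b ^+ d * ((b * `|x|) ^+ k / k`!%:R) = b ^+ (k + d) / k`!%:R * `|x| ^+ k.
    by rewrite [(b * _) ^+ _]exprMn exprD; move: (_^-1) (b ^+ d) (b ^+ k) (`|x| ^+ k) => z1 z2 z3 z4; ring.
  rewrite ler_wpM2r ?exprn_ge0 // ler_wpM2r ?invr_ge0 ?ler0n //.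
  exact: le_trans (mx_entry_le _ _ _) (norm_expmx_le _ _).
- by apply: is_cvg_seriesZ; exact: is_cvg_series_exp_coeff.
Qed.

Let exp_term A t k := (k`!%:R : R)^-1 *: (t *: A) ^+ k.

Let exprZ A t k : (t *: A) ^+ k = t ^+ k *: A ^+ k.
Proof.
elim: k => [|k IH]; first by rewrite !expr0 scale1r.
by rewrite !exprS IH -[LHS]/((t *: A) *m (t ^+ k *: A ^+ k)) -scalemxAl -scalemxAr scalerA.
Qed.

Let series_entry A t i j N : series (exp_term A t) N i j = pseries (exp_coef A 0 i j) t N.
Proof.
rewrite /series /= summxE; apply: eq_bigr => k _.
rewrite /= /exp_coef addn0 /exp_term exprZ; move: (A ^+ k) => B; rewrite !mxE; move: (_^-1) (t ^+ k) => z1 z2; ring.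
Qed.

Let expmx_lim A t : series (exp_term A t) @ \oo -->
  (\matrix_(i, j) limn (pseries (exp_coef A 0 i j) t) : 'M[R]_n).
Proof.
apply: cvg_mx => i j; rewrite mxE; under eq_fun do rewrite series_entry.
exact: cvg_exp_coef.
Qed.

Let expmxE A t : expmx (t *: A) = \matrix_(i, j) limn (pseries (exp_coef A 0 i j) t).
Proof. by apply: cvg_lim => //; exact: expmx_lim. Qed.

Lemma expmx_cvg A t :
  series (fun k => (k`!%:R : R)^-1 *: (t *: A) ^+ k) @ \oo --> expmx (t *: A).
Proof. by rewrite expmxE; exact: expmx_lim. Qed.

Let diffs_exp_coef A d i j : pseries_diffs (exp_coef A d i j) = exp_coef A d.+1 i j.
Proof.
apply/funext => k; rewrite /pseries_diffs /exp_coef addSnnS factS natrM.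
by rewrite invfM mulrCA mulVKf ?pnatr_eq0.
Qed.

Let expmx_diff A t : is_derive t (1 : R) (fun s => expmx (s *: A))
   (\matrix_(i, j) limn (pseries (exp_coef A 1 i j) t)).
Proof.
apply: is_derive_mx => i j; rewrite mxE.
have -> : (fun s => expmx (s *: A) i j) = (fun s => limn (pseries (exp_coef A 0 i j) s)).
  by apply/funext => s; rewrite expmxE mxE.
rewrite -diffs_exp_coef; apply: (@pseries_snd_diffs _ _ (`|t| + 1)).
- exact: cvg_exp_coef.
- by rewrite diffs_exp_coef; exact: cvg_exp_coef.
- by rewrite !diffs_exp_coef; exact: cvg_exp_coef.
- by rewrite [ltRHS]ger0_norm ?addr_ge0 // ltrDl.
Qed.

Lemma is_derive_expmx_l A t :
  is_derive t (1 : R) (fun s => expmx (s *: A)) (A *m expmx (t *: A)).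
Proof.
apply: is_derive_conv (expmx_diff A t) _.
have h : (fun N => A *m series (exp_term A t) N) @ \oo --> A *m expmx (t *: A).
  by apply: cvg_mulmx; [exact: cvg_cst|exact: expmx_cvg].
apply/matrixP => i j; rewrite [LHS]mxE; apply: cvg_lim => //.
suff -> : pseries (exp_coef A 1 i j) t = (fun N => (A *m series (exp_term A t) N) i j).
  exact: (cvg_entry (i:=i) (j:=j) h).
apply/funext => N; rewrite mxE.
under eq_bigr => l _ do rewrite series_entry /pseries /series /= mulr_sumr.
rewrite exchange_big /pseries /series /=; apply: eq_bigr => k _.
rewrite /exp_coef addn1 exprS -[(A * _)]/(A *m _) mxE mulr_suml mulr_suml.
by apply: eq_bigr => l _; rewrite addn0 !mulrA.
Qed.

Lemma is_derive_expmx_r A t :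
  is_derive t (1 : R) (fun s => expmx (s *: A)) (expmx (t *: A) *m A).
Proof.
apply: is_derive_conv (expmx_diff A t) _.
have h : (fun N => series (exp_term A t) N *m A) @ \oo --> expmx (t *: A) *m A.
  by apply: cvg_mulmx; [exact: expmx_cvg|exact: cvg_cst].
apply/matrixP => i j; rewrite [LHS]mxE; apply: cvg_lim => //.
suff -> : pseries (exp_coef A 1 i j) t = (fun N => (series (exp_term A t) N *m A) i j).
  exact: (cvg_entry (i:=i) (j:=j) h).
apply/funext => N; rewrite mxE.
under eq_bigr => l _ do rewrite series_entry /pseries /series /= mulr_suml.
rewrite exchange_big /pseries /series /=; apply: eq_bigr => k _.
rewrite /exp_coef addn1 exprSr -[(_ * A)]/(_ *m A) mxE mulr_suml mulr_suml.
by apply: eq_bigr => l _; rewrite addn0; ring.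
Qed.

Lemma expmx0 A : expmx (0 *: A) = 1%:M.
Proof.
rewrite expmxE; apply/matrixP => i j; rewrite mxE.
apply: cvg_lim => //; apply: cvg_near_cst; exists 1%N => // N /= N1.
rewrite /pseries /series /= -(prednK N1) big_nat_recl // big1_seq ?addr0.
  by rewrite /exp_coef addn0 expr0 fact0 divr1 expr0 mulr1.
by move=> k _; rewrite exprS mul0r mulr0.
Qed.

Lemma expmx_inv A t : expmx (- (t *: A)) *m expmx (t *: A) = 1%:M.
Proof.
rewrite -scalerN.
pose f s := expmx (s *: - A) *m expmx (s *: A).
suff h : f t = f 0 by rewrite -/(f t) h /f !expmx0 mulmx1.
apply/matrixP => i j; apply: (@is_derive_0_is_cst _ (fun s => f s i j)) => s.
have hf : is_derive s (1 : R) f 0.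
  apply: is_derive_conv (is_derive_mulmx (is_derive_expmx_r (- A) s) (is_derive_expmx_l A s)) _.
  by rewrite mulmxN mulNmx -mulmxA addNr.
by have := is_derive_entry i j hf; rewrite mxE.
Qed.

Lemma expmx_invr A t : expmx (t *: A) *m expmx (- (t *: A)) = 1%:M.
Proof. by have := expmx_inv (- A) t; rewrite scalerN opprK. Qed.

Lemma norm_expmx A t : 0 <= t -> `|expmx (t *: A)| <= expR (n%:R * `|A| * t).
Proof.
move=> t0; have h1 : `|series (exp_term A t) N| @[N --> \oo] --> `|expmx (t *: A)|.
  by apply: cvg_norm; exact: expmx_cvg.
have h2 : series (exp_coeff (n%:R * `|A| * t)) @ \oo --> expR (n%:R * `|A| * t).
  exact: is_cvg_series_exp_coeff.
apply: (ler_cvg_to h1 h2).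
near=> N; rewrite /series /=; apply: le_trans (ler_norm_sum _ _ _) _.
apply: ler_sum => k _; rewrite normrZ ger0_norm ?invr_ge0 ?ler0n //.
rewrite exprZ normrZ normrX ger0_norm // mulrC /exp_coeff /= ler_wpM2r ?invr_ge0 ?ler0n //.
by rewrite exprMn mulrC ler_wpM2r ?exprn_ge0 // norm_expmx_le.
Unshelve. all: by end_near. Qed.

Lemma norm_expmxN A t : 0 <= t -> `|expmx (- (t *: A))| <= expR (n%:R * `|A| * t).
Proof. by move=> t0; rewrite -scalerN -(normrN A); exact: norm_expmx. Qed.

End Expmx.

(** * The distributed observer *)

Section ObserverAlgebra.
Variables (R : realType) (N n : nat) (e : rel 'I_N) (a : 'M[R]_N) (u : 'rV[R]_N).
Hypotheses (hadj : adjacency e a) (hu : (u <= eigenspace (laplacian a) 0)%MS).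
Hypothesis hu1 : \sum_i u 0 i = 1.
Local Notation L := (laplacian a).
Local Notation G := (grounded_laplacian a u).

Lemma consensus_term q1 q2 (X : 'I_N -> 'M[R]_(q1, q2)) i :
  \sum_(j | e j i) a i j *: (X j - X i) = - \sum_k a i k *: (X i - X k).
Proof.
rewrite -sumrN big_mkcond /=; apply: eq_bigr => k _.
rewrite -scalerN opprB; case: (boolP (e k i)) => // h.
by have [_ ->] := hadj i k; rewrite ?scale0r.
Qed.

Lemma row_laplacian q (X : 'M[R]_(N, q)) i :
  row i (L *m X) = \sum_k a i k *: (row i X - row k X).
Proof.
apply/rowP => j; rewrite mxE laplacian_mulE summxE.
by apply: eq_bigr => k _; rewrite !mxE.
Qed.

(** The component in the kernel of u, parallel to the constant vectors.  The states
   of the agents are stored as the rows of one matrix. *)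
Definition deviation q (X : 'M[R]_(N, q)) := X - const_mx 1 *m (u *m X).

Lemma mean_const1 : u *m (const_mx 1 : 'cV[R]_N) = 1%:M.
Proof.
rewrite [LHS]mx11_scalar mxE; congr (_%:M).
by rewrite -[RHS]hu1; apply: eq_bigr => i _; rewrite mxE mulr1.
Qed.

Lemma mean_deviation q (X : 'M[R]_(N, q)) : u *m deviation X = 0.
Proof. by rewrite /deviation mulmxBr [u *m (_ *m (u *m X))]mulmxA mean_const1 mul1mx subrr. Qed.

Lemma laplacian_const1 : L *m (const_mx 1 : 'cV[R]_N) = 0.
Proof.
apply/matrixP => i j; rewrite laplacian_mulE [RHS]mxE big1 // => k _.
by rewrite !mxE subrr mulr0.
Qed.

Lemma laplacian_deviation q (X : 'M[R]_(N, q)) : L *m deviation X = L *m X.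
Proof. by rewrite /deviation mulmxBr [L *m (_ *m (u *m X))]mulmxA laplacian_const1 mul0mx subr0. Qed.

Lemma grounded_deviation q (X : 'M[R]_(N, q)) : G *m deviation X = - (L *m X).
Proof.
by rewrite mulNmx mulmxDl -mulmxA mean_deviation mulmx0 addr0 laplacian_deviation.
Qed.

Lemma deviation_laplacian q (X : 'M[R]_(N, q)) k :
  deviation (k *: (L *m X)) = k *: (L *m X).
Proof.
by rewrite /deviation -scalemxAr mulmxA (left_eigen_laplacian hu) mul0mx scaler0 mulmx0 subr0.
Qed.

Lemma deviationD q (X Y : 'M[R]_(N, q)) : deviation (X + Y) = deviation X + deviation Y.
Proof. by rewrite /deviation !mulmxDr opprD addrACA. Qed.

Lemma deviationM q r (X : 'M[R]_(N, q)) (B : 'M[R]_(q, r)) :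
  deviation (X *m B) = deviation X *m B.
Proof. by rewrite /deviation mulmxBl !mulmxA. Qed.

Lemma norm_const1_mul q (h : 'rV[R]_q) : `|(const_mx 1 : 'cV[R]_N) *m h| <= `|h|.
Proof.
apply: mx_norm_le => // i j; rewrite mxE big_ord1 mxE mul1r.
exact: mx_entry_le.
Qed.

Lemma norm_deviation q (X : 'M[R]_(N, q)) : `|deviation X| <= (1 + N%:R * `|u|) * `|X|.
Proof.
rewrite /deviation mulrDl mul1r; apply: le_trans (ler_normB _ _) _.
by rewrite lerD2l; apply: le_trans (norm_const1_mul _) (norm_mulmx _ _).
Qed.

Lemma is_derive_deviation q t (X : R -> 'M[R]_(N, q)) dX :
  is_derive t (1 : R) X dX ->
  is_derive t (1 : R) (fun s => deviation (X s)) (deviation dX).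
Proof.
move=> hX; apply: is_derive_sub => //.
have h1 : is_derive t (1 : R) (fun s => u *m X s) (u *m dX).
  apply: (is_derive_conv (is_derive_mulmx (is_derive_cst u t 1) hX)).
  by rewrite mul0mx add0r.
apply: (is_derive_conv (is_derive_mulmx (is_derive_cst (const_mx 1 : 'cV[R]_N) t 1) h1)).
by rewrite mul0mx add0r.
Qed.

Lemma cvg_deviation (T : Type) (F : set_system T) {FF : Filter F} q
    (X : T -> 'M[R]_(N, q)) (A : 'M[R]_(N, q)) :
  X @ F --> A -> (fun t => deviation (X t)) @ F --> deviation A.
Proof.
move=> hX; apply: cvgB => //; apply: cvg_mulmx; first exact: cvg_cst.
by apply: cvg_mulmx => //; exact: cvg_cst.
Qed.

Variables (P : 'M[R]_N) (c k : R).
Hypothesis LP : lyapunov G P c k.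

(** On deviations - L acts as the Hurwitz matrix G. *)
Lemma consensus_decay q mu T (X : R -> 'M[R]_(N, q)) : 0 < mu -> 0 <= T ->
  {within `[0, T], continuous X} ->
  (forall t, 0 < t < T -> is_derive t (1 : R) X (- mu *: (L *m X t))) ->
  wsq P (deviation (X T)) <= expR (- (2 * c * mu) * T) * wsq P (deviation (X 0)).
Proof.
move=> mu0 T0 cX hX; have [hP c0 _ _ _] := LP.
have cmu : 0 < 2 * c * mu by rewrite !mulr_gt0.
have := @gronwall _ (fun t => wsq P (deviation (X t))) _ (2 * c * mu) 0 0 T (lt0r_neq0 cmu) T0 _
  (fun t ht => is_derive_wsq hP (is_derive_deviation (hX t ht))).
rewrite mul0r !subr0 add0r; apply.
  by move=> x; apply: cvg_wsq; apply: cvg_deviation; exact: cX.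
move=> t ht; rewrite addr0 deviation_laplacian.
have -> : - mu *: (L *m X t) = mu *: (G *m deviation (X t)).
  by rewrite grounded_deviation scalerN scaleNr.
rewrite -scalemxAr linearZ /= .
have := lyapunov_decr LP (deviation (X t)); rewrite mulmxA => h.
nra.
Qed.

Lemma constant_of_derive0 (f : R -> R) T : 0 <= T -> {within `[0, T], continuous f} ->
  (forall t, 0 < t < T -> is_derive t (1 : R) f 0) -> f T = f 0.
Proof.
move=> T0 cf hf; apply/eqP; rewrite eq_le; apply/andP; split.
  exact: (@le_of_derive_le0 _ f (fun=> 0) 0 T).
have := @le_of_derive_le0 _ (fun t => - f t) (fun=> 0) 0 T T0.
rewrite lerN2; apply=> //.
  by move=> x; apply: cvgN; exact: cf.
by move=> t /hf ht; apply: (is_derive_conv (is_derive_opp ht)); rewrite oppr0.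
Qed.

Lemma consensus_mean q mu T (X : R -> 'M[R]_(N, q)) : 0 <= T ->
  {within `[0, T], continuous X} ->
  (forall t, 0 < t < T -> is_derive t (1 : R) X (- mu *: (L *m X t))) ->
  u *m X T = u *m X 0.
Proof.
move=> T0 cX hX; apply/matrixP => i j.
apply: (constant_of_derive0 (f := fun t => (u *m X t) i j) T0).
  by apply: (within_entry (f := fun t => u *m X t)); apply: within_mulmx => //; exact: within_cst.
move=> t ht.
have := is_derive_entry i j (is_derive_mulmx (is_derive_cst u t 1) (hX t ht)).
move=> h; apply: (is_derive_conv h).
by rewrite mul0mx add0r -scalemxAr mulmxA (left_eigen_laplacian hu) mul0mx scaler0 mxE.
Qed.

Variable Sstar : 'M[R]_n.

(** With mismatch and eta_field below: the dynamics of eta, the agents being the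
   rows of H.  The mismatch is the part of the drift due to S_i - Sstar. *)
Definition drift (S : 'I_N -> 'M[R]_n) (H : 'M[R]_(N, n)) : 'M[R]_(N, n) :=
  \matrix_i (S i *m (row i H)^T)^T.

Definition eta_field (mu2 : R) (S : 'I_N -> 'M[R]_n) (H : 'M[R]_(N, n)) :=
  drift S H - mu2 *: (L *m H).

Definition energy (H : 'M[R]_(N, n)) := wsq P (deviation H) + nsq (u *m H).

Definition mismatch (S : 'I_N -> 'M[R]_n) H := drift (fun i => S i - Sstar) H.

Lemma drift_split S H : drift S H = H *m Sstar^T + mismatch S H.
Proof.
apply/row_matrixP => i; rewrite linearD /= !rowK row_mul !trmx_mul trmxK -mulmxDr.
by rewrite -linearD /= addrC subrK.
Qed.

Lemma norm_mismatch S H s : 0 <= s -> (forall i, `|S i - Sstar| <= s) ->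
  `|mismatch S H| <= n%:R * s * `|H|.
Proof.
move=> s0 hs; apply: mx_norm_le; first by rewrite !mulr_ge0.
move=> i j; rewrite mxE.
apply: le_trans (mx_entry_le _ _ _) _; rewrite norm_trmx.
apply: le_trans (norm_mulmx _ _) _; rewrite ler_pM ?mulr_ge0 //.
  by rewrite ler_wpM2l.
by rewrite norm_trmx; apply: mx_norm_le => // x y; rewrite mxE mx_entry_le.
Qed.

Lemma energy_ge0 H : 0 <= energy H.
Proof. by rewrite addr_ge0 ?nsq_ge0 ?(lyapunov_ge0 LP). Qed.

Lemma eta_field_mean mu2 S H :
  u *m eta_field mu2 S H = u *m H *m Sstar^T + u *m mismatch S H.
Proof.
rewrite /eta_field mulmxBr -scalemxAr [u *m (L *m H)]mulmxA (left_eigen_laplacian hu).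
by rewrite mul0mx scaler0 subr0 drift_split mulmxDr mulmxA.
Qed.

Lemma eta_field_deviation mu2 S H : deviation (eta_field mu2 S H) =
  deviation H *m Sstar^T + (mu2 *: (G *m deviation H) + deviation (mismatch S H)).
Proof.
rewrite /eta_field drift_split !deviationD -scaleNr deviation_laplacian deviationM.
by rewrite grounded_deviation scalerN -scaleNr -addrA; congr (_ + _); rewrite addrC.
Qed.

(** K depends neither on the gains nor on the state.  The decay of the deviation is
   2 c mu2 - K, whereas the mean only feels Sstar and the mismatch, whose size
   is governed by the distance s of the S_i from Sstar. *)
Definition energy_constant (K : R) : Prop :=
  forall mu2 S s H, 0 <= mu2 -> 0 <= s -> (forall i, `|S i - Sstar| <= s) ->
  [/\ `|H| ^+ 2 <= K * energy H,
      `|u *m mismatch S H| <= K * s * `|H|,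
      2 * \tr ((deviation H)^T *m P *m deviation (eta_field mu2 S H)) <=
        - (2 * c * mu2 - K) * wsq P (deviation H) + K * s ^+ 2 * energy H &
      2 * \tr ((u *m H)^T *m (u *m eta_field mu2 S H)) <=
        K * nsq (u *m H) + K * s ^+ 2 * energy H].

(** The gain mu2 damps the deviation; everything else grows at a rate that
   depends neither on mu1 nor on mu2. *)
Lemma energy_estimates : exists2 K, 0 < K & energy_constant K.
Proof.
have [hP c0 k0 _ _] := LP.
have [Kp Kp0 hKp] := wsq_bound n P.
have pos : forall Z : 'M[R]_(N, n), 0 <= wsq P Z by move=> Z; exact: (lyapunov_ge0 LP).
have pos1 : forall Z : 'rV[R]_n, 0 <= wsq 1%:M Z by move=> Z; rewrite -nsq_wsq nsq_ge0.
pose c1 := 2 * (k^-1 + 1).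
pose c2 := 1 + N%:R * `|u|.
pose sg := n%:R * `|Sstar|.
have c10 : 0 <= c1 by rewrite mulr_ge0 // addr_ge0 // invr_ge0 ltW.
have c20 : 0 <= c2 by rewrite addr_ge0 // mulr_ge0.
have sg0 : 0 <= sg by rewrite mulr_ge0.
have dk H : `|deviation H| ^+ 2 <= k^-1 * wsq P (deviation H :> 'M[R]_(N, n)).
  rewrite mulrC ler_pdivlMr // mulrC; apply: le_trans (lyapunov_coercive LP _).
  by rewrite ler_pM2l // norm_le_nsq.
(* H is the sum of its deviation and of a constant vector *)
have HE (H : 'M[R]_(N, n)) : `|H| ^+ 2 <= c1 * energy H.
  have h1 : `|H| <= `|deviation H| + `|u *m H|.
    rewrite -{1}[H](subrK (const_mx 1 *m (u *m H))); apply: le_trans (ler_normD _ _) _.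
    by rewrite lerD2l norm_const1_mul.
  have h2 := dk H; have h3 := norm_le_nsq (u *m H); have h4 := nsq_ge0 (u *m H).
  have h5 := pos (deviation H); have h6 : 0 < k^-1 by rewrite invr_gt0.
  have h7 : `|H| ^+ 2 <= (`|deviation H| + `|u *m H|) ^+ 2.
    by rewrite lerXn2r ?nnegrE ?addr_ge0.
  have h8 := sqr_ge0 (`|deviation H| - `|u *m H|).
  rewrite /energy /c1; nra.
pose K1 := Kp * c2 ^+ 2 * (n%:R ^+ 2) * c1.
pose K2 := n%:R * (N%:R * `|u|) ^+ 2 * n%:R ^+ 2 * c1.
have ki0 : 0 <= k^-1 by rewrite invr_ge0 ltW.
have kkp : 0 <= Kp * sg ^+ 2 * k^-1 by do ![apply: mulr_ge0 => // | apply: exprn_ge0 => //].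
have kkn : 0 <= n%:R * sg ^+ 2 by do ![apply: mulr_ge0 => // | apply: exprn_ge0 => //].
have K10 : 0 <= K1 by do ![apply: mulr_ge0 => // | apply: exprn_ge0 => //].
have nu0 : 0 <= N%:R * `|u| by rewrite mulr_ge0.
have K20 : 0 <= K2 by do ![apply: mulr_ge0 => // | apply: exprn_ge0 => //].
have K30 : 0 <= N%:R * `|u| * n%:R by apply: mulr_ge0.
pose K := 3 + Kp * sg ^+ 2 * k^-1 + n%:R * sg ^+ 2 + K1 + K2 + c1 + N%:R * `|u| * n%:R.
exists K; first by rewrite /K; lra.
move=> mu2 S s H m0 s0 hs.
have E0 := energy_ge0 H.
have mm : `|mismatch S H| ^+ 2 <= n%:R ^+ 2 * c1 * s ^+ 2 * energy H.
  have := norm_mismatch H s0 hs => h.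
  apply: (@le_trans _ _ ((n%:R * s * `|H|) ^+ 2)).
    by rewrite lerXn2r ?nnegrE ?mulr_ge0.
  have ns0 : 0 <= (n%:R * s) ^+ 2 by rewrite exprn_ge0 // mulr_ge0.
  have := ler_wpM2l ns0 (HE H); rewrite !exprMn; lra.
have W0 := pos (deviation H); have B0 := nsq_ge0 (u *m H).
have sE : 0 <= s ^+ 2 * energy H by rewrite mulr_ge0 ?exprn_ge0.
split.
- apply: le_trans (HE H) _; rewrite ler_wpM2r // /K; lra.
- apply: le_trans (norm_mulmx _ _) _.
  apply: (@le_trans _ _ (N%:R * `|u| * n%:R * s * `|H|)).
    by rewrite -!mulrA ler_wpM2l // ler_wpM2l // mulrA norm_mismatch.
  by rewrite ler_wpM2r // ler_wpM2r // /K; lra.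
- rewrite eta_field_deviation 2!mulmxDr !mxtraceD 2!mulrDr.
  have y1 := wsq_young (deviation H) (deviation H *m Sstar^T) hP pos (ltr01).
  have y2 := wsq_young (deviation H) (deviation (mismatch S H)) hP pos (ltr01).
  have y3 := ler_wpM2l m0 (lyapunov_decr LP (deviation H)).
  rewrite -scalemxAr mxtraceZ.
  have z1 : wsq P (deviation H *m Sstar^T) <= Kp * sg ^+ 2 * k^-1 * wsq P (deviation H).
    apply: le_trans (hKp _) _; rewrite -[leRHS]mulrA -[leRHS]mulrA ler_wpM2l //.
    apply: (@le_trans _ _ (sg ^+ 2 * `|deviation H| ^+ 2)); last first.
      by apply: ler_wpM2l; [exact: exprn_ge0|exact: dk].
    rewrite -exprMn lerXn2r ?nnegrE ?mulr_ge0 //.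
    by apply: le_trans (norm_mulmx _ _) _; rewrite norm_trmx /sg mulrAC.
  have z2 : wsq P (deviation (mismatch S H)) <= K1 * (s ^+ 2 * energy H).
    have -> : K1 * (s ^+ 2 * energy H) = Kp * (c2 ^+ 2 * (n%:R ^+ 2 * c1 * s ^+ 2 * energy H)).
      by rewrite /K1; ring.
    apply: le_trans (hKp _) _; rewrite ler_wpM2l //.
    apply: (@le_trans _ _ (c2 ^+ 2 * `|mismatch S H| ^+ 2)).
      by rewrite -exprMn lerXn2r ?nnegrE ?mulr_ge0 // norm_deviation.
    by apply: ler_wpM2l; [exact: exprn_ge0|exact: mm].
  rewrite invr1 !mul1r in y1 y2.
  have k1 : (2 + Kp * sg ^+ 2 * k^-1) * wsq P (deviation H) <= K * wsq P (deviation H).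
    by rewrite ler_wpM2r // /K; lra.
  have k2 : K1 * (s ^+ 2 * energy H) <= K * s ^+ 2 * energy H.
    by rewrite -[leRHS]mulrA ler_wpM2r // /K; lra.
  lra.
- rewrite eta_field_mean mulmxDr mxtraceD mulrDr.
  have y1 := wsq_young (u *m H) (u *m H *m Sstar^T) (@trmx1 _ _) pos1 (ltr01).
  have y2 := wsq_young (u *m H) (u *m mismatch S H) (@trmx1 _ _) pos1 (ltr01).
  rewrite invr1 !mul1r -!nsq_wsq !mulmx1 in y1 y2.
  have z1 : nsq (u *m H *m Sstar^T) <= n%:R * sg ^+ 2 * nsq (u *m H).
    apply: le_trans (nsq_le_norm _) _; rewrite mul1n -[leRHS]mulrA ler_wpM2l //.
    apply: (@le_trans _ _ (sg ^+ 2 * `|u *m H| ^+ 2)); last first.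
      by apply: ler_wpM2l; [exact: exprn_ge0|exact: norm_le_nsq].
    rewrite -exprMn lerXn2r ?nnegrE ?mulr_ge0 //.
    by apply: le_trans (norm_mulmx _ _) _; rewrite norm_trmx /sg mulrAC.
  have z2 : nsq (u *m mismatch S H) <= K2 * (s ^+ 2 * energy H).
    have -> : K2 * (s ^+ 2 * energy H) =
        n%:R * ((N%:R * `|u|) ^+ 2 * (n%:R ^+ 2 * c1 * s ^+ 2 * energy H)).
      by rewrite /K2; ring.
    apply: le_trans (nsq_le_norm _) _; rewrite mul1n ler_wpM2l //.
    apply: (@le_trans _ _ ((N%:R * `|u|) ^+ 2 * `|mismatch S H| ^+ 2)).
      by rewrite -exprMn lerXn2r ?nnegrE ?mulr_ge0 // norm_mulmx.
    by apply: ler_wpM2l; [exact: exprn_ge0|exact: mm].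
  have k1 : (2 + n%:R * sg ^+ 2) * nsq (u *m H) <= K * nsq (u *m H).
    by rewrite ler_wpM2r // /K; lra.
  have k2 : K2 * (s ^+ 2 * energy H) <= K * s ^+ 2 * energy H.
    by rewrite -[leRHS]mulrA ler_wpM2r // /K; lra.
  lra.
Qed.

End ObserverAlgebra.

Section ExpLimit.
Variable R : realType.
Implicit Types (s t l : R).

(** The tail of the integral of the bound decays at the same rate as the bound. *)
Lemma exp_limit (f df : R -> R) (C beta : R) : 0 <= C -> 0 < beta ->
  {within `[0, +oo[, continuous f} ->
  (forall t, 0 < t -> is_derive t (1 : R) f (df t)) ->
  (forall t, 0 < t -> `|df t| <= C * expR (- beta * t)) ->
  exists l, forall t, 0 <= t -> `|f t - l| <= C / beta * expR (- beta * t).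
Proof.
move=> C0 b0 cf hf hdf.
pose g t := C / beta * expR (- beta * t).
have g0 t : 0 <= g t by rewrite mulr_ge0 ?expR_ge0 // divr_ge0 // ltW.
have hg (t : R) : is_derive t (1 : R) g (- C * expR (- beta * t)).
  apply: (is_derive_conv (is_derive_scale (is_derive_expRM (- beta) t) (C / beta))).
  rewrite /GRing.scale /=; field; lra.
have cg (D : set R) : {within D, continuous g} by apply: (@within_of_derive _ _ D g _ hg).
have cfT s t : 0 <= s -> {within `[s, t], continuous f}.
  move=> s0; apply: continuous_subspaceW cf => x /=; rewrite !in_itv /= andbT => /andP[sx _].
  exact: le_trans sx.
have key s t : 0 <= s -> s <= t -> `|f t - f s| <= g s.
  move=> s0 st.
  have h1 : f t + g t <= f s + g s.
    (* g is the tail of the integral of the bound on |df| *)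
    apply: (@le_of_derive_le0 _ (fun x => f x + g x) (fun x => df x + - C * expR (- beta * x)) s t st).
    - by apply: within_add; [exact: cfT|exact: cg].
    - by move=> x /andP[sx _]; exact: (is_derive_add (hf x (le_lt_trans s0 sx)) (hg x)).
    - move=> x /andP[sx _]; have := hdf x (le_lt_trans s0 sx).
      by rewrite ler_norml => /andP[]; lra.
  have h2 : g t - f t <= g s - f s.
    apply: (@le_of_derive_le0 _ (fun x => g x - f x) (fun x => - C * expR (- beta * x) - df x) s t st).
    - by apply: within_sub; [exact: cg|exact: cfT].
    - by move=> x /andP[sx _]; exact: (is_derive_sub (hg x) (hf x (le_lt_trans s0 sx))).
    - move=> x /andP[sx _]; have := hdf x (le_lt_trans s0 sx).
      by rewrite ler_norml => /andP[]; lra.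
  by have := g0 t; rewrite ler_norml; lra.
pose A := [set y | exists2 t, 0 <= t & y = f t - g t].
have ub t : 0 <= t -> ubound A (f t + g t).
  move=> t0 _ [s s0 ->]; have [st|/ltW ts] := leP s t.
    by have := key s t s0 st; have := g0 t; rewrite ler_norml; lra.
  by have := key t s t0 ts; have := g0 s; rewrite ler_norml; lra.
have A0 : A !=set0 by exists (f 0 - g 0), 0.
exists (sup A) => t t0.
have h1 : sup A <= f t + g t by apply: ge_sup => //; exact: ub.
have h2 : f t - g t <= sup A.
  by apply: ub_le_sup; [exists (f 0 + g 0); exact: ub|exists t].
by rewrite -/(g t) ler_norml; lra.
Qed.

Lemma exp_limit_mx m n (f df : R -> 'M[R]_(m, n)) (C beta : R) : 0 <= C -> 0 < beta ->
  {within `[0, +oo[, continuous f} ->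
  (forall t, 0 < t -> is_derive t (1 : R) f (df t)) ->
  (forall t, 0 < t -> `|df t| <= C * expR (- beta * t)) ->
  exists l : 'M[R]_(m, n), forall t, 0 <= t -> `|f t - l| <= C / beta * expR (- beta * t).
Proof.
move=> C0 b0 cf hf hdf.
have ex ij : exists l, forall t, 0 <= t ->
    `|f t ij.1 ij.2 - l| <= C / beta * expR (- beta * t).
  apply: (@exp_limit (fun t => f t ij.1 ij.2) (fun t => df t ij.1 ij.2)) => //.
  - exact: within_entry.
  - by move=> t t0; apply: is_derive_entry; exact: hf.
  - by move=> t t0; apply: le_trans (hdf t t0); exact: mx_entry_le.
have [l hl] := choice ex.
exists (\matrix_(i, j) l (i, j)) => t t0; apply: mx_norm_le.
  by rewrite mulr_ge0 ?expR_ge0 // divr_ge0 // ltW.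
by move=> i j; rewrite !mxE; exact: (hl (i, j)).
Qed.

End ExpLimit.

Section EtaDynamics.
Variable R : realType.
Implicit Types (t T x : R).
Variables (N n : nat) (a : 'M[R]_N) (u : 'rV[R]_N).
Hypotheses (hu : (u <= eigenspace (laplacian a) 0)%MS) (hu1 : \sum_i u 0 i = 1).
Variables (P : 'M[R]_N) (c k : R).
Hypothesis LP : lyapunov (grounded_laplacian a u) P c k.
Variables (Sstar : 'M[R]_n) (K : R).
Hypotheses (K0 : 0 < K) (hK : energy_constant a u P c Sstar K).
Variables (mu1 mu2 C0 : R).
Hypotheses (C00 : 0 <= C0) (mu10 : 0 < mu1) (mu20 : 0 < mu2).
Let kappa : R := K + 2 * K * C0 ^+ 2.
Let b : R := n%:R * `|Sstar|.
(* The energy grows at most at the rate kappa and passing to the frame that moves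
   with Sstar costs the rate b.  The mismatch decays at the rate c mu1, so that
   hmu1 makes its effect in that frame decay at the rate b + 1; hmu2 does the
   same for the deviation. *)
Hypothesis hmu1 : kappa + 4 * b + 3 <= 2 * c * mu1.
Hypothesis hmu2 : 2 * b + 2 <= 2 * c * mu2 - K.
Variable S : 'I_N -> R -> 'M[R]_n.
Hypothesis hS : forall i t, 0 <= t -> `|S i t - Sstar| <= C0 * expR (- (c * mu1) * t).

Local Notation field := (eta_field a mu2).
Local Notation energy := (energy u P).
Local Notation dev := (deviation u).

Let s t : R := C0 * expR (- (c * mu1) * t).

Let s0 t : 0 <= s t. Proof. by rewrite mulr_ge0 ?expR_ge0. Qed.

Let b0 : 0 <= b. Proof. by rewrite mulr_ge0. Qed.

Let kappa0 : 0 < kappa.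
Proof. by rewrite ltr_pwDl // mulr_ge0 ?sqr_ge0 // mulr_ge0 // ltW. Qed.

Let cm : 0 < c * mu1. Proof. by have := hmu1; have := kappa0; have := b0; lra. Qed.

Let s_le t : 0 <= t -> s t <= C0.
Proof.
move=> t0; rewrite ler_piMr // -expR0 ler_expR mulNr oppr_le0 mulr_ge0 //.
exact: ltW.
Qed.

Let W_derive t (H : R -> 'M[R]_(N, n)) dH : is_derive t (1 : R) H dH ->
  is_derive t (1 : R) (fun x => wsq P (dev (H x)))
    (2 * \tr ((dev (H t))^T *m P *m dev dH)).
Proof.
have [hP _ _ _ _] := LP; move=> hH.
exact: (is_derive_wsq hP (is_derive_deviation u hH)).
Qed.

Let B_derive t (H : R -> 'M[R]_(N, n)) dH : is_derive t (1 : R) H (dH : 'M[R]_(N, n)) ->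
  is_derive t (1 : R) (fun x => nsq (u *m H x)) (2 * \tr ((u *m H t)^T *m (u *m dH))).
Proof.
move=> hH.
have h1 : is_derive t (1 : R) (fun x => u *m H x) (u *m dH).
  apply: (is_derive_conv (is_derive_mulmx (is_derive_cst u t 1) hH)).
  by rewrite mul0mx add0r.
have := is_derive_wsq (@trmx1 _ _) h1; rewrite mulmx1.
by under eq_fun do rewrite -nsq_wsq.
Qed.

Let within_W (D : set R) (H : R -> 'M[R]_(N, n)) : {within D, continuous H} ->
  {within D, continuous (fun x => wsq P (dev (H x)))}.
Proof.
move=> cH; apply: (within_comp (g := fun X => wsq P (dev X)) _ cH) => X.
apply: (@cvg_wsq _ _ (nbhs X)); apply: (@cvg_deviation _ _ _ _ (nbhs X)); exact: cvg_id.
Qed.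

Let within_B (D : set R) (H : R -> 'M[R]_(N, n)) : {within D, continuous H} ->
  {within D, continuous (fun x => nsq (u *m H x))}.
Proof.
move=> cH.
have c1 : {within D, continuous (fun x => u *m H x)}.
  by apply: within_mulmx => //; exact: within_cst.
apply: (within_comp (g := fun X : 'rV[R]_n => nsq X) _ c1) => X.
have -> : (fun X : 'rV[R]_n => nsq X) = wsq 1%:M by apply/funext => Y; exact: nsq_wsq.
by apply: (@cvg_wsq _ _ (nbhs X) _ _ _ _ id); exact: cvg_id.
Qed.

(** The rate kappa is the same for all admissible gains, because the deviation
   contributes a nonpositive term. *)
Lemma energy_growth T H : 0 <= T -> {within `[0, T], continuous H} ->
  (forall t, 0 < t < T -> is_derive t (1 : R) H (field (S^~ t) (H t))) ->
  energy (H T) <= expR (kappa * T) * energy (H 0).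
Proof.
move=> T0 cH hH.
have := @gronwall_growth _ (fun t => energy (H t)) _ kappa 0 T kappa0
  (energy_ge0 LP _) T0 _ (fun t ht => is_derive_add (W_derive (hH t ht)) (B_derive (hH t ht))).
rewrite subr0; apply.
  by apply: within_add; [exact: within_W|exact: within_B].
move=> t /andP[t0 _].
have [_ _ h3 h4] := hK (H t) (ltW mu20) (s0 t) (fun i => hS i (ltW t0)).
have E0 := energy_ge0 LP (H t).
have W0 := lyapunov_ge0 LP (dev (H t)); have B0 := nsq_ge0 (u *m H t).
have s2 : s t ^+ 2 <= C0 ^+ 2 by rewrite lerXn2r ?nnegrE ?s_le // ltW.
have sE : K * s t ^+ 2 * energy (H t) <= K * C0 ^+ 2 * energy (H t).
  by rewrite ler_wpM2r // ler_wpM2l // ltW.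
have hW : - (2 * c * mu2 - K) * wsq P (dev (H t)) <= 0.
  by rewrite mulr_le0_ge0 //; have := hmu2; have := b0; lra.
have hE : energy (H t) = wsq P (dev (H t)) + nsq (u *m H t) by [].
have KW : 0 <= K * wsq P (dev (H t)) by rewrite mulr_ge0 // ltW.
have -> : kappa * energy (H t) = K * energy (H t) + 2 * (K * C0 ^+ 2 * energy (H t)).
  by rewrite /kappa; ring.
have -> : K * energy (H t) = K * wsq P (dev (H t)) + K * nsq (u *m H t) by rewrite hE; ring.
lra.
Qed.

Lemma eta_growth T H : 0 <= T -> {within `[0, T], continuous H} ->
  (forall t, 0 < t < T -> is_derive t (1 : R) H (field (S^~ t) (H t))) ->
  `|H T| <= Num.sqrt (K * energy (H 0)) * expR (kappa / 2 * T).
Proof.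
move=> T0 cH hH; have [h1 _ _ _] := hK (H T) (ltW mu20) (s0 T) (fun i => hS i T0).
have E0 := energy_ge0 LP (H 0).
have KE : 0 <= K * energy (H 0) by rewrite mulr_ge0 // ltW.
rewrite -(@ler_pXn2r _ 2) ?nnegrE ?mulr_ge0 ?sqrtr_ge0 ?expR_ge0 //.
apply: le_trans h1 _; rewrite exprMn sqr_sqrtr // -expRM_natl.
have -> : 2%:R * (kappa / 2 * T) = kappa * T by field.
rewrite -mulrA ler_wpM2l ?(ltW K0) // mulrC.
exact: energy_growth.
Qed.

Section Global.
Variable H : R -> 'M[R]_(N, n).
Hypothesis cH : {within `[0, +oo[, continuous H}.
Hypothesis hH : forall t, 0 < t -> is_derive t (1 : R) H (field (S^~ t) (H t)).

Let cHT T : {within `[0, T], continuous H}.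
Proof. exact: within_halfline. Qed.

Let E0 := energy (H 0).

Let E00 : 0 <= E0. Proof. exact: energy_ge0 LP _. Qed.

(** The rate b + 1 leaves a decaying term after multiplication by exp(- t Sstar),
   which may grow at the rate b. *)
Lemma deviation_decay : exists2 C, 0 <= C & forall t, 0 <= t ->
  `|dev (H t)| <= C * expR (- (b + 1) * t).
Proof.
have [_ c0 k0 _ _] := LP.
pose G := K * C0 ^+ 2 * E0.
have G0 : 0 <= G by rewrite !mulr_ge0 ?sqr_ge0 // ltW.
pose Q := wsq P (dev (H 0)) + G / (2 * b + 3 - (2 * b + 2)).
have Q0 : 0 <= Q.
  by rewrite addr_ge0 ?(lyapunov_ge0 LP) // divr_ge0 //; lra.
exists (Num.sqrt (Q / k)); first exact: sqrtr_ge0.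
move=> t t0; rewrite -(@ler_pXn2r _ 2) ?nnegrE ?mulr_ge0 ?sqrtr_ge0 ?expR_ge0 //.
rewrite exprMn sqr_sqrtr ?divr_ge0 ?(ltW k0) // -expRM_natl.
apply: le_trans (norm_le_nsq _) _; rewrite mulrAC ler_pdivlMr // mulrC.
apply: le_trans (lyapunov_coercive LP _) _.
have -> : 2%:R * (- (b + 1) * t) = - (2 * b + 2) * t by ring.
have bb : 2 * b + 2 < 2 * b + 3 by lra.
have := @gronwall_exp _ (fun t => wsq P (dev (H t))) _ (2 * b + 2) (2 * b + 3) G t
  bb G0 t0 _ (fun x hx => W_derive (hH (proj1 (andP hx)))).
apply; first exact: within_W.
move=> x /andP[x0 _].
have [_ _ h3 _] := hK (H x) (ltW mu20) (s0 x) (fun i => hS i (ltW x0)).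
apply: le_trans h3 _; have W0 := lyapunov_ge0 LP (dev (H x)).
apply: lerD; first by rewrite ler_wpM2r // lerN2.
have hE : energy (H x) <= expR (kappa * x) * E0.
  by apply: energy_growth => //; [exact: ltW|move=> y /andP[y0 _]; exact: hH].
have -> : K * s x ^+ 2 * energy (H x) =
    K * C0 ^+ 2 * (expR (- (2 * c * mu1) * x) * energy (H x)).
  rewrite /s exprMn -expRM_natl.
  have -> : 2%:R * (- (c * mu1) * x) = - (2 * c * mu1) * x by ring.
  ring.
rewrite /G -[leRHS]mulrA ler_wpM2l ?mulr_ge0 ?sqr_ge0 ?(ltW K0) //.
apply: (@le_trans _ _ (expR (- (2 * c * mu1) * x) * (expR (kappa * x) * E0))).
  by rewrite ler_wpM2l ?expR_ge0.
rewrite mulrA -expRD [leRHS]mulrC ler_wpM2r // ler_expR -mulrDl ler_wpM2r ?(ltW x0) //.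
have := hmu1; have := b0; lra.
Qed.

(** In the frame moving with the flow of Sstar only the mismatch, which decays, is
   left in the derivative of the weighted mean. *)
Lemma mean_limit : exists chi : 'cV[R]_n, exists2 C, 0 <= C & forall t, 0 <= t ->
  `|expmx (- (t *: Sstar)) *m (u *m H t)^T - chi| <= C * expR (- (b + 1) * t).
Proof.
pose f t := expmx (t *: - Sstar) *m (u *m H t)^T.
pose df t := expmx (t *: - Sstar) *m (u *m mismatch Sstar (S^~ t) (H t))^T.
pose Ch := Num.sqrt (K * E0).
pose C := n%:R * (K * C0 * Ch).
have Ch0 : 0 <= Ch by exact: sqrtr_ge0.
have C_0 : 0 <= C by rewrite !mulr_ge0 // ltW.
have b1 : 0 < b + 1 by have := b0; lra.
have cf : {within `[0, +oo[, continuous f}.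
  apply: within_mulmx.
    exact: (@within_of_derive _ _ _ _ _ (is_derive_expmx_l (- Sstar))).
  by apply: within_trmx; apply: within_mulmx => //; exact: within_cst.
have hf t : 0 < t -> is_derive t (1 : R) f (df t).
  move=> t0.
  have h1 : is_derive t (1 : R) (fun x => u *m H x) (u *m field (S^~ t) (H t)).
    apply: (is_derive_conv (is_derive_mulmx (is_derive_cst u t 1) (hH t0))).
    by rewrite mul0mx add0r.
  apply: (is_derive_conv (is_derive_mulmx (is_derive_expmx_r (- Sstar) t) (is_derive_trmx h1))).
  rewrite (eta_field_mean hu Sstar) /df linearD /= mulmxDr addrA [X in X + _](_ : _ = 0) ?add0r //.
  by rewrite [(u *m H t *m _)^T]trmx_mul trmxK mulmxN mulNmx mulmxA addNr.
have hdf t : 0 < t -> `|df t| <= C * expR (- (b + 1) * t).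
  move=> t0; rewrite /df.
  apply: le_trans (norm_mulmx _ _) _; rewrite norm_trmx.
  have [_ h2 _ _] := hK (H t) (ltW mu20) (s0 t) (fun i => hS i (ltW t0)).
  have e1 : `|expmx (t *: - Sstar)| <= expR (b * t).
    by rewrite /b -(normrN Sstar); apply: norm_expmx; exact: ltW.
  have hE : `|H t| <= Ch * expR (kappa / 2 * t).
    by apply: eta_growth; [exact: ltW|exact: cHT|move=> y /andP[y0 _]; exact: hH].
  apply: (@le_trans _ _ (n%:R * expR (b * t) * (K * s t * (Ch * expR (kappa / 2 * t))))).
    apply: ler_pM; [by rewrite mulr_ge0|exact: normr_ge0|by rewrite ler_wpM2l|].
    by apply: le_trans h2 _; apply: ler_wpM2l hE; rewrite mulr_ge0 ?s0 ?(ltW K0).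
  have -> : n%:R * expR (b * t) * (K * s t * (Ch * expR (kappa / 2 * t)))
    = C * (expR (b * t) * expR (- (c * mu1) * t) * expR (kappa / 2 * t)).
    by rewrite /C /s; ring.
  rewrite ler_wpM2l // -!expRD ler_expR -!mulrDl ler_wpM2r ?(ltW t0) //.
  have := hmu1; have := b0; have := kappa0; lra.
have [chi hchi] := exp_limit_mx C_0 b1 cf hf hdf.
exists chi, (C / (b + 1)); first by rewrite divr_ge0 // ltW.
by move=> t t0; rewrite -scalerN; exact: hchi.
Qed.

Lemma eta_consensus : exists chi : 'cV[R]_n, exists2 C, 0 <= C & forall i t, 0 <= t ->
  `|(row i (H t))^T - common_trajectory Sstar chi t| <= C * expR (- t) /\
  `|expmx (- (t *: Sstar)) *m (row i (H t))^T - chi| <= C * expR (- t).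
Proof.
have [Cd Cd0 hCd] := deviation_decay.
have [chi [Cm Cm0 hCm]] := mean_limit.
exists chi, (Cd + n%:R * Cm + Cm + n%:R * Cd).
  by rewrite !addr_ge0 // mulr_ge0.
move=> i t t0.
have rowE : (row i (H t))^T = (u *m H t)^T + (row i (dev (H t)))^T.
  rewrite /deviation -linearD /=; congr (_^T).
  apply/rowP => j; rewrite !mxE big_ord1 !mxE mul1r; ring.
have nd : `|(row i (dev (H t)))^T| <= Cd * expR (- (b + 1) * t).
  rewrite norm_trmx; apply: le_trans (hCd t t0).
  by apply: mx_norm_le => // x y; rewrite mxE mx_entry_le.
have x1 : expR (- (b + 1) * t) <= expR (- t).
  rewrite ler_expR -subr_ge0.
  have -> : - t - - (b + 1) * t = b * t by ring.
  by rewrite mulr_ge0.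
have x2 : expR (b * t) * expR (- (b + 1) * t) = expR (- t).
  by rewrite -expRD; congr expR; ring.
have nm := hCm t t0.
have eb1 := norm_expmx Sstar t0; have eb2 := norm_expmxN Sstar t0.
rewrite -/b in eb1 eb2.
have en := expR_ge0 (- t).
have pos1 : 0 <= n%:R * Cd * expR (- t) by rewrite !mulr_ge0.
have pos2 : 0 <= n%:R * Cm * expR (- t) by rewrite !mulr_ge0.
have pos3 : 0 <= Cd * expR (- t) by rewrite mulr_ge0.
have pos4 : 0 <= Cm * expR (- t) by rewrite mulr_ge0.
have nd' : `|(row i (dev (H t)))^T| <= Cd * expR (- t).
  by apply: le_trans nd _; rewrite ler_wpM2l.
have nm' : `|expmx (- (t *: Sstar)) *m (u *m H t)^T - chi| <= Cm * expR (- t).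
  by apply: le_trans nm _; rewrite ler_wpM2l.
have mul_le (E : 'M[R]_n) (v : 'cV[R]_n) Cv : 0 <= Cv -> `|E| <= expR (b * t) ->
    `|v| <= Cv * expR (- (b + 1) * t) -> `|E *m v| <= n%:R * Cv * expR (- t).
  move=> Cv0 hE hv; apply: le_trans (norm_mulmx _ _) _.
  rewrite -x2 -[leLHS]mulrA -[leRHS]mulrA ler_wpM2l //.
  apply: (@le_trans _ _ (expR (b * t) * (Cv * expR (- (b + 1) * t)))); first exact: ler_pM.
  by rewrite mulrCA.
split.
- rewrite rowE addrAC.
  have -> : (u *m H t)^T - common_trajectory Sstar chi t =
      expmx (t *: Sstar) *m (expmx (- (t *: Sstar)) *m (u *m H t)^T - chi).
    by rewrite mulmxBr mulmxA expmx_invr mul1mx.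
  apply: le_trans (ler_normD _ _) _.
  have := mul_le _ _ _ Cm0 eb1 nm; lra.
- rewrite rowE mulmxDr addrAC; apply: le_trans (ler_normD _ _) _.
  have := mul_le _ _ _ Cd0 eb2 nd; lra.
Qed.

End Global.

End EtaDynamics.

Section ObserverSolutions.
Variable R : realType.
Implicit Types (t T x : R).
Variables (N n : nat) (e : rel 'I_N) (a : 'M[R]_N) (u : 'rV[R]_N).
Hypotheses (hadj : adjacency e a) (htree : has_spanning_tree e).
Hypotheses (hu : (u <= eigenspace (laplacian a) 0)%MS) (hu1 : \sum_i u 0 i = 1).
Local Notation L := (laplacian a).

Lemma is_derive_rows q (f df : 'I_N -> R -> 'rV[R]_q) t :
  (forall i, is_derive t (1 : R) (f i) (df i t)) ->
  is_derive t (1 : R) (fun s => \matrix_i f i s) (\matrix_i df i t).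
Proof.
move=> h; apply: is_derive_mx => i j; rewrite mxE.
by under eq_fun do rewrite mxE; apply: is_derive_entry.
Qed.

Lemma within_rows (D : set R) q (f : 'I_N -> R -> 'rV[R]_q) :
  (forall i, {within D, continuous (f i)}) ->
  {within D, continuous (fun s => \matrix_i f i s)}.
Proof.
move=> h; apply: within_mx => i j.
by under eq_fun do rewrite mxE; apply: within_entry.
Qed.

Definition stackS (S : 'I_N -> 'M[R]_n) : 'M[R]_(N, n * n) := \matrix_i mxvec (S i).

Definition stackH (eta : 'I_N -> 'cV[R]_n) : 'M[R]_(N, n) := \matrix_i (eta i)^T.

Lemma stackS_rhs mu1 (S : 'I_N -> 'M[R]_n) :
  stackS (S_rhs e a mu1 S) = - mu1 *: (L *m stackS S).
Proof.
apply/row_matrixP => i; rewrite rowK [RHS]linearZ /= row_laplacian /S_rhs (consensus_term hadj).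
rewrite linearZ /= linearN /= scalerN scaleNr; congr (- (_ *: _)).
rewrite linear_sum /=; apply: eq_bigr => k _.
by rewrite linearZ linearB /= !rowK.
Qed.

Lemma stackH_rhs mu2 (S : 'I_N -> 'M[R]_n) (eta : 'I_N -> 'cV[R]_n) :
  stackH (eta_rhs e a mu2 S eta) = eta_field a mu2 S (stackH eta).
Proof.
apply/row_matrixP => i; rewrite rowK /eta_field [RHS]linearB /= !rowK [row i (mu2 *: _)]linearZ /= row_laplacian.
rewrite /eta_rhs (consensus_term hadj) linearD /= trmxK; congr (_ + _).
rewrite linearZ /= linearN /= scalerN; congr (- (_ *: _)).
rewrite linear_sum /=; apply: eq_bigr => k _.
by rewrite linearZ linearB /= !rowK.
Qed.

Lemma is_derive_mxvec m q (f : R -> 'M[R]_(m, q)) df t :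
  is_derive t (1 : R) f df -> is_derive t (1 : R) (fun s => mxvec (f s)) (mxvec df).
Proof.
move=> h; apply: is_derive_mx => i j; rewrite ord1.
case/mxvec_indexP: j => x y; rewrite mxvecE.
by under eq_fun do rewrite mxvecE; exact: is_derive_entry.
Qed.

Lemma within_mxvec (D : set R) m q (f : R -> 'M[R]_(m, q)) :
  {within D, continuous f} -> {within D, continuous (fun s => mxvec (f s))}.
Proof.
move=> h; apply: within_mx => i j; rewrite ord1.
case/mxvec_indexP: j => x y.
by under eq_fun do rewrite mxvecE; exact: within_entry.
Qed.

Lemma norm_mxvec m q (A : 'M[R]_(m, q)) : `|A| <= `|mxvec A|.
Proof.
by apply: mx_norm_le => // i j; rewrite -mxvecE; exact: mx_entry_le.
Qed.

Variables (P : 'M[R]_N) (c k : R).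
Hypothesis LP : lyapunov (grounded_laplacian a u) P c k.

Section FixedS0.
Variable S0 : 'I_N -> 'M[R]_n.
Let Sstar := \sum_i u 0 i *: S0 i.
Let C0 := Num.sqrt (wsq P (deviation u (stackS S0)) / k).

Lemma mean_stackS : u *m stackS S0 = mxvec Sstar.
Proof.
rewrite /Sstar linear_sum /=; apply/rowP => j; rewrite mxE summxE.
by apply: eq_bigr => i _; rewrite linearZ /= !mxE.
Qed.

Lemma S_decay mu1 S : 0 < mu1 ->
  (forall i, ivp (S i) (fun t => S_rhs e a mu1 (S^~ t) i) (S0 i)) ->
  forall i t, 0 <= t -> `|S i t - Sstar| <= C0 * expR (- (c * mu1) * t).
Proof.
move=> m0 hS i T T0; have [_ c0 k0 _ _] := LP.
pose X t := stackS (S^~ t).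
have cX : {within `[0, T], continuous X}.
  apply: within_rows => j; apply: within_mxvec; apply: within_halfline.
  by have [] := hS j.
have hX t : 0 < t < T -> is_derive t (1 : R) X (- mu1 *: (L *m X t)).
  move=> /andP[t0 _]; rewrite -stackS_rhs.
  apply: (is_derive_rows (df := fun j t => mxvec (S_rhs e a mu1 (S^~ t) j))) => j.
  by apply: is_derive_mxvec; have [_ h _] := hS j; exact: h.
have X0 : X 0 = stackS S0.
  by apply/row_matrixP => j; rewrite !rowK; have [_ _ ->] := hS j.
have W := consensus_decay hu hu1 LP m0 T0 cX hX.
have Mn := consensus_mean hu T0 cX hX; rewrite X0 in W Mn.
have W0 := lyapunov_ge0 LP (deviation u (stackS S0)).
have rowE : row i (deviation u (X T)) = mxvec (S i T - Sstar).
  rewrite /deviation Mn mean_stackS !linearB /= rowK; congr (_ - _).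
  by apply/rowP => j; rewrite !mxE big_ord1 mxE mul1r.
have D : `|deviation u (X T)| <= C0 * expR (- (c * mu1) * T).
  rewrite -(@ler_pXn2r _ 2) ?nnegrE ?mulr_ge0 ?sqrtr_ge0 ?expR_ge0 //.
  rewrite exprMn sqr_sqrtr ?divr_ge0 ?(ltW k0) // -expRM_natl.
  apply: le_trans (norm_le_nsq _) _; rewrite mulrAC ler_pdivlMr // mulrC.
  apply: le_trans (lyapunov_coercive LP _) _; rewrite mulrC; apply: le_trans W _.
  by rewrite le_eqVlt; apply/orP; left; apply/eqP; congr (expR _ * _); ring.
apply: le_trans D; apply: le_trans (norm_mxvec _) _; rewrite -rowE.
by apply: mx_norm_le => // x y; rewrite mxE mx_entry_le.
Qed.

Lemma exists_S mu1 : exists S,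
  forall i, ivp (S i) (fun t => S_rhs e a mu1 (S^~ t) i) (S0 i).
Proof.
pose X t := expmx (t *: (- mu1 *: L)) *m stackS S0.
have hX t : is_derive t (1 : R) X (- mu1 *: (L *m X t)).
  apply: (is_derive_conv (is_derive_mulmx (is_derive_expmx_l _ t) (is_derive_cst (stackS S0) t 1))).
  by rewrite mulmx0 addr0 -!scalemxAl mulmxA.
pose S i t := vec_mx (row i (X t)).
have stackE t : stackS (S^~ t) = X t.
  by apply/row_matrixP => i; rewrite rowK vec_mxK.
have hS i t : is_derive t (1 : R) (S i) (S_rhs e a mu1 (S^~ t) i).
  have -> : S_rhs e a mu1 (S^~ t) i = vec_mx (row i (- mu1 *: (L *m X t))).
    by rewrite -stackE -stackS_rhs rowK mxvecK.
  apply: is_derive_mx => x y; rewrite !mxE.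
  have := is_derive_entry i (mxvec_index x y) (hX t); rewrite !mxE.
  have -> : (fun s => S i s x y) = (fun s => X s i (mxvec_index x y)).
    by apply/funext => s; rewrite /S 2!mxE.
  by [].
exists S => i; split.
- exact: within_of_derive (hS i).
- by move=> t _; exact: hS.
- by rewrite /S /X expmx0 mul1mx rowK mxvecK.
Qed.

End FixedS0.

(** The dynamics of eta involve S, so the common limit is the same for all observers
   with given initial values only if S is. *)
Lemma S_unique (S0 : 'I_N -> 'M[R]_n) mu1 (S S' : 'I_N -> R -> 'M[R]_n) : 0 < mu1 ->
  (forall i, ivp (S i) (fun t => S_rhs e a mu1 (S^~ t) i) (S0 i)) ->
  (forall i, ivp (S' i) (fun t => S_rhs e a mu1 (S'^~ t) i) (S0 i)) ->
  forall i t, 0 <= t -> S i t = S' i t.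
Proof.
move=> m0 hS hS'.
have hD i : ivp (fun t => S i t - S' i t)
    (fun t => S_rhs e a mu1 (fun j => S j t - S' j t) i) ((fun=> 0) i : 'M[R]_n).
  have [c1 d1 e1] := hS i; have [c2 d2 e2] := hS' i; split.
  - exact: within_sub.
  - move=> t t0; apply: (is_derive_conv (is_derive_sub (d1 t t0) (d2 t t0))).
    rewrite /S_rhs -scalerBr -sumrB; congr (_ *: _); apply: eq_bigr => j _.
    by rewrite -scalerBr; congr (_ *: _); rewrite !opprD !opprK addrACA.
  - by rewrite e1 e2 subrr.
move=> i t t0; have := S_decay (S := fun i t => S i t - S' i t) m0 hD i t0.
have -> : stackS (fun=> 0) = 0 by apply/row_matrixP => j; rewrite rowK !linear0.
rewrite big1 ?subr0 => [|j _]; last by rewrite scaler0.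
rewrite /deviation !mulmx0 subr0 /wsq mulmx0 mxtrace0 mul0r sqrtr0 mul0r normr_le0.
by rewrite subr_eq0 => /eqP.
Qed.

End ObserverSolutions.

Section ObserverConsensus.
Variable R : realType.
Implicit Types (t T x : R).
Variables (N n : nat) (e : rel 'I_N) (a : 'M[R]_N) (u : 'rV[R]_N).
Hypotheses (hadj : adjacency e a) (htree : has_spanning_tree e).
Hypotheses (hu : (u <= eigenspace (laplacian a) 0)%MS) (hu1 : \sum_i u 0 i = 1).

Lemma within_row (U : topologicalType) (D : set U) q (H : U -> 'M[R]_(N, q)) i :
  {within D, continuous H} -> {within D, continuous (fun z => row i (H z))}.
Proof.
by move=> cH; apply: within_mx => x y; under eq_fun do rewrite mxE; exact: within_entry.
Qed.

Lemma is_derive_row q (H : R -> 'M[R]_(N, q)) dH i t :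
  is_derive t (1 : R) H dH -> is_derive t (1 : R) (fun t => row i (H t)) (row i dH).
Proof.
move=> hH; apply: is_derive_mx => x y; rewrite mxE.
by under eq_fun do rewrite mxE; apply: is_derive_entry.
Qed.

Lemma eta_fieldB mu2 S (H H' : 'M[R]_(N, n)) :
  eta_field a mu2 S (H - H') = eta_field a mu2 S H - eta_field a mu2 S H'.
Proof.
rewrite /eta_field mulmxBr scalerBr opprB [in RHS]opprB.
have -> : drift S (H - H') = drift S H - drift S H'.
  apply/row_matrixP => i; rewrite [RHS]linearB /= !rowK [row i (_ - _)]linearB /=.
  by rewrite [(row i H - _)^T]linearB /= mulmxBr [LHS]linearB.
by rewrite [LHS]addrACA [RHS]addrACA; congr (_ + _); rewrite addrC.
Qed.

Lemma eta_field_continuous mu2 (S : 'I_N -> R -> 'M[R]_n) :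
  (forall i, {within `[0, +oo[, continuous (S i)}) ->
  {within [set z : R * 'M[R]_(N, n) | 0 <= z.1],
    continuous (fun z => eta_field a mu2 (S^~ z.1) z.2)}.
Proof.
move=> cS; set D := [set z | _].
have c2 : {within D, continuous (fun z : R * 'M[R]_(N, n) => z.2)}.
  by apply: continuous_subspaceT => z; exact: cvg_snd.
apply: within_sub; last first.
  by apply: within_scale; apply: within_mulmx => //; exact: within_cst.
apply: within_mx => i j.
have -> : (fun z : R * 'M[R]_(N, n) => drift (S^~ z.1) z.2 i j) =
    (fun z => (S i z.1 *m (row i z.2)^T) j 0).
  by apply/funext => z; rewrite 2!mxE.
apply: within_entry; apply: within_mulmx; first exact: within_fst.
by apply: within_trmx; exact: within_row.
Qed.

(** Existence by an a priori bound, the growth estimate of the energy.  The limit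
   chi is read off from one solution; uniqueness, which is that growth estimate
   for the difference of two solutions, carries it over to all the others. *)
Theorem observer_consensus (S0 : 'I_N -> 'M[R]_n) :
  let Sstar := \sum_i u 0 i *: S0 i in
  exists mu1s mu2s : R, [/\ 0 < mu1s, 0 < mu2s &
  forall mu1 mu2 : R, mu1s <= mu1 -> mu2s <= mu2 -> forall eta0 : 'I_N -> 'cV[R]_n,
  (exists S eta, observer e a mu1 mu2 S0 eta0 S eta) /\
  exists chi : 'cV[R]_n, exists2 C : R, 0 <= C &
  forall S eta, observer e a mu1 mu2 S0 eta0 S eta -> forall i t, 0 <= t ->
  [/\ `|S i t - Sstar| <= C * expR (- t),
      `|eta i t - common_trajectory Sstar chi t| <= C * expR (- t) &
      `|expmx (- (t *: Sstar)) *m eta i t - chi| <= C * expR (- t)]].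
Proof.
move=> Sstar.
have [P [c [k LP]]] := hurwitz_lyapunov (hurwitz_grounded hadj htree hu hu1).
have [K K0 hK] := energy_estimates hu hu1 LP Sstar.
have [_ c0 k0 _ _] := LP.
pose C0 := Num.sqrt (wsq P (deviation u (stackS S0)) / k).
have C00 : 0 <= C0 by exact: sqrtr_ge0.
pose b := n%:R * `|Sstar|.
have b0 : 0 <= b by rewrite mulr_ge0.
pose kappa := K + 2 * K * C0 ^+ 2.
have kappa0 : 0 < kappa by rewrite ltr_pwDl // mulr_ge0 ?sqr_ge0 // mulr_ge0 // ltW.
have c20 : 0 < 2 * c by rewrite mulr_gt0.
exists ((kappa + 4 * b + 3) / (2 * c)), ((2 * b + 2 + K) / (2 * c)).
split; [by rewrite divr_gt0 //; lra | by rewrite divr_gt0 //; lra |].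
move=> mu1 mu2; rewrite !ler_pdivrMr // => hmu1 hmu2 eta0.
have m1 : 0 < mu1 by rewrite -(pmulr_lgt0 _ c20); lra.
have m2 : 0 < mu2 by rewrite -(pmulr_lgt0 _ c20); lra.
have hm1 : K + 2 * K * C0 ^+ 2 + 4 * (n%:R * `|Sstar|) + 3 <= 2 * c * mu1.
  by move: hmu1; rewrite /kappa /b; lra.
have hm2 : 2 * (n%:R * `|Sstar|) + 2 <= 2 * c * mu2 - K.
  by move: hmu2; rewrite /b; lra.
have cm1 : 1 <= c * mu1 by move: hmu1; lra.
have [S hS] := exists_S hadj S0 mu1.
have bS := S_decay hadj hu hu1 LP m1 hS.
have cS i : {within `[0, +oo[, continuous (S i)} by have [] := hS i.
pose H0 := stackH eta0.
have [H [HH0 cH hH]] : exists H : R -> 'M[R]_(N, n), [/\ H 0 = H0,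
    {within `[0, +oo[, continuous H} &
    forall t, 0 < t -> is_derive t (1 : R) H (eta_field a mu2 (S^~ t) (H t))].
  pose Ch := Num.sqrt (K * energy u P H0).
  pose r t := 1 + Ch * expR (kappa / 2 * t).
  have Ch0 : 0 <= Ch by exact: sqrtr_ge0.
  apply: (@peano_apriori R _ (@compact_mx_ball R N n) (fun t H => eta_field a mu2 (S^~ t) H) r).
  - exact: eta_field_continuous.
  - move=> t; apply: cvgD; first exact: cvg_cst.
    by apply: cvgM; [exact: cvg_cst|exact: continuous_expRM].
  - by move=> t; rewrite ltr_pwDl // mulr_ge0 // expR_ge0.
  - move=> T H T0 HH0 cH hH.
    have := eta_growth LP K0 hK C00 m2 hm1 hm2 bS T0 cH hH.
    by rewrite HH0 -/kappa -/Ch => /le_lt_trans; apply; rewrite /r; lra.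
pose eta i t := (row i (H t))^T.
have stackE t : stackH (eta^~ t) = H t.
  by apply/row_matrixP => i; rewrite rowK trmxK.
have hO : observer e a mu1 mu2 S0 eta0 S eta.
  move=> i; split; first exact: hS.
  split.
  - by apply: (within_trmx (f := fun t => row i (H t))); exact: within_row.
  - move=> t t0.
    have -> : eta_rhs e a mu2 (S^~ t) (eta^~ t) i = (row i (eta_field a mu2 (S^~ t) (H t)))^T.
      by rewrite -stackE -(stackH_rhs hadj) rowK trmxK.
    exact: (is_derive_trmx (is_derive_row i (hH t t0))).
  - by rewrite /eta HH0 rowK trmxK.
split; first by exists S, eta.
have [chi [C C_0 hC]] := eta_consensus hu LP K0 hK C00 m2 hm1 hm2 bS cH hH.
exists chi, (C + C0); first by rewrite addr_ge0.
move=> S' eta' hO' i t t0.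
have hS' j := (hO' j).1.
have SS' j x : 0 <= x -> S' j x = S j x by exact: (S_unique hadj hu hu1 LP m1 hS' hS).
(* the dynamics of eta are linear, so the difference of two solutions is a solution
   with zero energy at 0 *)
have HH' : stackH (eta'^~ t) = H t.
  pose H' x := stackH (eta'^~ x).
  have cD : {within `[0, t], continuous (fun x => H' x - H x)}.
    apply: within_sub; last exact: within_halfline.
    apply: within_halfline; apply: within_rows => j; apply: within_trmx.
    by have [_ []] := hO' j.
  have hD x : 0 < x < t -> is_derive x (1 : R) (fun x => H' x - H x)
      (eta_field a mu2 (S^~ x) (H' x - H x)).
    move=> /andP[x0 _]; rewrite eta_fieldB; apply: is_derive_sub; last exact: hH.
    have -> : S^~ x = S'^~ x by apply/funext => j; rewrite SS' // ltW.
    rewrite -(stackH_rhs hadj).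
    apply: (is_derive_rows (f := fun j s => (eta' j s)^T)
      (df := fun j t => (eta_rhs e a mu2 (S'^~ t) (eta'^~ t) j)^T)) => j.
    by apply: is_derive_trmx; have [_ [_ h _]] := hO' j; exact: h.
  have := eta_growth LP K0 hK C00 m2 hm1 hm2 bS t0 cD hD.
  have -> : H' 0 = H 0.
    by rewrite HH0; apply/row_matrixP => j; rewrite !rowK; have [_ [_ _ ->]] := hO' j.
  rewrite subrr /energy /deviation !mulmx0 subrr /nsq /wsq !mulmx0 !mxtrace0 addr0.
  by rewrite mulr0 sqrtr0 mul0r normr_le0 subr_eq0 => /eqP.
have etaE : eta' i t = (row i (H t))^T by rewrite -HH' rowK trmxK.
have [h1 h2] := hC i t t0.
have en := expR_ge0 (- t).
have C0e : 0 <= C0 * expR (- t) by rewrite mulr_ge0.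
have Ce : 0 <= C * expR (- t) by rewrite mulr_ge0.
rewrite etaE SS' // mulrDl; split.
- apply: le_trans (bS i t t0) _.
  have h : C0 * expR (- (c * mu1) * t) <= C0 * expR (- t).
    by rewrite ler_wpM2l // ler_expR mulNr lerN2 ler_peMl.
  by apply: le_trans h _; rewrite lerDr.
- by apply: le_trans h1 _; rewrite lerDl.
- by apply: le_trans h2 _; rewrite lerDl.
Qed.

End ObserverConsensus.

(** * The internal model of the disturbance *)

Section BlockDiagonal.
Variables (R : realType) (n : nat) (r : 'I_n -> nat).

Lemma mxdiag_mul (A B : forall s, 'M[R]_(r s)) :
  \mxdiag_s A s *m \mxdiag_s B s = \mxdiag_s (A s *m B s).
Proof.
rewrite {2}/mxdiag mul_mxdiag_mxblock /mxdiag; apply/eq_mxblock => i j.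
case: eqVneq => [<-|_]; last by rewrite mulmx0.
by rewrite !conform_mx_id.
Qed.

Lemma mxdiag_unit (A : forall s, 'M[R]_(r s)) :
  (forall s, A s \in unitmx) -> \mxdiag_s A s \in unitmx.
Proof.
move=> hA; have [] // := @mulmx1_unit _ _ (\mxdiag_s A s) (\mxdiag_s invmx (A s)).
rewrite mxdiag_mul; under eq_mxdiag do rewrite mulmxV //.
exact: mxdiagZ.
Qed.

Lemma lyapunov_mxdiag (A : forall s, 'M[R]_(r s)) :
  (forall s, exists P c k, lyapunov (A s) P c k) ->
  exists P c k, lyapunov (\mxdiag_s A s) P c k.
Proof.
move=> h.
have h' s : exists x : 'M[R]_(r s) * R * R, lyapunov (A s) x.1.1 x.1.2 x.2.
  by have [P [c [k hL]]] := h s; exists (P, c, k).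
pose x s := sval (cid (h' s)); have hL s := svalP (cid (h' s)).
pose P s := (x s).1.1.
pose c := \big[Num.min/1]_s (x s).1.2; pose k := \big[Num.min/1]_s (x s).2.
have form (B : forall s, 'M[R]_(r s)) (v w : 'cV[R]_(\sum_s r s)) :
    (v^T *m \mxdiag_s B s *m w) 0 0 =
    \sum_s ((submxcol v s)^T *m B s *m submxcol w s) 0 0.
  rewrite -{1}(submxcolK v) -{1}(submxcolK w) -mulmxA mul_mxdiag_mxcol tr_mxcol.
  rewrite mul_mxrow_mxcol summxE; apply: eq_bigr => s _.
  by rewrite mulmxA.
have nsqE' (v : 'cV[R]_(\sum_s r s)) : nsq v = \sum_s nsq (submxcol v s).
  rewrite nsq_cV -{1 2}(submxcolK v) tr_mxcol mul_mxrow_mxcol summxE.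
  by apply: eq_bigr => s _; rewrite nsq_cV.
exists (\mxdiag_s P s), c, k; split.
- rewrite tr_mxdiag; apply/eq_mxdiag => s.
  by have [] := hL s.
- by apply/bigmin_gtP; split => // s _; have [] := hL s.
- by apply/bigmin_gtP; split => // s _; have [] := hL s.
- move=> v; rewrite /qform form nsqE' mulr_sumr; apply: ler_sum => s _.
  have [_ _ _ hs _] := hL s; apply: le_trans (hs _).
  by rewrite ler_wpM2r ?nsq_ge0 //; exact: bigmin_le.
- move=> v; rewrite /qform mulmxA.
  have -> : v^T *m \mxdiag_s P s *m \mxdiag_s A s *m v = v^T *m \mxdiag_s (P s *m A s) *m v.
    by rewrite -mxdiag_mul !mulmxA.
  rewrite !form mulr_sumr; apply: ler_sum => s _.
  have [_ _ _ _ hs] := hL s; have := hs (submxcol v s); rewrite !mulmxA => hs'.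
  apply: le_trans hs' _; rewrite !mulNr lerN2 ler_wpM2r //; last exact: bigmin_le.
  by rewrite -/(qform _ _) -wsq_cV; exact: (lyapunov_ge0 (hL s)).
Qed.

End BlockDiagonal.

Section Sinusoids.
Variable R : realType.
Implicit Types (t : R).

(** Trigonometric polynomials with given frequencies are closed under
   differentiation: each derivative is a quarter-turn phase shift. *)
Lemma is_derive_sinusoids k (psi0 : R) (psi sigma phi : 'rV[R]_k) t :
  is_derive t (1 : R) (sinusoids psi0 psi sigma phi)
   (sinusoids 0 (\row_j (psi 0 j * sigma 0 j)) sigma (\row_j (phi 0 j + pi / 2)) t).
Proof.
rewrite /sinusoids.
have -> : (fun t => psi0 + \sum_(j < k) psi 0 j * sin (sigma 0 j * t + phi 0 j)) =
   (fun t => cst psi0 t + (\sum_(j < k) (fun t => psi 0 j * sin (sigma 0 j * t + phi 0 j))) t).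
  by apply/funext => s; rewrite fct_sumE.
apply: is_derive_add.
apply: (is_derive_conv (a := \sum_(j < k) (psi 0 j * sigma 0 j * cos (sigma 0 j * t + phi 0 j)))).
  apply: is_derive_sum => j.
  have h1 : is_derive t (1 : R) (fun s => sigma 0 j * s + phi 0 j) (sigma 0 j).
    have := is_derive_add (is_derive_scale (is_derive_id t (1 : R)) (sigma 0 j)) (is_derive_cst (phi 0 j) t 1).
    by rewrite /GRing.scale /= mulr1 addr0.
  have h2 := is_derive1_comp (f := sin) (g := fun s => sigma 0 j * s + phi 0 j) (is_derive_sin (sigma 0 j * t + phi 0 j)) h1.
  apply: (is_derive_conv (is_derive_scale h2 (psi 0 j))).
  by rewrite /GRing.scale /=; ring.
by apply: eq_bigr => j _; rewrite !mxE addrA sinDpihalf.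
Qed.

Lemma derive1n_sinusoids k (psi0 : R) (psi sigma phi : 'rV[R]_k) j :
  exists psi0' psi' phi', derive1n j (sinusoids psi0 psi sigma phi) = sinusoids psi0' psi' sigma phi'.
Proof.
elim: j => [|j [a [b [c IH]]]]; first by exists psi0, psi, phi.
exists 0, (\row_j (b 0 j * sigma 0 j)), (\row_j (c 0 j + pi / 2)).
rewrite derive1nS IH; apply/funext => t; rewrite derive1E.
by have [_ ->] := is_derive_sinusoids a b sigma c t.
Qed.

Lemma is_derive_derive1n_sinusoids k (psi0 : R) (psi sigma phi : 'rV[R]_k) j t :
  is_derive t (1 : R) (derive1n j (sinusoids psi0 psi sigma phi))
    (derive1n j.+1 (sinusoids psi0 psi sigma phi) t).
Proof.
rewrite derive1nS derive1E; have [a [b [c ->]]] := derive1n_sinusoids psi0 psi sigma phi j.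
by apply: derivableP; have [] := is_derive_sinusoids a b sigma c t.
Qed.

Lemma norm_sinusoids k (psi0 : R) (psi sigma phi : 'rV[R]_k) t :
  `|sinusoids psi0 psi sigma phi t| <= `|psi0| + \sum_j `|psi 0 j|.
Proof.
rewrite /sinusoids; apply: le_trans (ler_normD _ _) _; rewrite lerD2l.
apply: le_trans (ler_norm_sum _ _ _) _; apply: ler_sum => j _.
rewrite normrM ler_piMr // ler_norml; apply/andP; split; [exact: sin_geN1|exact: sin_le1].
Qed.

End Sinusoids.

Section SteadyState.
Variables (R : realType) (n l : nat) (m : internal_model R n l).
Hypothesis hm : internal_model_design m.
Variable d : disturbance m.
Hypothesis hd : disturbance_positive d.
Implicit Types (t : R).

Let ds s := sinusoids (d_bias d s) (d_amp d s) (submxrow (d_freq d) s) (d_phase d s).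

(* The state of the exosystem: the successive derivatives of the channel s. *)
Let Ds s t : 'cV[R]_(im_order m s) := \col_j derive1n j (ds s) t.

Let freq_pos s : positive_orthant (submxrow (d_freq d) s).
Proof. by move=> j; rewrite mxE; case: hd => _; exact. Qed.

Let Ds_derive s t :
  is_derive t (1 : R) (Ds s) (companion (im_rec m (submxrow (d_freq d) s)) *m Ds s t).
Proof.
apply: is_derive_mx => j z; rewrite ord1.
under eq_fun do rewrite mxE.
apply: (is_derive_conv (is_derive_derive1n_sinusoids _ _ _ _ j t)); rewrite mxE.
have [/(_ s) [_ hrec] _ _ _ _] := hm.
have [jr|jr] := eqVneq j.+1 (im_order m s).
  have [ha hf] := hd.
  rewrite jr (hrec _ _ _ _ (ha s) (@freq_pos s)).
  by apply: eq_bigr => k _; rewrite !mxE jr eqxx.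
have jlt : (j.+1 < im_order m s)%N by rewrite ltn_neqAle jr ltn_ord.
rewrite (bigD1 (Ordinal jlt)) //= big1 ?addr0.
  by rewrite !mxE (negbTE jr) eqxx mul1r.
move=> k hk; rewrite !mxE (negbTE jr).
by rewrite [_ == _ :> nat]eq_sym (_ : (nat_of_ord k == j.+1) = false) ?mul0r //; apply: negbTE.
Qed.

Let first_Ds s t : first_row R (im_order m s) *m Ds s t = (ds s t)%:M.
Proof.
have [/(_ s) [r0 _] _ _ _ _] := hm.
rewrite [LHS]mx11_scalar; congr (_%:M); rewrite mxE (bigD1 (Ordinal r0)) //= big1 ?addr0.
  by rewrite !mxE eqxx mul1r.
by move=> k hk; rewrite !mxE (_ : (nat_of_ord k == 0%N) = false) ?mul0r //; apply: negbTE.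
Qed.

Let theta_s s t := im_T m (submxrow (d_freq d) s) *m Ds s t.

Let theta t : 'cV[R]_(im_dim m) := \mxcol_s theta_s s t.

Let entry_signal t s : disturbance_signal d t s 0 = ds s t.
Proof. by rewrite mxE. Qed.

Let mul_delta t s : (delta_mx (0 : 'I_1) s : 'rV[R]_n) *m disturbance_signal d t = (ds s t)%:M.
Proof.
rewrite [LHS]mx11_scalar; congr (_%:M).
by rewrite -rowE mxE entry_signal.
Qed.

(* T Phi = M T + N Psi turns the exosystem, of matrix Phi, into the internal model
   driven by its own output. *)
Let theta_derive t : is_derive t (1 : R) theta
   (M_blk m *m theta t + N_blk m *m disturbance_signal d t).
Proof.
rewrite /M_blk /N_blk /theta mul_mxdiag_mxcol mxcol_mul -mxcolD.
have hs s : is_derive t (1 : R) (theta_s s)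
    (im_M m s *m theta_s s t + im_N m s *m delta_mx 0 s *m disturbance_signal d t).
  apply: (is_derive_conv (is_derive_mulmx (is_derive_cst _ t 1) (Ds_derive s t))).
  rewrite mul0mx add0r -mulmxA mul_delta mulmxA.
  have [_ _ hsyl _ _] := hm; have [_ hT] := hsyl s _ (@freq_pos s).
  rewrite -(subrK (im_M m s *m im_T m (submxrow (d_freq d) s)) (_ *m companion _)) hT.
  by rewrite mulmxDl -!mulmxA first_Ds addrC.
apply: is_derive_mx => i j; rewrite mxE.
have -> : (fun s => (\mxcol_s0 theta_s s0 s) i j) = (fun s => theta_s (tagnat.sig1 i) s (tagnat.sig2 i) j).
  by apply/funext => s; rewrite mxE.
exact: is_derive_entry.
Qed.

Let signal_theta t : disturbance_signal d t = B_blk (d_freq d) *m theta t.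
Proof.
rewrite /B_blk /theta /theta_s -mul_mxdiag_mxcol -/(@T_blk R n l m (d_freq d)) -mulmxA mulKmx; last first.
  apply: mxdiag_unit => s; have [_ _ hsyl _ _] := hm.
  by have [] := hsyl s _ (@freq_pos s).
rewrite /Psi_blk mul_mxrow_mxcol; apply/colP => i; rewrite entry_signal summxE.
rewrite (bigD1 i) //= big1 ?addr0 => [|s si].
  by rewrite -mulmxA first_Ds mul_mx_scalar !mxE !eqxx mulr1.
by rewrite -mulmxA first_Ds mul_mx_scalar !mxE eq_sym (negbTE si) mulr0.
Qed.

Lemma disturbance_continuous : continuous (disturbance_signal d).
Proof.
move=> t; apply: (@cvg_mx _ _ (nbhs t)) => i j; rewrite mxE.
under eq_fun do rewrite mxE.
apply/differentiable_continuous/derivable1_diffP.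
by have [] := is_derive_sinusoids (d_bias d i) (d_amp d i) (submxrow (d_freq d) i) (d_phase d i) t.
Qed.

Lemma disturbance_bounded : exists2 b : R, 0 <= b & forall t, `|disturbance_signal d t| <= b.
Proof.
exists (\sum_s (`|d_bias d s| + \sum_j `|d_amp d s 0 j|)).
  by apply: sumr_ge0 => s _; rewrite addr_ge0 // sumr_ge0.
move=> t; apply: mx_norm_le.
  by apply: sumr_ge0 => s _; rewrite addr_ge0 // sumr_ge0.
move=> i j; rewrite mxE; apply: le_trans (norm_sinusoids _ _ _ _ _) _.
rewrite [leRHS](bigD1 i) //= lerDl; apply: sumr_ge0 => s _.
by rewrite addr_ge0 // sumr_ge0.
Qed.

Lemma lyapunov_M_blk : exists P c k, lyapunov (M_blk m) P c k.
Proof.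
by apply: lyapunov_mxdiag => s; apply: hurwitz_lyapunov; have [_ /(_ s) []] := hm.
Qed.

(** The disturbance is an output of a copy of the controller's internal model
   driven by the disturbance itself; the Sylvester equation is what makes the
   change of coordinates T conjugate the exosystem into that form. *)
Lemma steady_state : exists theta : R -> 'cV[R]_(im_dim m), [/\
  forall t, is_derive t (1 : R) theta (M_blk m *m theta t + N_blk m *m disturbance_signal d t),
  forall t, disturbance_signal d t = B_blk (d_freq d) *m theta t &
  exists2 b : R, 0 <= b & forall t, 0 <= t -> `|theta t| <= b].
Proof.
exists theta; split => //.
have [P [c [k LP]]] := lyapunov_M_blk.
have [b b0 hb] := disturbance_bounded.
have f0 : 0 <= n%:R * `|N_blk m| * b by rewrite !mulr_ge0.
have [B B0 hB] := lyapunov_bounded LP 1 (normr_ge0 (theta 0)) f0.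
exists B => // t t0; apply: (hB t theta (fun t => N_blk m *m disturbance_signal d t)) => //.
- exact: within_of_derive theta_derive.
- move=> s _; apply: le_trans (norm_mulmx _ _) _.
  by rewrite ler_wpM2l ?mulr_ge0 // hb.
Qed.

End SteadyState.

(** * Convergence of a square-integrable Lipschitz signal *)

Section Barbalat.
Variable R : realType.
Implicit Types (s t x : R).

Lemma lipschitz_of_derive m q (w dw : R -> 'M[R]_(m, q)) B a b : 0 <= B -> a <= b ->
  {within `[a, b], continuous w} ->
  (forall t, a < t < b -> is_derive t (1 : R) w (dw t)) ->
  (forall t, a < t < b -> `|dw t| <= B) -> `|w b - w a| <= B * (b - a).
Proof.
move=> B0 ab cw hw hB; apply: mx_norm_le; first by rewrite mulr_ge0 ?subr_ge0.
move=> i j; rewrite !mxE.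
have ci : {within `[a, b], continuous (fun t => w t i j)} by exact: within_entry.
have cl : {within `[a, b], continuous (fun t => B *: t)}.
  by apply: within_scale; apply: continuous_subspaceT => t; exact: cvg_id.
have dl t : is_derive t (1 : R) (fun t => B *: t) B.
  apply: (is_derive_conv (is_derive_scale (is_derive_id t (1 : R)) B)).
  by rewrite /GRing.scale /= mulr1.
have hij t : a < t < b -> `|dw t i j| <= B.
  by move=> ht; apply: le_trans (hB t ht); exact: mx_entry_le.
have h1 : w b i j - B *: b <= w a i j - B *: a.
  apply: (@le_of_derive_le0 _ (fun t => w t i j - B *: t) (fun t => dw t i j - B) a b) => //.
  - exact: within_sub.
  - by move=> t ht; apply: is_derive_sub => //; apply: is_derive_entry; exact: hw.
  - by move=> t /hij; rewrite ler_norml subr_le0 => /andP[].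
have h2 : - w b i j - B *: b <= - w a i j - B *: a.
  apply: (@le_of_derive_le0 _ (fun t => - w t i j - B *: t) (fun t => - dw t i j - B) a b) => //.
  - by apply: within_sub => // x; apply: cvgN; exact: ci.
  - move=> t ht; apply: is_derive_sub => //; apply: is_derive_opp.
    by apply: is_derive_entry; exact: hw.
  - by move=> t /hij; rewrite ler_norml => /andP[]; lra.
rewrite /GRing.scale /= in h1 h2.
by rewrite ler_norml; apply/andP; split; lra.
Qed.

(** If the signal returned to size eps at arbitrarily late times, the Lipschitz
   bound would keep it large on intervals of fixed length, on each of which V
   drops by a fixed amount. *)
Lemma barbalat m q (V dV : R -> R) (w dw : R -> 'M[R]_(m, q)) (k B : R) :
  0 < k -> 0 <= B -> (forall t, 0 <= t -> 0 <= V t) ->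
  {within `[0, +oo[, continuous V} ->
  (forall t, 0 < t -> is_derive t (1 : R) V (dV t)) ->
  (forall t, 0 < t -> dV t <= - k * nsq (w t)) ->
  {within `[0, +oo[, continuous w} ->
  (forall t, 0 < t -> is_derive t (1 : R) w (dw t)) ->
  (forall t, 0 < t -> `|dw t| <= B) ->
  w t @[t --> +oo] --> (0 : 'M[R]_(m, q)).
Proof.
move=> k0 B0 V0 cV hV hdV cw hw hdw; apply/cvgrPdist_le => e e0.
have sub s t : 0 <= s -> `[s, t]%classic `<=` (`[0, +oo[%classic : set R).
  by move=> s0 x /=; rewrite !in_itv /= andbT => /andP[sx _]; exact: le_trans sx.
(* |w| stays above e / 2 during a time d after exceeding e *)
pose d := e / (2 * (B + 1)).
have d0 : 0 < d by rewrite divr_gt0 // mulr_gt0 //; lra.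
have Bd : B * d <= e / 2.
  rewrite /d mulrA ler_pdivrMr ?mulr_gt0 //; last lra.
  nra.
pose drop := k * (e / 2) ^+ 2 * d.
have drop0 : 0 < drop.
  by do 2!apply: mulr_gt0 => //; rewrite exprn_gt0 // divr_gt0.
pose A := [set y | exists2 t, 0 <= t & y = V t].
have iA : has_inf A.
  split; first by exists (V 0), 0.
  by exists 0 => _ [t t0 ->]; exact: V0.
(* from the time a on, V cannot lose drop any more *)
have [_ [a a0 ->] ha] := inf_adherent drop0 iA.
have infle t : 0 <= t -> inf A <= V t by move=> t0; apply: ge_inf; [exact: iA.2|exists t].
have mono s t : 0 <= s -> s <= t -> V t <= V s.
  move=> s0 st; apply: (@le_of_derive_le0 _ V dV s t) => //.
  - exact: (continuous_subspaceW (sub _ _ s0) cV).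
  - by move=> x /andP[sx _]; apply: hV; exact: le_lt_trans sx.
  - move=> x /andP[sx _]; apply: le_trans (hdV x (le_lt_trans s0 sx)) _.
    by rewrite mulNr oppr_le0 mulr_ge0 ?nsq_ge0 // ltW.
exists a; split; first by rewrite num_real.
move=> t at_; rewrite sub0r normrN leNgt; apply/negP => et.
have t0 : 0 <= t by apply: le_trans (ltW at_).
have big x : t <= x <= t + d -> (e / 2) ^+ 2 <= nsq (w x).
  move=> /andP[tx xd]; apply: le_trans (norm_le_nsq _).
  have L : `|w x - w t| <= B * (x - t).
    apply: (@lipschitz_of_derive _ _ w dw) => //.
    - exact: (continuous_subspaceW (sub _ _ t0) cw).
    - by move=> y /andP[ty _]; apply: hw; exact: le_lt_trans ty.
    - by move=> y /andP[ty _]; apply: hdw; exact: le_lt_trans ty.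
  have L2 : B * (x - t) <= B * d by rewrite ler_wpM2l //; lra.
  have tri : `|w t| <= `|w x| + `|w x - w t|.
    rewrite -[X in `|X| <= _](subKr (w x)) -[w x - (w x - w t)]addrC addrC.
    exact: ler_normB.
  rewrite lerXn2r ?nnegrE ?divr_ge0 ?(ltW e0) //; lra.
have dropV : V (t + d) + k * (e / 2) ^+ 2 *: (t + d) <= V t + k * (e / 2) ^+ 2 *: t.
  apply: (@le_of_derive_le0 _ (fun x => V x + k * (e / 2) ^+ 2 *: x)
     (fun x => dV x + k * (e / 2) ^+ 2) t (t + d)).
  - lra.
  - apply: within_add; first exact: (continuous_subspaceW (sub _ _ t0) cV).
    by apply: within_scale; apply: continuous_subspaceT => x; exact: cvg_id.
  - move=> x /andP[tx _]; apply: is_derive_add; first by apply: hV; exact: le_lt_trans tx.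
    apply: (is_derive_conv (is_derive_scale (is_derive_id x (1 : R)) (k * (e / 2) ^+ 2))).
    by rewrite /GRing.scale /= mulr1.
  - move=> x /andP[tx xd]; have := hdV x (le_lt_trans t0 tx).
    have : k * (e / 2) ^+ 2 <= k * nsq (w x).
      by rewrite ler_pM2l // big // (ltW tx) (ltW xd).
    lra.
have h1 := mono a t a0 (ltW at_).
have h2 := infle (t + d) (addr_ge0 t0 (ltW d0)).
move: dropV; rewrite /GRing.scale /= => dropV.
have dropE : drop = k * (e / 2) ^+ 2 * (t + d) - k * (e / 2) ^+ 2 * t.
  by rewrite /drop; ring.
lra.
Qed.

End Barbalat.

(** * Derivatives along curves, products of balls, inverses of coercive matrices *)

Section Composition.
Variable R : realType.

Lemma is_derive_comp_diff (U V : normedModType R) (f : U -> V) (q : R -> U) t dq :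
  differentiable f (q t) -> is_derive t (1 : R) q dq ->
  is_derive t (1 : R) (fun s => f (q s)) ('D_dq f (q t)).
Proof.
move=> df [dq1 dq2].
have dqd : differentiable q t by exact/derivable1_diffP.
have dc : differentiable (f \o q) t by exact: differentiable_comp.
split; first exact/derivable1_diffP.
have -> : 'D_1 (fun s => f (q s)) t = 'd (f \o q) t 1 by rewrite deriveE.
by rewrite diff_comp //= -[X in 'd f _ X]deriveE // dq2 -deriveE.
Qed.

Section Pairs.
Variables U V : normedModType R.

Lemma is_derive_fst (x : R -> U * V) t dx :
  is_derive t (1 : R) x dx -> is_derive t (1 : R) (fun s => (x s).1) dx.1.
Proof.
move=> [d1 d2]; have c1 : h^-1 *: (x (h *: (1 : R) + t) - x t) @[h --> (0 : R)^'] --> dx.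
  by rewrite -d2; exact: d1.
have c2 : h^-1 *: ((x (h *: (1 : R) + t)).1 - (x t).1) @[h --> (0 : R)^'] --> dx.1.
  apply: (@cvg_comp _ _ _ (fun h => h^-1 *: (x (h *: (1 : R) + t) - x t)) fst _ _ _ c1).
  by case: (dx) => a b; exact: cvg_fst.
by split; [apply/cvg_ex; exists dx.1|apply/cvg_lim].
Qed.

Lemma is_derive_snd (x : R -> U * V) t dx :
  is_derive t (1 : R) x dx -> is_derive t (1 : R) (fun s => (x s).2) dx.2.
Proof.
move=> [d1 d2]; have c1 : h^-1 *: (x (h *: (1 : R) + t) - x t) @[h --> (0 : R)^'] --> dx.
  by rewrite -d2; exact: d1.
have c2 : h^-1 *: ((x (h *: (1 : R) + t)).2 - (x t).2) @[h --> (0 : R)^'] --> dx.2.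
  apply: (@cvg_comp _ _ _ (fun h => h^-1 *: (x (h *: (1 : R) + t) - x t)) snd _ _ _ c1).
  by case: (dx) => a b; exact: cvg_snd.
by split; [apply/cvg_ex; exists dx.2|apply/cvg_lim].
Qed.

Lemma compact_ball_pair :
  (forall r : R, compact [set x : U | `|x| <= r]) ->
  (forall r : R, compact [set x : V | `|x| <= r]) ->
  forall r : R, compact [set x : U * V | `|x| <= r].
Proof.
move=> cU cV r.
have -> : [set x : U * V | `|x| <= r] = [set x : U | `|x| <= r] `*` [set x : V | `|x| <= r].
  apply/seteqP; split => -[x y] /=; rewrite prod_normE /= ge_max.
    by case/andP.
  by case=> -> ->.
exact: compact_setX.
Qed.

End Pairs.

Lemma coercive_unit n (A : 'M[R]_n) k : 0 < k ->
  (forall x : 'cV[R]_n, k * nsq x <= qform A x) -> A \in unitmx.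
Proof.
move=> k0 h; rewrite -unitmx_tr -row_free_unit -kermx_eq0; apply/rowV0P => v.
move=> /sub_kermxP vA; apply: trmx_inj; rewrite trmx0.
apply/eqP; rewrite -nsq_eq0 eq_le nsq_ge0 andbT -(pmulr_rle0 _ k0).
apply: le_trans (h _) _; rewrite /qform trmxK -mulmxA.
have -> : A *m v^T = 0 by rewrite -[A]trmxK -trmx_mul vA trmx0.
by rewrite mulmx0 mxE.
Qed.

Lemma coercive_inv n (A : 'M[R]_n) k (y : 'cV[R]_n) : 0 < k ->
  (forall x : 'cV[R]_n, k * nsq x <= qform A x) ->
  `|invmx A *m y| <= n%:R / k * `|y|.
Proof.
move=> k0 h; have uA := coercive_unit k0 h.
set z := invmx A *m y.
have zy : A *m z = y by rewrite /z mulKVmx.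
have h1 : k * `|z| ^+ 2 <= n%:R * `|z| * `|y|.
  apply: (@le_trans _ _ (k * nsq z)); first by rewrite ler_pM2l // norm_le_nsq.
  apply: le_trans (h z) _; rewrite /qform -mulmxA zy.
  apply: le_trans (ler_norm _) _; apply: le_trans (mx_entry_le _ _ _) _.
  by apply: le_trans (norm_mulmx _ _) _; rewrite norm_trmx.
have [->|z0] := eqVneq z 0; first by rewrite normr0 !mulr_ge0 // invr_ge0 ltW.
have zp : 0 < `|z| by rewrite normr_gt0.
rewrite mulrAC ler_pdivlMr // mulrC -(ler_pM2r zp).
by move: h1; rewrite expr2; lra.
Qed.

(** The inverse is Lipschitz in the matrix as long as the forms stay uniformly
   coercive. *)
Lemma coercive_inv_continuous n (U : topologicalType) (A : U -> 'M[R]_n) k : 0 < k ->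
  (forall u (x : 'cV[R]_n), k * nsq x <= qform (A u) x) -> continuous A ->
  continuous (fun u => invmx (A u)).
Proof.
move=> k0 h cA u; apply/cvgrPdist_le => e e0.
have nk0 : 0 <= n%:R / k by rewrite divr_ge0 // ltW.
have inv_le (B : 'M[R]_n) v : `|invmx (A v) *m B| <= n%:R / k * `|B|.
  apply: mx_norm_le; first by rewrite mulr_ge0.
  move=> i j; have -> : (invmx (A v) *m B) i j = (invmx (A v) *m col j B) i 0.
    by rewrite [col j B]colE mulmxA -colE [RHS]mxE.
  apply: le_trans (mx_entry_le _ _ _) _; apply: le_trans (coercive_inv _ k0 (h v)) _.
  by rewrite ler_wpM2l //; apply: mx_norm_le => // x z; rewrite mxE mx_entry_le.
pose C := n%:R / k * (n%:R * `|invmx (A u)|).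
have C0 : 0 <= C by apply: mulr_ge0 => //; exact: mulr_ge0.
have e1 : 0 < e / (C + 1) by rewrite divr_gt0 //; lra.
have /cvgrPdist_le/(_ _ e1) := cA u.
apply: filterS => v hv.
have -> : invmx (A u) - invmx (A v) = invmx (A v) *m ((A v - A u) *m invmx (A u)).
  rewrite mulmxBl mulmxBr mulmxV ?(coercive_unit k0 (h u)) // mulmx1.
  by rewrite mulKmx // (coercive_unit k0 (h v)).
apply: le_trans (inv_le _ _) _.
apply: (@le_trans _ _ (C * (e / (C + 1)))).
  rewrite /C -[leRHS]mulrA ler_wpM2l //; apply: le_trans (norm_mulmx _ _) _.
  rewrite -[leLHS]mulrA -[leRHS]mulrA ler_wpM2l // mulrC distrC ler_wpM2l //.
by rewrite mulrA ler_pdivrMr; lra.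
Qed.

End Composition.

(** * The adaptive controller of one agent *)

Section ColumnAlgebra.
Variable R : realType.

Lemma col_addE n (x y : 'cV[R]_n) i : (x + y) i 0 = x i 0 + y i 0.
Proof. by rewrite mxE. Qed.

Lemma col_oppE n (x : 'cV[R]_n) i : (- x) i 0 = - x i 0.
Proof. by rewrite mxE. Qed.

Lemma col_scaleE n (k : R) (x : 'cV[R]_n) i : (k *: x) i 0 = k * x i 0.
Proof. by rewrite mxE. Qed.

Definition col_linE := (col_addE, col_oppE, col_scaleE).

Lemma skew_form n (X : 'M[R]_n) (x : 'cV[R]_n) : skew_symmetric X -> \tr (x^T *m (X *m x)) = 0.
Proof.
move=> hX; have : \tr (x^T *m (X *m x)) = - \tr (x^T *m (X *m x)).
  by rewrite -[LHS]mxtrace_tr !trmx_mul trmxK hX mulmxN mulNmx linearN /= mulmxA.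
lra.
Qed.

Lemma dot_sym n (x y : 'cV[R]_n) : \tr (x^T *m y) = \tr (y^T *m x).
Proof. by rewrite -mxtrace_tr trmx_mul trmxK. Qed.

Lemma dot_young n (x y : 'cV[R]_n) d : 0 < d ->
  2 * \tr (x^T *m y) <= d * nsq x + d^-1 * nsq y.
Proof.
move=> d0; rewrite !nsq_wsq; have := wsq_young x y (@trmx1 _ _) _ d0.
by rewrite mulmx1; apply => Z; rewrite -nsq_wsq nsq_ge0.
Qed.

End ColumnAlgebra.

Section AgentAlgebra.
Variables (R : realType) (n p l : nat) (g : agent R n p) (m : internal_model R n l).
Variable c : controller p m.
Hypotheses (hlin : el_linear g) (hskew : el_skew g) (hreg : regression_identities g c).
Variables (B : 'M[R]_(n, im_dim m)) (r : 'I_l -> R).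
Hypothesis hdec : A_blk m - B = \sum_j r j *: im_E m j.
Local Notation A := (A_blk m).
Local Notation Nb := (N_blk m).
Local Notation Mb := (M_blk m).
Local Notation Th := (theta g).

Definition agent_rho (q v s qr qrr : 'cV[R]_n) (zeta : 'M[R]_(im_dim m, p))
    (xi : 'cV[R]_(im_dim m)) : 'M[R]_(n, omega_dim p l) :=
  row_mx (row_mx (A *m zeta + ct_Q c q v s qr qrr) (E_row (zeta + Nb *m ct_L c q s)))
         (E_row xi).

Definition agent_torque q v s qr qrr zeta xi (om : 'cV[R]_(omega_dim p l)) : 'cV[R]_n :=
  - (ct_K c *m s) - agent_rho q v s qr qrr zeta xi *m om + A *m xi.

(** The parameter vector that the adaptation would have to find: Theta itself, its
   products with the opposites of the coefficients of the decomposition of A - B,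
   and these coefficients. *)
Definition true_parameter : 'cV[R]_(omega_dim p l) :=
  col_mx (col_mx Th (\mxcol_(j < l) (- r j *: Th))) (\mxcol_(j < l) (r j)%:M).

(** The internal-model error: it compares xi with the state - theta of the
   disturbance generator after removing the contributions of the momentum and
   of the uncertain parameters. *)
Definition model_error (q s : 'cV[R]_n) zeta xi th : 'cV[R]_(im_dim m) :=
  xi + th - Nb *m (inertia g q *m s) - zeta *m Th.

Lemma E_row_mxcol q1 q2 (Z : 'M[R]_(im_dim m, q1)) (X : 'I_l -> 'M[R]_(q1, q2)) :
  E_row Z *m \mxcol_(j < l) X j = \sum_j im_E m j *m Z *m X j.
Proof. exact: mul_mxrow_mxcol. Qed.

(** Multiplying rho by the true parameter replaces A by B in the terms that
   the regressor can only produce with A. *)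
Lemma rho_true_parameter q v s qr qrr zeta xi :
  agent_rho q v s qr qrr zeta xi *m true_parameter =
  (A *m zeta + ct_Q c q v s qr qrr) *m Th
  - (A - B) *m ((zeta + Nb *m ct_L c q s) *m Th) + (A - B) *m xi.
Proof.
rewrite /agent_rho /true_parameter !mul_row_col !E_row_mxcol hdec !mulmx_suml -sumrN.
congr (_ + _ + _); apply: eq_bigr => j _.
  by rewrite -scalemxAr scaleNr -!scalemxAl mulmxA.
by rewrite mul_mx_scalar -scalemxAl.
Qed.

Section Motion.
Variables (q v qr qrr dv d : 'cV[R]_n) (zeta : 'M[R]_(im_dim m, p)).
Variables (xi th : 'cV[R]_(im_dim m)) (om : 'cV[R]_(omega_dim p l)).
Variable s : 'cV[R]_n.
Hypothesis hs : s = v - qr.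
Let H := inertia g q.
Let C := coriolis g q v.
Let rho := agent_rho q v s qr qrr zeta xi.
Let tau := agent_torque q v s qr qrr zeta xi om.
Let eps := model_error q s zeta xi th.
Hypothesis motion : H *m dv + C *m v + gravity g q = tau + d.
Hypothesis hth : d = B *m th.

Lemma sliding_momentum : H *m (dv - qrr) + C *m s = tau + d - regressor g q v qrr qr *m Th.
Proof.
rewrite -hlin -/H -/C -motion hs !mulmxBr.
by apply/colP => i; rewrite !col_linE; ring.
Qed.

(** The torque compensates the disturbance and the uncertain feedforward up to the
   model error and the parameter mismatch. *)
Lemma sliding_dynamics : H *m (dv - qrr) + C *m s =
  - (ct_K c *m s) + B *m eps - rho *m (om - true_parameter).
Proof.
rewrite sliding_momentum hth [rho *m (_ - _)]mulmxBr /rho rho_true_parameter /tau /agent_torque -/rho /eps /model_error.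
have [hL _ hQ] := hreg q v s qr qrr.
rewrite [(zeta + _) *m Th]mulmxDl -[_ *m ct_L _ _ _ *m Th]mulmxA hL.
rewrite [(A *m zeta + _) *m Th]mulmxDl hQ.
rewrite -/H; move: (A_blk m) => A; rewrite -!mulmxA; move: (zeta *m Th) (Nb *m (H *m s)) => z w.
rewrite ![(A - B) *m _]mulmxBl !mulmxDr !mulmxN.
by apply/colP => i; rewrite !col_linE; ring.
Qed.

(** The filter zeta is designed so that the torque, the disturbance and the inertial
   terms cancel: the error is a free motion of the Hurwitz matrix M. *)
Lemma model_error_dynamics :
  (Mb *m xi + Nb *m tau) + (Mb *m th + Nb *m d)
  - Nb *m (inertia_dot g q v *m s + H *m (dv - qrr))
  - (Mb *m zeta + ct_P c q v s qr qrr) *m Th = Mb *m eps.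
Proof.
have hm : H *m (dv - qrr) = tau + d - regressor g q v qrr qr *m Th - C *m s.
  by rewrite -sliding_momentum addrK.
have [_ hP _] := hreg q v s qr qrr.
rewrite hm mulmxDl hP /eps /model_error -/H -/C !(mulmxDr, mulmxN) -!mulmxA.
by apply/colP => i; rewrite !col_linE; ring.
Qed.

Variables (Lam : 'M[R]_(omega_dim p l)) (P : 'M[R]_(im_dim m)) (kM kP kK ce : R).
Hypothesis LP : lyapunov Mb P kM kP.
Hypothesis uLam : Lam \in unitmx.
Hypotheses (kK0 : 0 < kK) (hK : forall x : 'cV[R]_n, kK * nsq x <= qform (ct_K c) x).
Hypothesis ce0 : 0 <= ce.
Hypothesis hce : kK^-1 * nsq (B *m eps) <= ce * (2 * kM) * wsq P eps.

(** The adaptation law cancels the parameter mismatch, skew symmetry cancels the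
   Coriolis term, and the decay of the internal-model error dominates its
   effect on the sliding variable. *)
Lemma lyapunov_rate :
  2 * \tr (s^T *m (H *m (dv - qrr))) + \tr (s^T *m (inertia_dot g q v *m s))
  + 2 * \tr ((om - true_parameter)^T *m Lam *m (invmx Lam *m rho^T *m s))
  + ce * (2 * \tr (eps^T *m P *m (Mb *m eps))) <= - kK * nsq s.
Proof.
have hH : H *m (dv - qrr) =
    - (ct_K c *m s) + B *m eps - rho *m (om - true_parameter) - C *m s.
  by rewrite -sliding_dynamics addrK.
have e1 := skew_form s (hskew q v).
rewrite mulmxBl mulmxBr linearB /= -scalemxAl -scalemxAr linearZ /= -/C in e1.
have e2 : \tr ((om - true_parameter)^T *m Lam *m (invmx Lam *m rho^T *m s))
    = \tr (s^T *m (rho *m (om - true_parameter))).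
  rewrite -[invmx Lam *m rho^T *m s]mulmxA [_ *m (invmx Lam *m _)]mulmxA mulmxK // dot_sym.
  by rewrite trmx_mul mulmxA.
have e3 := lyapunov_decr LP eps.
have e4 := hK s; rewrite -wsq_cV /wsq -mulmxA in e4.
have e5 := dot_young s (B *m eps) kK0.
have e6 := ler_wpM2l ce0 e3.
have e7 : \tr (s^T *m (H *m (dv - qrr))) = - \tr (s^T *m (ct_K c *m s))
    + \tr (s^T *m (B *m eps)) - \tr (s^T *m (rho *m (om - true_parameter)))
    - \tr (s^T *m (C *m s)).
  rewrite hH; move: (ct_K c *m s) (B *m eps) (rho *m _) (C *m s) => x1 x2 x3 x4.
  by rewrite !(mulmxDr, mulmxN) !mxtraceD  ![\tr (- _)]linearN.
have e8 := hce; rewrite e7 e2; lra.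
Qed.

End Motion.

End AgentAlgebra.

(** * Continuity of the closed-loop vector field *)

Section Continuity.
Variable R : realType.
Variables (T : topologicalType) (D : set T).

Lemma within_row_mx k k1 k2 (f : T -> 'M[R]_(k, k1)) (h : T -> 'M[R]_(k, k2)) :
  {within D, continuous f} -> {within D, continuous h} ->
  {within D, continuous (fun t => row_mx (f t) (h t))}.
Proof.
move=> cf ch; apply: within_mx => i j.
have -> : (fun t => row_mx (f t) (h t) i j) =
    (fun t => match fintype.split j with inl j1 => f t i j1 | inr j2 => h t i j2 end).
  by apply/funext => t; rewrite mxE.
by case: (fintype.split j) => j'; exact: within_entry.
Qed.

Variables (n p l : nat) (g : agent R n p) (m : internal_model R n l).
Variable c : controller p m.
Hypotheses (hEL : euler_lagrange g) (hc : controller_design g c).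

Lemma within_E_row k (f : T -> 'M[R]_(im_dim m, k)) :
  {within D, continuous f} -> {within D, continuous (fun t => E_row (f t))}.
Proof.
move=> cf; apply: within_mx => i j.
have -> : (fun t => E_row (f t) i j) = (fun t => (im_E m (tagnat.sig1 j) *m f t) i (tagnat.sig2 j)).
  by apply/funext => t; rewrite [LHS]mxE.
by apply: within_entry; apply: within_mulmx => //; exact: within_cst.
Qed.

Variables q v s qr qrr : T -> 'cV[R]_n.
Hypotheses (cq : {within D, continuous q}) (cv : {within D, continuous v}).
Hypotheses (cs : {within D, continuous s}) (cqr : {within D, continuous qr}).
Hypothesis cqrr : {within D, continuous qrr}.

Lemma within_ct_L : {within D, continuous (fun t => ct_L c (q t) (s t))}.
Proof.
have [_ _ _ _ [cL _ _]] := hc.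
exact: (within_comp cL (within_pair cq cs)).
Qed.

Lemma within_ct_P :
  {within D, continuous (fun t => ct_P c (q t) (v t) (s t) (qr t) (qrr t))}.
Proof.
have [_ _ _ _ [_ cP _]] := hc.
exact: (within_comp cP (within_pair (within_pair (within_pair (within_pair cq cv) cs) cqr) cqrr)).
Qed.

Lemma within_ct_Q :
  {within D, continuous (fun t => ct_Q c (q t) (v t) (s t) (qr t) (qrr t))}.
Proof.
have [_ _ _ _ [_ _ cQ]] := hc.
exact: (within_comp cQ (within_pair (within_pair (within_pair (within_pair cq cv) cs) cqr) cqrr)).
Qed.

Variables (zeta : T -> 'M[R]_(im_dim m, p)) (xi : T -> 'cV[R]_(im_dim m)).
Variables (om : T -> 'cV[R]_(omega_dim p l)) (d : T -> 'cV[R]_n).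
Hypotheses (czeta : {within D, continuous zeta}) (cxi : {within D, continuous xi}).
Hypotheses (com : {within D, continuous om}) (cd : {within D, continuous d}).

Lemma within_agent_rho : {within D, continuous
  (fun t => agent_rho c (q t) (v t) (s t) (qr t) (qrr t) (zeta t) (xi t))}.
Proof.
apply: within_row_mx; last exact: within_E_row.
apply: within_row_mx.
  by apply: within_add; [apply: within_mulmx => //; exact: within_cst|exact: within_ct_Q].
apply: within_E_row; apply: within_add => //.
by apply: within_mulmx; [exact: within_cst|exact: within_ct_L].
Qed.

Lemma within_agent_torque : {within D, continuous
  (fun t => agent_torque c (q t) (v t) (s t) (qr t) (qrr t) (zeta t) (xi t) (om t))}.
Proof.
apply: within_add; last by apply: within_mulmx => //; exact: within_cst.
apply: within_sub; last by apply: within_mulmx => //; exact: within_agent_rho.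
have -> : (fun t => - (ct_K c *m s t)) = (fun t => (- ct_K c) *m s t).
  by apply/funext => t; rewrite mulNmx.
by apply: within_mulmx => //; exact: within_cst.
Qed.

Definition acceleration q v s qr qrr zeta xi om d : 'cV[R]_n :=
  invmx (inertia g q) *m (agent_torque c q v s qr qrr zeta xi om + d
     - coriolis g q v *m v - gravity g q).

Lemma within_acceleration : {within D, continuous (fun t =>
  acceleration (q t) (v t) (s t) (qr t) (qrr t) (zeta t) (xi t) (om t) (d t))}.
Proof.
have [[hdiff cC cG] [km [kM [kc [kg [[km0 _ _ _] hb]]]]] _ _] := hEL.
have cI : continuous (fun q : 'cV[R]_n => invmx (inertia g q)).
  apply: (coercive_inv_continuous km0) => [u x|u]; last exact: differentiable_continuous.
  by have [_ h _ _] := hb u 0; rewrite nsq_cV; have /andP[] := h x.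
apply: within_mulmx; first exact: (within_comp cI cq).
apply: within_sub; last exact: (within_comp cG cq).
apply: within_sub; first by apply: within_add => //; exact: within_agent_torque.
by apply: within_mulmx => //; exact: (within_comp cC (within_pair cq cv)).
Qed.

End Continuity.

Lemma inertia_unit (R : realType) n p (g : agent R n p) : euler_lagrange g ->
  forall q, inertia g q \in unitmx.
Proof.
move=> [_ [km [kM [kc [kg [[km0 _ _ _] hb]]]]] _ _] q.
apply: (coercive_unit km0) => x.
by have [_ h _ _] := hb q 0; rewrite nsq_cV; have /andP[] := h x.
Qed.


(** * One agent driven by prescribed observer signals *)

(** The section variables eta and y stand for the observer outputs eta_i and
   S_i eta_i, etad and yd for their derivatives, B for Psi (T^sigma)^-1, r for
   the coefficients of A - B, and th for the steady state of the internal model,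
   which generates the disturbance d. *)
Section AgentDynamics.
Variable R : realType.
Implicit Types (t T : R).
Variables (n p l : nat) (g : agent R n p) (m : internal_model R n l).
Variables (c : controller p m) (alpha : R).
Hypotheses (a0 : 0 < alpha) (hEL : euler_lagrange g) (hc : controller_design g c).
Variables (B : 'M[R]_(n, im_dim m)) (r : 'I_l -> R).
Hypothesis hdec : A_blk m - B = \sum_j r j *: im_E m j.
Variables (P : 'M[R]_(im_dim m)) (kM kP : R).
Hypothesis LP : lyapunov (M_blk m) P kM kP.
Variables (d : R -> 'cV[R]_n) (th : R -> 'cV[R]_(im_dim m)) (bth : R).
Hypothesis cd : continuous d.
Hypothesis dth : forall t, is_derive t (1 : R) th (M_blk m *m th t + N_blk m *m d t).
Hypothesis hd : forall t, d t = B *m th t.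
Hypothesis hbth : forall t, 0 <= t -> `|th t| <= bth.
Variables (eta y etad yd : R -> 'cV[R]_n) (bs : R).
Hypotheses (ceta : {within `[0, +oo[, continuous eta}) (cy : {within `[0, +oo[, continuous y}).
Hypotheses (cetad : {within `[0, +oo[, continuous etad}) (cyd : {within `[0, +oo[, continuous yd}).
Hypothesis deta : forall t, 0 < t -> is_derive t (1 : R) eta (etad t).
Hypothesis dy : forall t, 0 < t -> is_derive t (1 : R) y (yd t).
Hypothesis hbs : forall t, 0 <= t ->
  [/\ `|eta t| <= bs, `|y t| <= bs, `|etad t| <= bs & `|yd t| <= bs].
Local Notation Th := (theta g).
Local Notation Nb := (N_blk m).
Local Notation Mb := (M_blk m).
Local Notation Lam := (ct_Lambda c).
Local Notation star := (true_parameter g r).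

Definition ref_velocity t (q : 'cV[R]_n) : 'cV[R]_n := y t - alpha *: (q - eta t).

Definition ref_acceleration t (v : 'cV[R]_n) : 'cV[R]_n := yd t - alpha *: (v - etad t).

Definition sliding_var t (q v : 'cV[R]_n) : 'cV[R]_n := v - ref_velocity t q.

Definition torque_at t q v zeta xi om :=
  agent_torque c q v (sliding_var t q v) (ref_velocity t q) (ref_acceleration t v) zeta xi om.

Definition rho_at t q v zeta xi :=
  agent_rho c q v (sliding_var t q v) (ref_velocity t q) (ref_acceleration t v) zeta xi.

Definition P_at t q v :=
  ct_P c q v (sliding_var t q v) (ref_velocity t q) (ref_acceleration t v).

Record agent_solution T (q v : R -> 'cV[R]_n) (xi : R -> 'cV[R]_(im_dim m))
    (zeta : R -> 'M[R]_(im_dim m, p)) (om : R -> 'cV[R]_(omega_dim p l)) : Prop := {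
  sol_q : {within `[0, T], continuous q};
  sol_v : {within `[0, T], continuous v};
  sol_xi : {within `[0, T], continuous xi};
  sol_zeta : {within `[0, T], continuous zeta};
  sol_om : {within `[0, T], continuous om};
  sol_dq : forall t, 0 < t < T -> is_derive t (1 : R) q (v t);
  sol_dv : forall t, 0 < t < T -> derivable v t (1 : R) /\
    inertia g (q t) *m derive1 v t + coriolis g (q t) (v t) *m v t + gravity g (q t)
    = torque_at t (q t) (v t) (zeta t) (xi t) (om t) + d t;
  sol_dxi : forall t, 0 < t < T -> is_derive t (1 : R) xi
    (Mb *m xi t + Nb *m torque_at t (q t) (v t) (zeta t) (xi t) (om t));
  sol_dzeta : forall t, 0 < t < T -> is_derive t (1 : R) zeta
    (Mb *m zeta t + P_at t (q t) (v t));
  sol_dom : forall t, 0 < t < T -> is_derive t (1 : R) om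
    (invmx Lam *m (rho_at t (q t) (v t) (zeta t) (xi t))^T *m sliding_var t (q t) (v t)) }.

Lemma agent_solution_restrict T T' q v xi zeta om : T' <= T ->
  agent_solution T q v xi zeta om -> agent_solution T' q v xi zeta om.
Proof.
move=> TT' [h1 h2 h3 h4 h5 h6 h7 h8 h9 h10].
have sub : `[0, T']%classic `<=` (`[0, T]%classic : set R).
  by move=> x /=; rewrite !in_itv /= => /andP[-> xT]; exact: le_trans TT'.
have lt t : 0 < t < T' -> 0 < t < T by move=> /andP[-> tT]; exact: lt_le_trans TT'.
by split; (try exact: (continuous_subspaceW sub)); move=> t /lt; auto.
Qed.

(** * The Lyapunov function of an agent *)

Section Solution.
Variable T : R.
Variables (q v : R -> 'cV[R]_n) (xi : R -> 'cV[R]_(im_dim m)).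
Variables (zeta : R -> 'M[R]_(im_dim m, p)) (om : R -> 'cV[R]_(omega_dim p l)).
Hypothesis sol : agent_solution T q v xi zeta om.

Definition sliding_of t := sliding_var t (q t) (v t).

Definition error_of t := model_error g (q t) (sliding_of t) (zeta t) (xi t) (th t).

Let H t := inertia g (q t).
Let s := sliding_of.
Let eps := error_of.
Let ds t := derive1 v t - ref_acceleration t (v t).

Lemma sliding_derive t : 0 < t < T -> is_derive t (1 : R) sliding_of (ds t).
Proof.
move=> ht; have t0 : 0 < t by case/andP: ht.
have [dv _] := sol_dv sol ht.
have hv : is_derive t (1 : R) v (derive1 v t) by rewrite derive1E; exact: derivableP.
exact: (is_derive_sub hv (is_derive_sub (dy t0)
  (is_derive_scale (is_derive_sub (sol_dq sol ht) (deta t0)) alpha))).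
Qed.

Let cT (V : topologicalType) (f : R -> V) :
  {within `[0, +oo[, continuous f} -> {within `[0, T], continuous f}.
Proof. exact: within_halfline. Qed.

Lemma sliding_within : {within `[0, T], continuous sliding_of}.
Proof.
apply: within_sub; first exact: sol_v sol.
apply: within_sub; first exact: cT.
apply: within_scale; apply: within_sub; [exact: sol_q sol|exact: cT].
Qed.

Lemma inertia_continuous : continuous (inertia g).
Proof.
by have [[hdiff _ _] _ _ _] := hEL; move=> x; exact: differentiable_continuous.
Qed.

Let H_within : {within `[0, T], continuous H}.
Proof. exact: (within_comp inertia_continuous (sol_q sol)). Qed.

Let H_derive t : 0 < t < T -> is_derive t (1 : R) H (inertia_dot g (q t) (v t)).
Proof.
have [[hdiff _ _] _ _ _] := hEL.
by move=> ht; exact: (is_derive_comp_diff (hdiff (q t)) (sol_dq sol ht)).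
Qed.

Lemma error_derive t : 0 < t < T -> is_derive t (1 : R) error_of (Mb *m eps t).
Proof.
move=> ht; have [_ hb hlin hskew] := hEL; have [_ _ _ hreg _] := hc.
have [_ hmot] := sol_dv sol ht.
have hs : s t = v t - ref_velocity t (q t) by [].
have := model_error_dynamics hlin hreg (th t) hs hmot.
set rhs := (X in X = _) => e.
have h1 : is_derive t (1 : R) (fun x => Nb *m (H x *m s x))
    (Nb *m (inertia_dot g (q t) (v t) *m s t + H t *m ds t)).
  have hHs := is_derive_mulmx (H_derive ht) (sliding_derive ht).
  apply: (is_derive_conv (is_derive_mulmx (is_derive_cst Nb t 1) hHs)).
  by rewrite mul0mx add0r.
have h2 : is_derive t (1 : R) (fun x => zeta x *m Th)
    ((Mb *m zeta t + P_at t (q t) (v t)) *m Th).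
  apply: (is_derive_conv (is_derive_mulmx (sol_dzeta sol ht) (is_derive_cst Th t 1))).
  by rewrite mulmx0 addr0.
apply: (is_derive_conv (is_derive_sub (is_derive_sub (is_derive_add (sol_dxi sol ht) (dth t)) h1) h2)).
exact: e.
Qed.

Lemma error_within : {within `[0, T], continuous error_of}.
Proof.
apply: within_sub; last first.
  by apply: within_mulmx; [exact: sol_zeta sol|exact: within_cst].
apply: within_sub.
  apply: within_add; first exact: sol_xi sol.
  exact: (within_of_derive dth).
apply: within_mulmx; first exact: within_cst.
by apply: within_mulmx; [exact: H_within|exact: sliding_within].
Qed.

Definition lyapunov_function ce t : R :=
  \tr ((s t)^T *m (H t *m s t)) + wsq Lam (om t - star) + ce * wsq P (eps t).

Let Lam_sym : Lam^T = Lam.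
Proof.
have [_ hdiag _ _ _] := hc; apply/matrixP => i j; rewrite mxE.
have [->//|ij] := eqVneq i j.
have /is_diag_mxP hD := hdiag.
by rewrite !hD // eq_sym.
Qed.

Lemma lyapunov_function_derive ce t : 0 < t < T ->
  is_derive t (1 : R) (lyapunov_function ce)
   (2 * \tr ((s t)^T *m (H t *m ds t)) + \tr ((s t)^T *m (inertia_dot g (q t) (v t) *m s t))
    + 2 * \tr ((om t - star)^T *m Lam *m
        (invmx Lam *m (rho_at t (q t) (v t) (zeta t) (xi t))^T *m s t))
    + ce * (2 * \tr ((eps t)^T *m P *m (Mb *m eps t)))).
Proof.
move=> ht; have [hP _ _ _ _] := LP.
have [_ [km [kM' [kc [kg [_ hb]]]]] _ _] := hEL.
have symH : (H t)^T = H t by have [] := hb (q t) 0.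
have hs := sliding_derive ht.
have h1 := is_derive_mxtrace (is_derive_mulmx (is_derive_trmx hs) (is_derive_mulmx (H_derive ht) hs)).
have hom : is_derive t (1 : R) (fun x => om x - star)
    (invmx Lam *m (rho_at t (q t) (v t) (zeta t) (xi t))^T *m s t).
  by apply: (is_derive_conv (is_derive_sub (sol_dom sol ht) (is_derive_cst star t 1))); rewrite subr0.
have h2 := is_derive_wsq Lam_sym hom.
have h3 := is_derive_scale (is_derive_wsq hP (error_derive ht)) ce.
apply: (is_derive_conv (is_derive_add (is_derive_add h1 h2) h3)).
congr (_ + _ + _); rewrite mxtraceD [X in _ + \tr X]mulmxDr mxtraceD.
have -> : \tr ((ds t)^T *m (H t *m s t)) = \tr ((s t)^T *m (H t *m ds t)).
  by rewrite dot_sym trmx_mul symH mulmxA.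
by rewrite -/(s t); ring.
Qed.

Lemma lyapunov_function_within ce : {within `[0, T], continuous (lyapunov_function ce)}.
Proof.
have tr_cont : continuous (fun X : 'M[R]_1 => \tr X).
  have -> : (fun X : 'M[R]_1 => \tr X) = (fun X => X 0 0).
    by apply/funext => X; rewrite /mxtrace big_ord1.
  exact: coord_continuous.
apply: within_add; first apply: within_add.
- apply: (within_comp tr_cont); apply: within_mulmx.
    by apply: within_trmx; exact: sliding_within.
  by apply: within_mulmx; [exact: H_within|exact: sliding_within].
- apply: (within_comp (g := fun X : 'cV[R]_(omega_dim p l) => wsq Lam X)).
    by move=> X; apply: (@cvg_wsq _ _ (nbhs X) _ _ _ _ id); exact: cvg_id.
  by apply: within_sub; [exact: sol_om sol|exact: within_cst].
- apply: (@within_scale _ _ _ _ ce (fun x => wsq P (eps x))).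
  apply: (within_comp (g := fun X : 'cV[R]_(im_dim m) => wsq P X)).
    by move=> X; apply: (@cvg_wsq _ _ (nbhs X) _ _ _ _ id); exact: cvg_id.
  exact: error_within.
Qed.

End Solution.

(** The coercivity constants of the gain matrices and of the inertia, and a weight
   ce for the model error, large enough for its decay to absorb the Young
   remainder of its coupling with the sliding variable. *)
Definition closed_loop_gains (ce kK kL kH : R) : Prop :=
  [/\ 0 < ce, 0 < kK, 0 < kL, 0 < kH &
    [/\ forall x : 'cV[R]_n, kK * nsq x <= qform (ct_K c) x,
      forall x : 'cV[R]_(omega_dim p l), kL * nsq x <= qform Lam x,
      forall q (x : 'cV[R]_n), kH * nsq x <= qform (inertia g q) x &
      forall x : 'cV[R]_(im_dim m), kK^-1 * nsq (B *m x) <= ce * (2 * kM) * wsq P x]].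

Lemma exists_gains : exists ce kK kL kH, closed_loop_gains ce kK kL kH.
Proof.
have [hK _ hL _ _] := hc; have [_ hb _ _] := hEL.
have [_ kM0 kP0 _ _] := LP.
have [kK kK0 hkK] := posdef_coercive hK.
have [kL kL0 hkL] := posdef_coercive hL.
have [km [kM' [kc [kg [[km0 _ _ _] hb']]]]] := hb.
have [b b0 hbB] : exists2 b, 0 <= b & forall x : 'cV[R]_(im_dim m), nsq (B *m x) <= b * `|x| ^+ 2.
  have [b b0 hb1] := wsq_bound 1 (B^T *m B).
  by exists b => // x; apply: le_trans (hb1 x); rewrite /nsq /wsq trmx_mul !mulmxA.
(* + 1 keeps the weight positive, even for B = 0 *)
exists (kK^-1 * (b / kP) / (2 * kM) + 1), kK, kL, km.
have kk0 : 0 < kK^-1 by rewrite invr_gt0.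
have bk : 0 <= kK^-1 * (b / kP) / (2 * kM).
  by apply: divr_ge0; [apply: mulr_ge0; [exact: ltW|apply: divr_ge0 => //; exact: ltW]|rewrite mulr_ge0 // ltW].
split => //; first lra.
split => //.
- by move=> q x; have [_ h _ _] := hb' q 0; rewrite nsq_cV; have /andP[] := h x.
- move=> x; have Wx : kP * `|x| ^+ 2 <= wsq P x.
    apply: le_trans (lyapunov_coercive LP x); rewrite ler_pM2l //; exact: norm_le_nsq.
  have W0 : 0 <= wsq P x by apply: (lyapunov_ge0 LP).
  have h1 : nsq (B *m x) <= b / kP * wsq P x.
    apply: le_trans (hbB x) _; rewrite -mulrA ler_wpM2l // mulrC ler_pdivlMr // mulrC.
    exact: Wx.
  have h2 := ler_wpM2l (ltW kk0) h1.
  have -> : (kK^-1 * (b / kP) / (2 * kM) + 1) * (2 * kM) * wsq P x =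
    kK^-1 * (b / kP * wsq P x) + 2 * kM * wsq P x by field; rewrite ?gt_eqF.
  by apply: le_trans h2 _; rewrite lerDl mulr_ge0 // mulr_ge0 // ltW.
Qed.

Section Rate.
Variables (ce kK kL kH : R).
Hypothesis hg : closed_loop_gains ce kK kL kH.

Let uLam : Lam \in unitmx.
Proof. by have [_ _ L0 _ [_ hL _ _]] := hg; exact: (coercive_unit L0 hL). Qed.

Lemma lyapunov_function_rate T q v xi zeta om t :
  agent_solution T q v xi zeta om -> 0 < t < T ->
  exists2 dV, is_derive t (1 : R) (lyapunov_function q v xi zeta om ce) dV &
    dV <= - kK * nsq (sliding_of q v t).
Proof.
move=> sol ht; have [ce0 K0 _ _ [hK _ _ hce]] := hg.
have [_ _ hlin hskew] := hEL; have [_ _ _ hreg _] := hc.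
have [_ hmot] := sol_dv sol ht.
have hs : sliding_of q v t = v t - ref_velocity t (q t) by [].
eexists; first exact: (lyapunov_function_derive sol ce ht).
apply: (lyapunov_rate hlin hskew hreg hdec hs hmot (hd t) LP uLam K0 hK (ltW ce0)).
exact: hce.
Qed.

End Rate.


Lemma three_terms (x1 x2 x3 w1 w2 w3 V : R) : x1 <= w1 -> x2 <= w2 -> x3 <= w3 ->
  0 <= x1 -> 0 <= x2 -> 0 <= x3 -> w1 + w2 + w3 <= V ->
  [/\ x1 <= V, x2 <= V & x3 <= V].
Proof. by move=> *; split; lra. Qed.

(** * A priori bounds *)

Section Bounds.
Variables (q0 v0 : 'cV[R]_n) (xi0 : 'cV[R]_(im_dim m)).
Variables (zeta0 : 'M[R]_(im_dim m, p)) (om0 : 'cV[R]_(omega_dim p l)).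

Definition starts_at (q v : R -> 'cV[R]_n) (xi : R -> 'cV[R]_(im_dim m))
    (zeta : R -> 'M[R]_(im_dim m, p)) (om : R -> 'cV[R]_(omega_dim p l)) : Prop :=
  [/\ q 0 = q0, v 0 = v0, xi 0 = xi0, zeta 0 = zeta0 & om 0 = om0].

(** The Lyapunov function does not increase and dominates the three squares.  As the
   bound involves the initial values but not T, it also serves as the a priori
   bound for existence. *)
Lemma error_bounds : exists2 b : R, 0 <= b & forall T q v xi zeta om,
  agent_solution T q v xi zeta om -> starts_at q v xi zeta om ->
  forall t, 0 <= t <= T ->
    [/\ `|sliding_of q v t| <= b, `|om t| <= b & `|error_of q v xi zeta t| <= b].
Proof.
have [ce [kK [kL [kH hg]]]] := exists_gains.
have [ce0 K0 L0 H0 [_ hL hH _]] := hg.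
have [_ _ kP0 _ _] := LP.
pose V0 : R := lyapunov_function (fun=> q0) (fun=> v0) (fun=> xi0) (fun=> zeta0) (fun=> om0) ce 0.
pose b1 : R := Num.sqrt (V0 / kH); pose b2 : R := Num.sqrt (V0 / kL) + `|star|.
pose b3 : R := Num.sqrt (V0 / (ce * kP)).
have b10 : 0 <= b1 by exact: sqrtr_ge0.
have b20 : 0 <= b2 by apply: addr_ge0; [exact: sqrtr_ge0|exact: normr_ge0].
have b30 : 0 <= b3 by exact: sqrtr_ge0.
exists (b1 + b2 + b3); first by rewrite !addr_ge0.
move=> T q v xi zeta om sol [i1 i2 i3 i4 i5] t /andP[t0 tT].
have solt := agent_solution_restrict tT sol.
have hV : lyapunov_function q v xi zeta om ce t <= V0.
  have -> : V0 = lyapunov_function q v xi zeta om ce 0.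
    by rewrite /V0 /lyapunov_function /error_of /sliding_of i1 i2 i3 i4 i5.
  apply: (le_of_rate_le0 t0); first exact: (lyapunov_function_within solt).
  move=> x hx; have [dV h1 h2] := lyapunov_function_rate hg solt hx.
  exists dV => //; apply: le_trans h2 _.
  by rewrite mulNr oppr_le0; apply: mulr_ge0; [exact: ltW|exact: nsq_ge0].
move: hV; rewrite /lyapunov_function [_^T *m (_ *m _)]mulmxA -/(wsq (inertia g (q t)) (sliding_of q v t)).
have w1 : kH * nsq (sliding_of q v t) <= wsq (inertia g (q t)) (sliding_of q v t).
  by rewrite wsq_cV; exact: hH.
have w2 : kL * nsq (om t - star) <= wsq Lam (om t - star) by rewrite wsq_cV; exact: hL.
have w3 : ce * kP * nsq (error_of q v xi zeta t) <= ce * wsq P (error_of q v xi zeta t).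
  rewrite -mulrA; apply: (ler_wpM2l (ltW ce0)); exact: (lyapunov_coercive LP).
have n1 : 0 <= kH * nsq (sliding_of q v t) by apply: mulr_ge0; [exact: ltW|exact: nsq_ge0].
have n2 : 0 <= kL * nsq (om t - star) by apply: mulr_ge0; [exact: ltW|exact: nsq_ge0].
have n3 : 0 <= ce * kP * nsq (error_of q v xi zeta t).
  by apply: mulr_ge0; [apply: mulr_ge0; exact: ltW|exact: nsq_ge0].
move=> hV.
have [c1 c2 c3] := three_terms w1 w2 w3 n1 n2 n3 hV.
have r1 := norm_of_nsq_le H0 c1.
have r2 := norm_of_nsq_le L0 c2.
have r3 := norm_of_nsq_le (mulr_gt0 ce0 kP0) c3.
have r4 : `|om t| <= b2.
  rewrite -[om t](subrK star); apply: le_trans (ler_normD _ _) _.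
  by rewrite lerD2r.
split.
- apply: le_trans r1 _; rewrite -/b1 -addrA lerDl; exact: addr_ge0.
- apply: le_trans r4 _; rewrite -addrA [b2 + b3]addrC addrA lerDr; exact: addr_ge0.
- apply: le_trans r3 _; rewrite -/b3 lerDr; exact: addr_ge0.
Qed.

Let bs0 : 0 <= bs.
Proof. by have [h _ _ _] := hbs (lexx 0); exact: le_trans (normr_ge0 _) h. Qed.

Let ref_bound (y1 q1 e1 : 'cV[R]_n) (b : R) : `|y1| <= bs -> `|q1| <= b -> `|e1| <= bs ->
  `|y1 - alpha *: (q1 - e1)| <= bs + alpha * (b + bs).
Proof.
move=> h1 h2 h3; apply: le_trans (ler_normB _ _) _; apply: lerD => //.
rewrite normrZ (gtr0_norm a0) ler_pM2l //.
by apply: le_trans (ler_normB _ _) _; exact: lerD.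
Qed.

(** The position error is filtered out of bounded signals by a stable linear
   equation: (q - eta)' = - alpha (q - eta) + s + y - eta'. *)
Lemma signal_bounds : exists2 b : R, 0 <= b & forall T q v xi zeta om,
  agent_solution T q v xi zeta om -> starts_at q v xi zeta om ->
  forall t, 0 <= t <= T ->
    [/\ `|om t| <= b, `|error_of q v xi zeta t| <= b &
    [/\ `|q t| <= b, `|v t| <= b, `|sliding_of q v t| <= b,
        `|ref_velocity t (q t)| <= b & `|ref_acceleration t (v t)| <= b]].
Proof.
have [b b0 hb] := error_bounds.
have f0 : 0 <= b + bs + bs by rewrite !addr_ge0.
have [Bz Bz0 hBz] := lyapunov_bounded (lyapunov_scalar n a0) 1 (normr_ge0 (q0 - eta 0)) f0.
pose bq : R := Bz + bs; pose br : R := bs + alpha * (bq + bs).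
have bq0 : 0 <= bq by exact: addr_ge0.
have br0 : 0 <= br by apply: addr_ge0 => //; apply: mulr_ge0; [exact: ltW|exact: addr_ge0].
pose bv : R := b + br; have bv0 : 0 <= bv by exact: addr_ge0.
pose ba : R := bs + alpha * (bv + bs).
have ba0 : 0 <= ba by apply: addr_ge0 => //; apply: mulr_ge0; [exact: ltW|exact: addr_ge0].
exists (bq + bv + ba); first by apply: addr_ge0 => //; exact: addr_ge0.
move=> T q v xi zeta om sol st t ht.
have [hs hom he] := hb T q v xi zeta om sol st t ht.
have [t0 tT] : 0 <= t /\ t <= T by apply/andP.
have solt := agent_solution_restrict tT sol.
have [e1 e2 e3 e4] := hbs t0.
have hz : `|q t - eta t| <= Bz.
  apply: (hBz t (fun x => q x - eta x) (fun x => sliding_of q v x + y x - etad x)) => //.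
  - by case: st => ->.
  - by apply: within_sub; [exact: sol_q solt|exact: within_halfline].
  - move=> x hx; have x0 : 0 < x by case/andP: hx.
    apply: (is_derive_conv (is_derive_sub (sol_dq solt hx) (deta x0))).
    rewrite /sliding_of /sliding_var /ref_velocity mulNmx mul_scalar_mx.
    by apply/colP => i; rewrite !col_linE; ring.
  - move=> x hx; have x0 : 0 <= x by case/andP: hx => /ltW.
    have xT : 0 <= x <= T.
      by rewrite x0; case/andP: hx => _ /ltW xt; exact: le_trans xt tT.
    have [hsx _ _] := hb T q v xi zeta om sol st x xT.
    have [_ f2 f3 _] := hbs x0.
    apply: le_trans (ler_normB _ _) _; apply: lerD => //.
    by apply: le_trans (ler_normD _ _) _; exact: lerD.
have hq : `|q t| <= bq.
  by rewrite -[q t](subrK (eta t)); apply: le_trans (ler_normD _ _) _; exact: lerD.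
have hr : `|ref_velocity t (q t)| <= br by exact: ref_bound.
have hv : `|v t| <= bv.
  rewrite -[v t](subrK (ref_velocity t (q t))).
  by apply: le_trans (ler_normD _ _) _; exact: lerD.
have ha : `|ref_acceleration t (v t)| <= ba by exact: ref_bound.
have hbv : b <= bv by rewrite lerDl.
have hrv : br <= bv by rewrite lerDr.
have l1 : bq <= bq + bv + ba by rewrite -addrA lerDl; exact: addr_ge0.
have l3 : ba <= bq + bv + ba by rewrite lerDr; exact: addr_ge0.
have l2 : bv <= bq + bv + ba by rewrite [bq + bv]addrC -addrA lerDl; exact: addr_ge0.
move: (le_trans hbv l2) (le_trans hrv l2) => l4 l5.
split; [exact: le_trans hom l4|exact: le_trans he l4|].
by split; [exact: le_trans hq l1|exact: le_trans hv l2|exact: le_trans hs l4|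
  exact: le_trans hr l5|exact: le_trans ha l3].
Qed.

Lemma regressor_bounded (b : R) : exists2 B, 0 <= B & forall q v s qr qrr : 'cV[R]_n,
  `|q| <= b -> `|v| <= b -> `|s| <= b -> `|qr| <= b -> `|qrr| <= b ->
  `|ct_P c q v s qr qrr| <= B.
Proof.
have [_ _ _ _ [_ cP _]] := hc.
have c1 := @compact_mx_ball R n 1.
have c2 := @compact_ball_pair _ _ _ c1 c1.
have c5 := @compact_ball_pair _ _ _ (@compact_ball_pair _ _ _ (@compact_ball_pair _ _ _ c2 c1) c1) c1.
have [Bp hBp] := continuous_compact_bounded (c5 b) cP.
exists `|Bp| => // q v s qr qrr h1 h2 h3 h4 h5; apply: le_trans (ler_norm Bp).
apply: (hBp (q, v, s, qr, qrr)); rewrite /= !prod_normE /= !ge_max.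
by rewrite h1 h2 h3 h4 h5.
Qed.

(** The state zeta is a stable filter of the bounded regressor P, and xi is then
   determined by the model error. *)
Lemma state_bounds : exists2 b : R, 0 <= b & forall T q v xi zeta om,
  agent_solution T q v xi zeta om -> starts_at q v xi zeta om ->
  forall t, 0 <= t <= T ->
    [/\ `|xi t| <= b, `|zeta t| <= b, `|om t| <= b &
    [/\ `|q t| <= b, `|v t| <= b, `|sliding_of q v t| <= b,
        `|ref_velocity t (q t)| <= b & `|ref_acceleration t (v t)| <= b]].
Proof.
have [b b0 hb] := signal_bounds.
have [BP BP0 hBP] := regressor_bounded b.
have [Bz Bz0 hBz] := lyapunov_bounded LP p (normr_ge0 zeta0) BP0.
have [BH hBH] := continuous_compact_bounded (compact_mx_ball (r:=b)) inertia_continuous.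
have bth0 : 0 <= bth by exact: le_trans (normr_ge0 _) (hbth (lexx 0)).
pose k1 : R := n%:R * `|Nb| * (n%:R * `|BH| * b).
pose k2 : R := p%:R * Bz * `|Th|.
have k10 : 0 <= k1 by rewrite /k1 !mulr_ge0.
have k20 : 0 <= k2 by rewrite /k2 !mulr_ge0.
pose bx : R := b + k2 + k1 + bth; have bx0 : 0 <= bx.
  by apply: addr_ge0 => //; apply: addr_ge0 => //; exact: addr_ge0.
exists (bx + Bz + b); first by apply: addr_ge0 => //; exact: addr_ge0.
move=> T q v xi zeta om sol st t ht.
have [t0 tT] : 0 <= t /\ t <= T by apply/andP.
have solt := agent_solution_restrict tT sol.
have [hom he [hq hv hs hr ha]] := hb T q v xi zeta om sol st t ht.
have hz : `|zeta t| <= Bz.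
  apply: (hBz t zeta (fun x => P_at x (q x) (v x))) => //.
  - by case: st => _ _ _ ->.
  - exact: sol_zeta solt.
  - by move=> x hx; exact: (sol_dzeta solt hx).
  - move=> x hx; have x0 : 0 <= x by case/andP: hx => /ltW.
    have xT : 0 <= x <= T.
      by rewrite x0; case/andP: hx => _ /ltW xt; exact: le_trans xt tT.
    have [_ _ [f1 f2 f3 f4 f5]] := hb T q v xi zeta om sol st x xT.
    exact: hBP.
have hx : `|xi t| <= bx.
  have -> : xi t = error_of q v xi zeta t + zeta t *m Th
      + Nb *m (inertia g (q t) *m sliding_of q v t) - th t.
    rewrite /error_of /model_error.
    move: (zeta t *m Th) (Nb *m _) (th t) (xi t) => z1 z2 z3 z4.
    by apply/colP => i; rewrite !col_linE; ring.
  apply: le_trans (ler_normB _ _) _; apply: lerD; last exact: hbth.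
  apply: le_trans (ler_normD _ _) _; apply: lerD.
    apply: le_trans (ler_normD _ _) _; apply: lerD => //.
    exact: norm_mulmx_le.
  apply: norm_mulmx_le => //; apply: norm_mulmx_le => //.
  by apply: le_trans (ler_norm BH); apply: hBH.
have l1 : bx <= bx + Bz + b by rewrite -addrA lerDl; exact: addr_ge0.
have l3 : b <= bx + Bz + b by rewrite lerDr; exact: addr_ge0.
have l2 : Bz <= bx + Bz + b by rewrite [bx + Bz]addrC -addrA lerDl; exact: addr_ge0.
split; [exact: le_trans hx l1|exact: le_trans hz l2|exact: le_trans hom l3|].
by split; [exact: le_trans hq l3|exact: le_trans hv l3|exact: le_trans hs l3|
  exact: le_trans hr l3|exact: le_trans ha l3].
Qed.

End Bounds.

Lemma solution_acceleration T q v xi zeta om t : agent_solution T q v xi zeta om -> 0 < t < T ->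
  derive1 v t = acceleration g c (q t) (v t) (sliding_of q v t) (ref_velocity t (q t))
    (ref_acceleration t (v t)) (zeta t) (xi t) (om t) (d t).
Proof.
move=> sol ht; have [_ h] := sol_dv sol ht.
have uH := inertia_unit hEL (q t).
apply: (can_inj (mulKmx uH)); rewrite /acceleration mulKVmx //.
move: h; rewrite /torque_at -/(sliding_of q v t) => <-.
by rewrite addrAC addrK addrK.
Qed.

Let W := ('cV[R]_n * 'cV[R]_n * 'cV[R]_n * 'cV[R]_n * 'cV[R]_n * 'M[R]_(im_dim m, p)
  * 'cV[R]_(im_dim m) * 'cV[R]_(omega_dim p l) * 'cV[R]_n)%type.

Lemma acceleration_bounded (b : R) : exists2 b1 : R, 0 <= b1 &
  forall (q v s qr qrr : 'cV[R]_n) zeta xi om d,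
  `|q| <= b -> `|v| <= b -> `|s| <= b -> `|qr| <= b -> `|qrr| <= b ->
  `|zeta| <= b -> `|xi| <= b -> `|om| <= b -> `|d| <= b ->
  `|acceleration g c q v s qr qrr zeta xi om d| <= b1.
Proof.
have c1 := @compact_mx_ball R n 1.
have c2 := @compact_ball_pair _ _ _ c1 c1.
have c5 := @compact_ball_pair _ _ _ (@compact_ball_pair _ _ _ (@compact_ball_pair _ _ _ c2 c1) c1) c1.
have c6 := @compact_ball_pair _ _ _ c5 (@compact_mx_ball R (im_dim m) p).
have c7 := @compact_ball_pair _ _ _ c6 (@compact_mx_ball R (im_dim m) 1).
have c8 := @compact_ball_pair _ _ _ c7 (@compact_mx_ball R (omega_dim p l) 1).
have c9 := @compact_ball_pair _ _ _ c8 c1.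
pose K := [set z : W | `|z| <= b].
have p0 : {within K, continuous (fun z : W => z)}.
  by apply: continuous_subspaceT => z; exact: cvg_id.
have p1 := within_proj1 p0; have p2 := within_proj1 p1; have p3 := within_proj1 p2.
have p4 := within_proj1 p3; have p5 := within_proj1 p4; have p6 := within_proj1 p5.
have p7 := within_proj1 p6.
have cA := within_acceleration hEL hc (within_proj1 p7) (within_proj2 p7) (within_proj2 p6)
  (within_proj2 p5) (within_proj2 p4) (within_proj2 p3) (within_proj2 p2) (within_proj2 p1) (within_proj2 p0).
have [Bp hBp] := within_compact_bounded (c9 b) cA.
exists `|Bp| => // q v s qr qrr zeta xi om e h1 h2 h3 h4 h5 h6 h7 h8 h9.
apply: le_trans (ler_norm Bp).
apply: (hBp (q, v, s, qr, qrr, zeta, xi, om, e)); rewrite /= !prod_normE /= !ge_max.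
by rewrite h1 h2 h3 h4 h5 h6 h7 h8 h9.
Qed.

(** * Tracking of the observer *)

Section Convergence.
Variables (q v : R -> 'cV[R]_n) (xi : R -> 'cV[R]_(im_dim m)).
Variables (zeta : R -> 'M[R]_(im_dim m, p)) (om : R -> 'cV[R]_(omega_dim p l)).
Hypothesis sol : forall T, agent_solution T q v xi zeta om.

Let below t : 0 < t -> 0 < t < t + 1.
Proof. by move=> ->; rewrite ltrDl ltr01. Qed.

Lemma solution_bounded : exists2 b : R, 0 <= b & forall t, 0 <= t -> `|q t| <= b /\ `|v t| <= b.
Proof.
have [b b0 hb] := state_bounds (q 0) (v 0) (xi 0) (zeta 0) (om 0).
exists b => // t t0.
have ht : 0 <= t <= t by rewrite t0 lexx.
have st : starts_at (q 0) (v 0) (xi 0) (zeta 0) (om 0) q v xi zeta om by split.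
by have [_ _ _ []] := hb t q v xi zeta om (sol t) st t ht.
Qed.

Lemma sliding_derive_bounded : exists2 b : R, 0 <= b &
  forall t, 0 < t -> `|derive1 v t - ref_acceleration t (v t)| <= b.
Proof.
have [b b0 hb] := state_bounds (q 0) (v 0) (xi 0) (zeta 0) (om 0).
pose bd : R := (im_dim m)%:R * `|B| * `|bth|.
have bd0 : 0 <= bd by apply: mulr_ge0 => //; exact: mulr_ge0.
have [b1 b10 hb1] := acceleration_bounded (b + bd).
exists (b1 + b); first exact: addr_ge0.
move=> t t0; have ht : 0 <= t <= t + 1 by rewrite ltW //= lerDl.
have st : starts_at (q 0) (v 0) (xi 0) (zeta 0) (om 0) q v xi zeta om by split.
have [h1 h2 h3 [h4 h5 h6 h7 h8]] := hb (t + 1) q v xi zeta om (sol (t + 1)) st t ht.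
have lb x : x <= b -> x <= b + bd by move=> hx; apply: le_trans hx _; rewrite lerDl.
have hdt : `|d t| <= b + bd.
  apply: (@le_trans _ _ bd); last by rewrite lerDr.
  rewrite hd; apply: norm_mulmx_le => //.
  by apply: le_trans (hbth (ltW t0)) _; exact: ler_norm.
apply: le_trans (ler_normB _ _) _; apply: lerD => //.
rewrite (solution_acceleration (sol (t + 1)) (below t0)).
by apply: hb1 => //; exact: (lb _ _).
Qed.

(** The decay rate of the Lyapunov function controls the square of the sliding
   variable, which is Lipschitz. *)
Lemma sliding_cvg0 : sliding_of q v t @[t --> +oo] --> (0 : 'cV[R]_n).
Proof.
have [ce [kK [kL [kH hg]]]] := exists_gains.
have [ce0 K0 L0 H0 [_ hL hH _]] := hg.
have [b b0 hb] := sliding_derive_bounded.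
pose V := lyapunov_function q v xi zeta om ce.
apply: (@barbalat R n 1 V (derive1 V) (sliding_of q v)
  (fun t => derive1 v t - ref_acceleration t (v t)) kK b K0 b0).
- move=> t t0; rewrite /V /lyapunov_function [_^T *m (_ *m _)]mulmxA.
  rewrite -/(wsq (inertia g (q t)) (sliding_of q v t)).
  have w3 : 0 <= wsq P (error_of q v xi zeta t) by exact: (lyapunov_ge0 LP).
  have w1 : 0 <= wsq (inertia g (q t)) (sliding_of q v t).
    rewrite wsq_cV; apply: le_trans (hH _ _).
    by apply: mulr_ge0; [exact: ltW|exact: nsq_ge0].
  have w2 : 0 <= wsq Lam (om t - star).
    rewrite wsq_cV; apply: le_trans (hL _).
    by apply: mulr_ge0; [exact: ltW|exact: nsq_ge0].
  by apply: addr_ge0; [exact: addr_ge0|apply: mulr_ge0; [exact: ltW|exact: w3]].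
- by apply: within_halfline_of => T; exact: (lyapunov_function_within (sol T)).
- move=> t t0; have [e [h1 _] _] := lyapunov_function_rate hg (sol (t + 1)) (below t0).
  by rewrite derive1E; exact: derivableP.
- move=> t t0; have [e [_ h2] he] := lyapunov_function_rate hg (sol (t + 1)) (below t0).
  by rewrite derive1E h2.
- by apply: within_halfline_of => T; exact: (sliding_within (sol T)).
- by move=> t t0; exact: (sliding_derive (sol (t + 1)) (below t0)).
- exact: hb.
Qed.

Hypothesis hy : y t - etad t @[t --> +oo] --> (0 : 'cV[R]_n).

(** The position error obeys a stable linear equation driven by a vanishing input. *)
Lemma position_error_cvg0 : q t - eta t @[t --> +oo] --> (0 : 'cV[R]_n).
Proof.
pose F t := sliding_of q v t + (y t - etad t).
have cF : F t @[t --> +oo] --> (0 : 'cV[R]_n).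
  by rewrite -(addr0 0); exact: (cvgD sliding_cvg0 hy).
have LA := lyapunov_scalar n a0.
have sym1 : (1%:M : 'M[R]_n)^T = 1%:M by exact: trmx1.
have nsq1 (X : 'cV[R]_n) : wsq 1%:M X = nsq X by rewrite /wsq /nsq mulmx1.
pose z t := q t - eta t.
have dz t : 0 < t -> is_derive t (1 : R) z (- alpha%:M *m z t + F t).
  move=> t0; apply: (is_derive_conv (is_derive_sub (sol_dq (sol (t + 1)) (below t0)) (deta t0))).
  rewrite /F /z /sliding_of /sliding_var /ref_velocity mulNmx mul_scalar_mx.
  by apply/colP => i; rewrite !col_linE; ring.
have cz : {within `[0, +oo[, continuous z}.
  by apply: within_sub => //; apply: within_halfline_of => T; exact: sol_q (sol T).
apply: cvg0_of_nsq.
have -> : (fun t => nsq (q t - eta t)) = (fun t => wsq 1%:M (z t)).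
  by apply/funext => t; rewrite nsq1.
apply: (@gronwall_cvg0 R (fun t => wsq 1%:M (z t))
  (fun t => 2 * \tr ((z t)^T *m 1%:M *m (- alpha%:M *m z t + F t)))
  (fun t => alpha^-1 * wsq 1%:M (F t)) alpha a0).
- by move=> t t0; rewrite nsq1 nsq_ge0.
- apply: (within_comp (g := fun X : 'cV[R]_n => wsq 1%:M X)) => //.
  by move=> X; apply: (@cvg_wsq _ _ (nbhs X) _ _ _ _ id); exact: cvg_id.
- by move=> t t0; exact: (is_derive_wsq sym1 (dz t t0)).
- by move=> t t0; exact: (lyapunov_forced LA).
- rewrite -[X in _ --> X](mulr0 alpha^-1); apply: cvgMl_tmp.
  have -> : 0 = wsq (1%:M : 'M[R]_n) (0 : 'cV[R]_n).
    by rewrite /wsq mulmx0 mxtrace0.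
  exact: cvg_wsq.
Qed.

Lemma velocity_error_cvg0 : v t - y t @[t --> +oo] --> (0 : 'cV[R]_n).
Proof.
have -> : (fun t => v t - y t) = (fun t => sliding_of q v t - alpha *: (q t - eta t)).
  apply/funext => t; rewrite /sliding_of /sliding_var /ref_velocity.
  by apply/colP => i; rewrite !col_linE; ring.
rewrite -(subr0 0); apply: cvgB; first exact: sliding_cvg0.
by rewrite -(scaler0 _ alpha); apply: cvgZl_tmp; exact: position_error_cvg0.
Qed.

End Convergence.

(** * Existence of closed-loop trajectories *)

Section Existence.
Let X := ('cV[R]_n * 'cV[R]_n * 'cV[R]_(im_dim m) * 'M[R]_(im_dim m, p)
  * 'cV[R]_(omega_dim p l))%type.

Definition agent_field t (x : X) : X :=
  let q := x.1.1.1.1 in let v := x.1.1.1.2 in let xi := x.1.1.2 in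
  let zeta := x.1.2 in let om := x.2 in
  (v,
   acceleration g c q v (sliding_var t q v) (ref_velocity t q) (ref_acceleration t v)
     zeta xi om (d t),
   Mb *m xi + Nb *m torque_at t q v zeta xi om,
   Mb *m zeta + P_at t q v,
   invmx Lam *m (rho_at t q v zeta xi)^T *m sliding_var t q v).

Lemma agent_field_continuous :
  {within [set z : R * X | 0 <= z.1], continuous (fun z => agent_field z.1 z.2)}.
Proof.
pose D := [set z : R * X | 0 <= z.1].
have p0 : {within D, continuous (fun z : R * X => z.2)}.
  by apply: continuous_subspaceT => z; exact: cvg_snd.
have p1 := within_proj1 p0; have p2 := within_proj1 p1; have p3 := within_proj1 p2.
have cq := within_proj1 p3; have cv := within_proj2 p3; have cxi := within_proj2 p2.
have czeta := within_proj2 p1; have com := within_proj2 p0.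
have ceta' : {within D, continuous (fun z : R * X => eta z.1)} by exact: within_fst.
have cy' : {within D, continuous (fun z : R * X => y z.1)} by exact: within_fst.
have cetad' : {within D, continuous (fun z : R * X => etad z.1)} by exact: within_fst.
have cyd' : {within D, continuous (fun z : R * X => yd z.1)} by exact: within_fst.
have cd' : {within D, continuous (fun z : R * X => d z.1)}.
  by apply: within_fst; exact: continuous_subspaceT.
have cqr : {within D, continuous (fun z : R * X => ref_velocity z.1 z.2.1.1.1.1)}.
  by apply: within_sub cy' _; apply: within_scale; exact: within_sub.
have cqrr : {within D, continuous (fun z : R * X => ref_acceleration z.1 z.2.1.1.1.2)}.
  by apply: within_sub cyd' _; apply: within_scale; exact: within_sub.
have cs := within_sub cv cqr.
have cacc := within_acceleration hEL hc cq cv cs cqr cqrr czeta cxi com cd'.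
have ctau := within_agent_torque hc cq cv cs cqr cqrr czeta cxi com.
have cP := within_ct_P hc cq cv cs cqr cqrr.
have crho := within_agent_rho hc cq cv cs cqr cqrr czeta cxi.
have cMxi := within_mulmx (@within_cst _ _ D _ Mb) cxi.
have cNtau := within_mulmx (@within_cst _ _ D _ Nb) ctau.
have cMzeta := within_mulmx (@within_cst _ _ D _ Mb) czeta.
have cadapt := within_mulmx (within_mulmx (@within_cst _ _ D _ (invmx Lam)) (within_trmx crho)) cs.
exact: (within_pair (within_pair (within_pair (within_pair cv cacc)
  (within_add cMxi cNtau)) (within_add cMzeta cP)) cadapt).
Qed.

(** The field is solved for the acceleration; this returns to the implicit form of the
   equation of motion. *)
Lemma agent_solution_of_field T (x : R -> X) : {within `[0, T], continuous x} ->
  (forall t, 0 < t < T -> is_derive t (1 : R) x (agent_field t (x t))) ->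
  agent_solution T (fun t => (x t).1.1.1.1) (fun t => (x t).1.1.1.2) (fun t => (x t).1.1.2)
    (fun t => (x t).1.2) (fun t => (x t).2).
Proof.
move=> cx dx; pose D := `[0, T]%classic : set R.
have p1 := within_proj1 cx; have p2 := within_proj1 p1; have p3 := within_proj1 p2.
have d1 t (ht : 0 < t < T) := is_derive_fst (dx t ht).
have d2 t (ht : 0 < t < T) := is_derive_fst (d1 t ht).
have d3 t (ht : 0 < t < T) := is_derive_fst (d2 t ht).
split.
- exact: within_proj1 p3.
- exact: within_proj2 p3.
- exact: within_proj2 p2.
- exact: within_proj2 p1.
- exact: within_proj2 cx.
- by move=> t ht; exact: (is_derive_fst (d3 t ht)).
- move=> t ht; have [h1 h2] := is_derive_snd (d3 t ht); split; first exact: h1.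
  rewrite derive1E h2 /= /acceleration mulKVmx ?(inertia_unit hEL) //.
  move: (coriolis _ _ _ *m _) (gravity _ _) => z1 z2.
  by rewrite [X in X + _]addrAC !subrK.
- by move=> t ht; exact: (is_derive_snd (d2 t ht)).
- by move=> t ht; exact: (is_derive_snd (d1 t ht)).
- by move=> t ht; exact: (is_derive_snd (dx t ht)).
Qed.

(** The data are only continuous, so solutions come from compactness and the a priori
   bound, not from a contraction. *)
Lemma agent_solution_exists q0 v0 xi0 zeta0 om0 : exists q v xi zeta om,
  starts_at q0 v0 xi0 zeta0 om0 q v xi zeta om /\
  forall T, agent_solution T q v xi zeta om.
Proof.
have [b b0 hb] := state_bounds q0 v0 xi0 zeta0 om0.
pose x0 : X := (q0, v0, xi0, zeta0, om0).
have c1 := @compact_mx_ball R n 1.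
have c2 := @compact_ball_pair _ _ _ c1 c1.
have c3 := @compact_ball_pair _ _ _ c2 (@compact_mx_ball R (im_dim m) 1).
have c4 := @compact_ball_pair _ _ _ c3 (@compact_mx_ball R (im_dim m) p).
have c5 := @compact_ball_pair _ _ _ c4 (@compact_mx_ball R (omega_dim p l) 1).
have b1 t : 0 < b + 1 by apply: ltr_pwDr.
have cb : continuous (fun _ : R => b + 1) by move=> z; exact: cvg_cst.
have ap T (x : R -> X) : 0 <= T -> x 0 = x0 -> {within `[0, T], continuous x} ->
    (forall t, 0 < t < T -> is_derive t (1 : R) x (agent_field t (x t))) -> `|x T| < b + 1.
  move=> T0 x00 cx dx; have sol := agent_solution_of_field cx dx.
  have st : starts_at q0 v0 xi0 zeta0 om0 (fun t => (x t).1.1.1.1) (fun t => (x t).1.1.1.2)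
    (fun t => (x t).1.1.2) (fun t => (x t).1.2) (fun t => (x t).2) by split; rewrite x00.
  have hT : 0 <= T <= T by rewrite T0 lexx.
  have [h1 h2 h3 [h4 h5 _ _ _]] := hb T _ _ _ _ _ sol st T hT.
  apply: (@le_lt_trans _ _ b); last by rewrite ltrDl.
  by rewrite !prod_normE !ge_max h1 h2 h3 h4 h5.
have [x [x00 cx dx]] := @peano_apriori R _ c5 agent_field (fun=> b + 1) x0
  agent_field_continuous cb b1 ap.
exists (fun t => (x t).1.1.1.1), (fun t => (x t).1.1.1.2), (fun t => (x t).1.1.2),
  (fun t => (x t).1.2), (fun t => (x t).2).
split; first by split; rewrite x00.
move=> T; apply: agent_solution_of_field; first exact: within_halfline.
by move=> t /andP[t0 _]; exact: dx.
Qed.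

End Existence.

End AgentDynamics.

(** * The observer as a source of reference signals *)

Section BoundedSignals.
Variable R : realType.
Implicit Types (s t : R).

Lemma bounded_add m n (x y : R -> 'M[R]_(m, n)) :
  bounded_on_halfline x -> bounded_on_halfline y -> bounded_on_halfline (fun t => x t + y t).
Proof.
move=> [b hb] [b1 hb1]; exists (b + b1) => t t0.
by apply: le_trans (ler_normD _ _) _; apply: lerD; [exact: hb|exact: hb1].
Qed.

Lemma bounded_mulmx m n q (x : R -> 'M[R]_(m, n)) (y : R -> 'M[R]_(n, q)) :
  bounded_on_halfline x -> bounded_on_halfline y -> bounded_on_halfline (fun t => x t *m y t).
Proof.
move=> [b hb] [b1 hb1]; exists (n%:R * b * b1) => t t0.
by apply: norm_mulmx_le; [exact: hb|exact: hb1].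
Qed.

Lemma bounded_near_bounded m n (x y : R -> 'M[R]_(m, n)) (C : R) : 0 <= C ->
  (forall t, 0 <= t -> `|x t - y t| <= C * expR (- t)) -> bounded_on_halfline y ->
  bounded_on_halfline x.
Proof.
move=> C0 h [b hb]; exists (C + b) => t t0.
rewrite -[x t](subrK (y t)); apply: le_trans (ler_normD _ _) _.
apply: lerD; last exact: hb.
apply: le_trans (h t t0) _; rewrite -[leRHS]mulr1 ler_wpM2l //.
by rewrite -expR0 ler_expR oppr_le0.
Qed.

Lemma cvg0_of_exp m n (x : R -> 'M[R]_(m, n)) (C : R) :
  (forall t, 0 <= t -> `|x t| <= C * expR (- t)) ->
  x t @[t --> +oo] --> (0 : 'M[R]_(m, n)).
Proof.
move=> h; apply/norm_cvg0P.
apply: (@squeeze_cvgr _ _ _ _ (fun=> 0) (fun t => C * expR (- t))); last first.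
- rewrite -[X in _ --> X](mulr0 C); apply: cvgMl_tmp; exact: cvgr_expR.
- exact: cvg_cst.
- apply: filterS (nbhs_pinfty_ge (num_real 0)) => t t0.
  by rewrite normr_ge0 h.
Qed.

Lemma consensus_sum_le N m n (e : rel 'I_N) (a : 'M[R]_N) (mu b : R) i
    (f : 'I_N -> 'M[R]_(m, n)) : (forall j, `|f j - f i| <= b) ->
  `|mu *: \sum_(j | e j i) a i j *: (f j - f i)| <= `|mu| * (\sum_(j | e j i) `|a i j|) * b.
Proof.
move=> h; rewrite normrZ -mulrA ler_wpM2l // mulr_suml.
apply: le_trans (ler_norm_sum _ _ _) _; apply: ler_sum => j _.
by rewrite normrZ ler_wpM2l.
Qed.

End BoundedSignals.

Section ObserverSignals.
Variables (R : realType) (N n : nat) (e : rel 'I_N) (a : 'M[R]_N) (mu1 mu2 : R).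
Variables (S0 : 'I_N -> 'M[R]_n) (eta0 : 'I_N -> 'cV[R]_n).
Variables (S : 'I_N -> R -> 'M[R]_n) (eta : 'I_N -> R -> 'cV[R]_n).
Hypothesis obs : observer e a mu1 mu2 S0 eta0 S eta.
Variables (Sstar : 'M[R]_n) (w : R -> 'cV[R]_n) (C : R).
Hypothesis C0 : 0 <= C.
Hypothesis hS : forall i t, 0 <= t -> `|S i t - Sstar| <= C * expR (- t).
Hypothesis heta : forall i t, 0 <= t -> `|eta i t - w t| <= C * expR (- t).
Hypothesis bw : bounded_on_halfline w.
Implicit Types (t : R) (i j : 'I_N).

Definition etad i t := eta_rhs e a mu2 (S^~ t) (eta^~ t) i.

Definition obs_velocity i t := S i t *m eta i t.

Definition obs_acceleration i t := S_rhs e a mu1 (S^~ t) i *m eta i t + S i t *m etad i t.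

Lemma within_S_rhs i : {within `[0, +oo[, continuous (fun t => S_rhs e a mu1 (S^~ t) i)}.
Proof.
have cS j : {within `[0, +oo[, continuous (S j)} by have [[]] := obs j.
apply: within_scale => t; apply: cvg_big => [|j _]; first exact: add_continuous.
have h : {within `[0, +oo[, continuous (fun t => a i j *: (S j t - S i t))}.
  by apply: within_scale; apply: within_sub.
exact: h.
Qed.

Lemma within_etad i : {within `[0, +oo[, continuous (etad i)}.
Proof.
have cS j : {within `[0, +oo[, continuous (S j)} by have [[]] := obs j.
have ce j : {within `[0, +oo[, continuous (eta j)} by have [_ []] := obs j.
apply: within_add; first exact: within_mulmx.
apply: within_scale => t; apply: cvg_big => [|j _]; first exact: add_continuous.
have h : {within `[0, +oo[, continuous (fun t => a i j *: (eta j t - eta i t))}.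
  by apply: within_scale; apply: within_sub.
exact: h.
Qed.

Lemma within_obs_velocity i : {within `[0, +oo[, continuous (obs_velocity i)}.
Proof.
have [[cS _ _] [ce _ _]] := obs i.
exact: within_mulmx.
Qed.

Lemma within_obs_acceleration i : {within `[0, +oo[, continuous (obs_acceleration i)}.
Proof.
have [[cS _ _] [ce _ _]] := obs i.
apply: within_add; apply: within_mulmx => //; [exact: within_S_rhs|exact: within_etad].
Qed.

Lemma obs_velocity_derive i t : 0 < t ->
  is_derive t (1 : R) (obs_velocity i) (obs_acceleration i t).
Proof.
move=> t0; have [[_ dS _] [_ de _]] := obs i.
exact: (is_derive_mulmx (dS t t0) (de t t0)).
Qed.

Let S_bounded i : bounded_on_halfline (S i).
Proof.
apply: (bounded_near_bounded C0 (hS i)).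
by exists `|Sstar| => t _.
Qed.

Let eta_bounded i : bounded_on_halfline (eta i).
Proof. exact: (bounded_near_bounded C0 (heta i) bw). Qed.

Let S_diff i j t : 0 <= t -> `|S i t - S j t| <= 2 * C * expR (- t).
Proof.
move=> t0; have -> : S i t - S j t = (S i t - Sstar) - (S j t - Sstar).
  by rewrite opprB addrA subrK.
apply: le_trans (ler_normB _ _) _; have h1 := hS i t0; have h2 := hS j t0; lra.
Qed.

Let eta_diff i j t : 0 <= t -> `|eta i t - eta j t| <= 2 * C * expR (- t).
Proof.
move=> t0; have -> : eta i t - eta j t = (eta i t - w t) - (eta j t - w t).
  by rewrite opprB addrA subrK.
apply: le_trans (ler_normB _ _) _; have h1 := heta i t0; have h2 := heta j t0; lra.
Qed.

Let exp_le1 t : 0 <= t -> 2 * C * expR (- t) <= 2 * C.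
Proof.
move=> t0; rewrite -[leRHS]mulr1 ler_wpM2l ?mulr_ge0 //.
by rewrite -expR0 ler_expR oppr_le0.
Qed.

Lemma observer_signals_bounded i : exists bs : R, forall t, 0 <= t ->
  [/\ `|eta i t| <= bs, `|obs_velocity i t| <= bs, `|etad i t| <= bs &
      `|obs_acceleration i t| <= bs].
Proof.
have hv : bounded_on_halfline (obs_velocity i) by exact: bounded_mulmx.
have he : bounded_on_halfline (etad i).
  apply: bounded_add => //.
  exists (`|mu2| * (\sum_(j | e j i) `|a i j|) * (2 * C)) => t t0.
  apply: consensus_sum_le => j; exact: (le_trans (eta_diff j i t0) (exp_le1 t0)).
have hSr : bounded_on_halfline (fun t => S_rhs e a mu1 (S^~ t) i).
  exists (`|mu1| * (\sum_(j | e j i) `|a i j|) * (2 * C)) => t t0.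
  apply: consensus_sum_le => j; exact: (le_trans (S_diff j i t0) (exp_le1 t0)).
have ha : bounded_on_halfline (obs_acceleration i).
  by apply: bounded_add; exact: bounded_mulmx.
have [b1 h1] := eta_bounded i; have [b2 h2] := hv; have [b3 h3] := he; have [b4 h4] := ha.
exists (`|b1| + `|b2| + `|b3| + `|b4|) => t t0.
have k1 := h1 t t0; have l1 := ler_norm b1; have o1 := normr_ge0 b1.
have k2 := h2 t t0; have l2 := ler_norm b2; have o2 := normr_ge0 b2.
have k3 := h3 t t0; have l3 := ler_norm b3; have o3 := normr_ge0 b3.
have k4 := h4 t t0; have l4 := ler_norm b4; have o4 := normr_ge0 b4.
by split; lra.
Qed.

(** The reference velocity S eta differs from eta' by the consensus term only. *)
Lemma obs_velocity_mismatch i :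
  obs_velocity i t - etad i t @[t --> +oo] --> (0 : 'cV[R]_n).
Proof.
apply: (@cvg0_of_exp _ _ _ _ (`|mu2| * (\sum_(j | e j i) `|a i j|) * (2 * C))) => t t0.
rewrite /etad /eta_rhs /obs_velocity opprD addrA subrr sub0r normrN -[leRHS]mulrA.
by apply: consensus_sum_le => j; exact: eta_diff.
Qed.

Lemma eta_agreement i j : eta i t - eta j t @[t --> +oo] --> (0 : 'cV[R]_n).
Proof. by apply: (@cvg0_of_exp _ _ _ _ (2 * C)) => t t0; exact: eta_diff. Qed.

Lemma obs_velocity_agreement i j :
  obs_velocity i t - obs_velocity j t @[t --> +oo] --> (0 : 'cV[R]_n).
Proof.
have [b1 h1] := eta_bounded i; have [b2 h2] := S_bounded j.
apply: (@cvg0_of_exp _ _ _ _ (n%:R * (2 * C) * b1 + n%:R * b2 * (2 * C))) => t t0.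
have -> : obs_velocity i t - obs_velocity j t =
    (S i t - S j t) *m eta i t + S j t *m (eta i t - eta j t).
  by rewrite mulmxBl mulmxBr addrA subrK.
apply: le_trans (ler_normD _ _) _; rewrite mulrDl; apply: lerD.
  apply: le_trans (norm_mulmx_le (S_diff i j t0) (h1 t t0)) _.
  by rewrite le_eqVlt; apply/orP; left; apply/eqP; ring.
apply: le_trans (norm_mulmx_le (h2 t t0) (eta_diff i j t0)) _.
by rewrite le_eqVlt; apply/orP; left; apply/eqP; ring.
Qed.

End ObserverSignals.

(** * Consensus *)

Section ClosedLoop.
Variables (R : realType) (N n p l : nat) (e : rel 'I_N) (a : 'M[R]_N).
Variables (mu1 mu2 alpha : R) (g : 'I_N -> agent R n p).
Variables (m : 'I_N -> internal_model R n l) (c : forall i, controller p (m i)).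
Variable d : forall i, disturbance (m i).
Implicit Types (t T : R) (i : 'I_N).

Definition observer_driven_solution (S : 'I_N -> R -> 'M[R]_n) (eta : 'I_N -> R -> 'cV[R]_n)
    i T :=
  agent_solution (g i) (c i) alpha (disturbance_signal (d i)) (eta i) (obs_velocity S eta i)
    (etad e a mu2 S eta i) (obs_acceleration e a mu1 mu2 S eta i) T.

Arguments observer_driven_solution : clear implicits.

Lemma closed_loop_solution x x0 : closed_loop e a mu1 mu2 alpha g c d x x0 ->
  forall i T, observer_driven_solution (tr_S x) (tr_eta x) i T
    (tr_q x i) (tr_v x i) (tr_xi x i) (tr_zeta x i) (tr_omega x i).
Proof.
move=> [_ h] i T.
have [[cq dq _] [cv mot _] [cxi dxi _] [cz dz _] [co do_ _]] := h i.
split; try exact: within_halfline.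
- by move=> t /andP[t0 _]; exact: dq.
- by move=> t /andP[t0 _]; exact: (mot t t0).
- by move=> t /andP[t0 _]; exact: (dxi t t0).
- by move=> t /andP[t0 _]; exact: (dz t t0).
- by move=> t /andP[t0 _]; exact: (do_ t t0).
Qed.

Lemma closed_loop_of_solutions (x : trajectory p m) (x0 : initial_data p m) :
  observer e a mu1 mu2 (S_init x0) (eta_init x0) (tr_S x) (tr_eta x) ->
  (forall i, starts_at (q_init x0 i) (v_init x0 i) (xi_init x0 i) (zeta_init x0 i)
     (omega_init x0 i) (tr_q x i) (tr_v x i) (tr_xi x i) (tr_zeta x i) (tr_omega x i)) ->
  (forall i T, observer_driven_solution (tr_S x) (tr_eta x) i T
    (tr_q x i) (tr_v x i) (tr_xi x i) (tr_zeta x i) (tr_omega x i)) ->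
  closed_loop e a mu1 mu2 alpha g c d x x0.
Proof.
move=> obs st sol; split => // i; have [s1 s2 s3 s4 s5] := st i.
have below (t : R) : 0 < t -> 0 < t < t + 1 by move=> ->; rewrite ltrDl ltr01.
split.
- split => //; first by apply: within_halfline_of => T; exact: sol_q (sol i T).
  by move=> t t0; exact: (sol_dq (sol i (t + 1)) (below t t0)).
- split => //; first by apply: within_halfline_of => T; exact: sol_v (sol i T).
  by move=> t t0; exact: (sol_dv (sol i (t + 1)) (below t t0)).
- split => //; first by apply: within_halfline_of => T; exact: sol_xi (sol i T).
  by move=> t t0; exact: (sol_dxi (sol i (t + 1)) (below t t0)).
- split => //; first by apply: within_halfline_of => T; exact: sol_zeta (sol i T).
  by move=> t t0; exact: (sol_dzeta (sol i (t + 1)) (below t t0)).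
- split => //; first by apply: within_halfline_of => T; exact: sol_om (sol i T).
  by move=> t t0; exact: (sol_dom (sol i (t + 1)) (below t t0)).
Qed.

Hypotheses (a0 : 0 < alpha) (hEL : forall i, euler_lagrange (g i)).
Hypotheses (hm : forall i, internal_model_design (m i)).
Hypotheses (hc : forall i, controller_design (g i) (c i)).
Hypothesis hd : forall i, disturbance_positive (d i).
Variables (S0 : 'I_N -> 'M[R]_n) (eta0 : 'I_N -> 'cV[R]_n).
Variables (S : 'I_N -> R -> 'M[R]_n) (eta : 'I_N -> R -> 'cV[R]_n).
Hypothesis obs : observer e a mu1 mu2 S0 eta0 S eta.
Variables (Sstar : 'M[R]_n) (w : R -> 'cV[R]_n) (C : R).
Hypothesis C0 : 0 <= C.
Hypothesis hS : forall i t, 0 <= t -> `|S i t - Sstar| <= C * expR (- t).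
Hypothesis heta : forall i t, 0 <= t -> `|eta i t - w t| <= C * expR (- t).
Hypothesis bw : bounded_on_halfline w.

Let im_decomp i : A_blk (m i) - B_blk (d_freq (d i)) =
  \sum_j im_varrho (m i) j (d_freq (d i)) *: im_E (m i) j.
Proof. by have [_ _ _ _ [_ h]] := hm i; have [_ hf] := hd i; exact: h. Qed.

Let ceta i : {within `[0, +oo[, continuous (eta i)}.
Proof. by have [_ []] := obs i. Qed.

Let deta i t : 0 < t -> is_derive t (1 : R) (eta i) (etad e a mu2 S eta i t).
Proof. by have [_ [_ h _]] := obs i; exact: h. Qed.

Lemma driven_solution_exists i q0 v0 xi0 zeta0 om0 : exists q v xi zeta om,
  starts_at q0 v0 xi0 zeta0 om0 q v xi zeta om /\
  forall T, observer_driven_solution S eta i T q v xi zeta om.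
Proof.
have [P [kM [kP LP]]] := lyapunov_M_blk (hm i).
have [th [dth hth [bth _ hbth]]] := steady_state (hm i) (hd i).
have [bs hbs] := observer_signals_bounded e a mu1 mu2 C0 hS heta bw i.
have cv : {within `[0, +oo[, continuous (obs_velocity S eta i)}.
  exact: (within_obs_velocity obs).
have dv t (t0 : 0 < t) : is_derive t (1 : R) (obs_velocity S eta i)
    (obs_acceleration e a mu1 mu2 S eta i t) := obs_velocity_derive obs i t0.
exact: (agent_solution_exists a0 (hEL i) (hc i) (im_decomp i) LP
  (@disturbance_continuous _ _ _ _ (d i)) dth hth hbth
  (@ceta i) cv (@within_etad _ _ _ _ _ _ _ _ _ _ _ obs i) (@within_obs_acceleration _ _ _ _ _ _ _ _ _ _ _ obs i)
  (@deta i) dv hbs).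
Qed.

Lemma driven_solution_tracks i q v xi zeta om :
  (forall T, observer_driven_solution S eta i T q v xi zeta om) ->
  [/\ bounded_on_halfline q, bounded_on_halfline v,
      q t - eta i t @[t --> +oo] --> (0 : 'cV[R]_n) &
      v t - obs_velocity S eta i t @[t --> +oo] --> (0 : 'cV[R]_n)].
Proof.
move=> sol; have [P [kM [kP LP]]] := lyapunov_M_blk (hm i).
have [th [dth hth [bth _ hbth]]] := steady_state (hm i) (hd i).
have [bs hbs] := observer_signals_bounded e a mu1 mu2 C0 hS heta bw i.
have cv : {within `[0, +oo[, continuous (obs_velocity S eta i)}.
  exact: (within_obs_velocity obs).
have dv t (t0 : 0 < t) : is_derive t (1 : R) (obs_velocity S eta i)
    (obs_acceleration e a mu1 mu2 S eta i t) := obs_velocity_derive obs i t0.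
have hmis : obs_velocity S eta i t - etad e a mu2 S eta i t @[t --> +oo] --> (0 : 'cV[R]_n).
  exact: (obs_velocity_mismatch e a mu2 S heta).
have [b _ hb] := solution_bounded a0 (hEL i) (hc i) (im_decomp i) LP dth hth hbth
  (@ceta i) cv (@deta i) dv hbs sol.
split.
- by exists b => t t0; have [] := hb t t0.
- by exists b => t t0; have [] := hb t t0.
- exact: (position_error_cvg0 a0 (hEL i) (hc i) (im_decomp i) LP dth hth hbth
    (@ceta i) cv (@deta i) dv hbs sol hmis).
- exact: (velocity_error_cvg0 a0 (hEL i) (hc i) (im_decomp i) LP dth hth hbth
    (@ceta i) cv (@deta i) dv hbs sol hmis).
Qed.

End ClosedLoop.

Section Consensus.
Variables (R : realType) (n : nat).

Lemma consensus_of_tracking (x1 x2 y1 y2 : R -> 'cV[R]_n) :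
  x1 t - y1 t @[t --> +oo] --> (0 : 'cV[R]_n) ->
  x2 t - y2 t @[t --> +oo] --> (0 : 'cV[R]_n) ->
  y1 t - y2 t @[t --> +oo] --> (0 : 'cV[R]_n) ->
  x1 t - x2 t @[t --> +oo] --> (0 : 'cV[R]_n).
Proof.
move=> h1 h2 h3.
have -> : (fun t => x1 t - x2 t) = (fun t => (x1 t - y1 t) - (x2 t - y2 t) + (y1 t - y2 t)).
  by apply/funext => t; apply/colP => i; rewrite !col_linE; ring.
have -> : (0 : 'cV[R]_n) = 0 - 0 + 0 by rewrite subr0 addr0.
exact: (cvgD (cvgB h1 h2) h3).
Qed.

End Consensus.

Theorem theorem1 (R : realType) (N n p l : nat) (e : rel 'I_N) (a : 'M[R]_N)
    (u : 'rV[R]_N) (S0 : 'I_N -> 'M[R]_n)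
    (hl : (0 < l)%N)
    (hadj : adjacency e a) (htree : has_spanning_tree e)
    (hu : (u <= eigenspace (laplacian a) 0)%MS) (hu1 : \sum_i u 0 i = 1) :
  let Sstar := \sum_i u 0 i *: S0 i in
  exists mu1s mu2s : R, [/\ 0 < mu1s, 0 < mu2s &
  forall mu1 mu2 : R, mu1s <= mu1 -> mu2s <= mu2 ->
  forall eta0 : 'I_N -> 'cV[R]_n,
  exists chi : 'cV[R]_n, common_limit e a mu1 mu2 Sstar S0 eta0 chi /\
  (bounded_on_halfline (fun t => Sstar *m common_trajectory Sstar chi t) ->
   bounded_on_halfline (common_trajectory Sstar chi) ->
   forall (alpha : R) (g : 'I_N -> agent R n p)
     (m : 'I_N -> internal_model R n l) (c : forall i, controller p (m i)),
   0 < alpha ->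
   (forall i, euler_lagrange (g i)) ->
   (forall i, internal_model_design (m i)) ->
   (forall i, controller_design (g i) (c i)) ->
   forall d : forall i, disturbance (m i),
   (forall i, disturbance_positive (d i)) ->
   forall x0 : initial_data p m, S_init x0 = S0 -> eta_init x0 = eta0 ->
   (exists x : trajectory p m, closed_loop e a mu1 mu2 alpha g c d x x0) /\
   (forall x : trajectory p m, closed_loop e a mu1 mu2 alpha g c d x x0 ->
      leaderless_consensus x))].
Proof.
move=> Sstar; have [mu1s [mu2s [m1 m2 H]]] := observer_consensus hadj htree hu hu1 S0.
exists mu1s, mu2s; split => // mu1 mu2 hm1 hm2 eta0.
have [[S [eta obs]] [chi [C C0 hC]]] := H mu1 mu2 hm1 hm2 eta0.
have est S' eta' (obs' : observer e a mu1 mu2 S0 eta0 S' eta') :=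
  hC S' eta' obs'.
exists chi; split.
  exists S, eta; split=> // i.
  have h t : 0 <= t -> `|expmx (- (t *: Sstar)) *m eta i t - chi| <= C * expR (- t).
    by move=> t0; have [] := est _ _ obs i t t0.
  have := @cvg0_of_exp R n 1 (fun t => expmx (- (t *: Sstar)) *m eta i t - chi) C h.
  by move/cvg_sub0; apply; exact: cvg_cst.
move=> _ bw alpha g m c a0 hEL hm hc d hd x0 eS eeta.
split.
  have hS i t : 0 <= t -> `|S i t - Sstar| <= C * expR (- t).
    by move=> t0; have [] := est _ _ obs i t t0.
  have heta i t : 0 <= t -> `|eta i t - common_trajectory Sstar chi t| <= C * expR (- t).
    by move=> t0; have [] := est _ _ obs i t t0.
  have ex i := driven_solution_exists a0 hEL hm hc hd obs C0 hS heta bw (i := i)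
    (q_init x0 i) (v_init x0 i) (xi_init x0 i) (zeta_init x0 i) (omega_init x0 i).
  have [q hq] := choice ex; have [v hv] := choice hq.
  pose X i := (R -> 'cV[R]_(im_dim (m i)))%type; pose Z i := (R -> 'M[R]_(im_dim (m i), p))%type.
  pose xi i : X i := projT1 (cid (hv i)).
  have hxi i := projT2 (cid (hv i)).
  pose zeta i : Z i := projT1 (cid (hxi i)).
  have hzeta i := projT2 (cid (hxi i)).
  have [om hom] := choice hzeta.
  exists (Trajectory S eta q v xi zeta om).
  apply: closed_loop_of_solutions; rewrite /= ?eS ?eeta //.
    by move=> i; have [] := hom i.
  by move=> i T; have [_] := hom i.
move=> x cl; have sol := closed_loop_solution cl.
have obs' : observer e a mu1 mu2 S0 eta0 (tr_S x) (tr_eta x).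
  by case: cl => h _; rewrite -eS -eeta.
have hS i t : 0 <= t -> `|tr_S x i t - Sstar| <= C * expR (- t).
  by move=> t0; have [] := est _ _ obs' i t t0.
have heta i t : 0 <= t -> `|tr_eta x i t - common_trajectory Sstar chi t| <= C * expR (- t).
  by move=> t0; have [] := est _ _ obs' i t t0.
have tr i := driven_solution_tracks a0 hEL hm hc hd obs' C0 hS heta bw (sol i).
split=> [i|i j]; first by have [] := tr i.
have [_ _ q1 v1] := tr i; have [_ _ q2 v2] := tr j.
split.
  exact: (consensus_of_tracking q1 q2 (@eta_agreement _ _ _ _ _ _ heta i j)).
exact: (consensus_of_tracking v1 v2 (@obs_velocity_agreement _ _ _ _ _ _ _ _ C0 hS heta bw i j)).
Qed.
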